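(* Let $Q_0\in\mathcal N$, $Q_0\ne0$, and let $r$ be a symmetric rational function with $\deg r>0$. Then $Q_0\in\mathcal N_0^0(r)$ (i.e. $rQ_0\in\mathcal N$) if and only if the following two conditions hold: (i) $0\le r\le\infty$ on $\sigma(Q_0)$, and if $-\infty<r(x)<0$, $x\in\mathbb R$, then $Q_0(x)\ne0$; (ii) every finite zero and every finite pole $\gamma$ of $r$ is real and of order at most two, and: (a) if $\gamma$ is a zero (respectively pole) of $r$ of order two, then $\gamma$ is an isolated pole of $Q_0$ (respectively an isolated zero of $Q_0$, i.e. $\gamma\in\rho(Q_0)$, $Q_0(\gamma)=0$) and, respectively, $$-\infty<\lim_{z\widehat\to\gamma}\frac{r(z)}{(z-\gamma)^2}<0\qquad\text{or}\qquad -\infty<\lim_{z\widehat\to\gamma}(z-\gamma)^2r(z)<0;$$ (b) if $\gamma$ is a zero (respectively pole) of $r$ of order one and $\iota_\gamma=\operatorname{sgn}\lim_{z\widehat\to\gamma}\frac{r(z)}{z-\gamma}$ (respectively $\iota_\gamma=\operatorname{sgn}\lim_{z\widehat\to\gamma}(z-\gamma)r(z)$), then, respectively, $$0<\lim_{z\widehat\to\gamma}\iota_\gamma Q_0(z)\le\infty\qquad\text{or}\qquad -\infty<\lim_{z\widehat\to\gamma}\iota_\gamma Q_0(z)\le0.$$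
   Context: A function $f$ is symmetric if $f(\bar z)=\overline{f(z)}$. $\mathcal N=\mathcal N_0$ is the class of (ordinary) Nevanlinna functions: symmetric functions $Q$ holomorphic on $\mathbb C\setminus\mathbb R$ with $\operatorname{Im}Q(z)/\operatorname{Im}z\ge0$ there; equivalently $Q(z)=\alpha+\beta z+\int_{\mathbb R}\left(\frac1{t-z}-\frac{t}{1+t^2}\right)d\sigma(t)$ with $\alpha\in\mathbb R$, $\beta\ge0$ and $\sigma$ a nonnegative Borel measure with $\int d\sigma(t)/(1+t^2)<\infty$. $\rho(Q)$ is the domain of holomorphy of $Q$ (including real points to which $Q$ extends holomorphically); $\sigma(Q)=\mathbb R\setminus\rho(Q)$ if $\beta=0$ and $\sigma(Q)=(\mathbb R\setminus\rho(Q))\cup\{\infty\}$ if $\beta>0$. For a nonconstant symmetric rational function $r$, $\mathcal N_0^0(r)=\{Q\in\mathcal N:\ rQ\in\mathcal N\}$. $z\,\widehat\to\,c$ ($c\in\mathbb R$) denotes the nontangential limit from the upper (or lower) half-plane; a limit equal to $\infty$ means that the modulus tends to $+\infty$. *)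

(* Defs.v *)
From HB Require Import structures.
From mathcomp Require Import all_boot all_order all_algebra.
From mathcomp Require Import complex.
From mathcomp Require Import all_classical all_reals all_analysis.

Set Implicit Arguments.
Unset Strict Implicit.
Unset Printing Implicit Defensive.

Import numFieldNormedType.Exports.

Local Open Scope classical_set_scope.
Local Open Scope ring_scope.
Local Open Scope complex_scope.

(* Functions defined on the non-real part of the plane are represented by total
   functions f : R[i] -> R[i]; the values f x at real x carry no information,
   and no definition below reads them off directly.

   The order on R[i] is the partial one in which [0 <= w] means that w is real
   and nonnegative; likewise [w < 0] entails that w is real. *)

Definition nonreal (R : realType) : set R[i] := [set z | Im z != 0].

Definition holo_at (R : realType) (f : R[i] -> R[i]) (z : R[i]) : Prop :=
  derivable (f : R[i]^o -> R[i]^o) z 1.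

Definition symmetric_fun (R : realType) (f : R[i] -> R[i]) : Prop :=
  forall z, nonreal z -> f z^* = (f z)^*.

Definition nevanlinna (R : realType) (Q : R[i] -> R[i]) : Prop :=
  [/\ forall z, nonreal z -> holo_at Q z,
      symmetric_fun Q &
      forall z, nonreal z -> 0 <= Im (Q z) / Im z].

Definition nev_kernel (R : realType) (z : R[i]) (t : R) : R[i] :=
  (t%:C - z)^-1 - (t / (1 + t ^+ 2))%:C.

(* Q(z) = alpha + beta z + \int (1/(t-z) - t/(1+t^2)) dsigma(t); the complex
   integral is taken componentwise, both components being integrable because
   the kernel is O(1/(1+t^2)) for each non-real z. *)
Definition integral_rep (R : realType) (Q : R[i] -> R[i]) (alpha beta : R)
    (sigma : {measure set (measurableTypeR R) -> \bar R}) : Prop :=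
  [/\ 0 <= beta,
      (\int[sigma]_t ((1 + t ^+ 2)^-1)%:E < +oo)%E &
      forall z, nonreal z ->
        Q z = alpha%:C + beta%:C * z
              + ((\int[sigma]_t Re (nev_kernel z t))
                 +i* (\int[sigma]_t Im (nev_kernel z t)))].

Definition linear_coeff (R : realType) (Q : R[i] -> R[i]) (beta : R) : Prop :=
  exists alpha sigma, integral_rep Q alpha beta sigma.

Definition holo_ext (R : realType) (Q g : R[i] -> R[i]) (z : R[i]) : Prop :=
  (\forall w \near (z : R[i]^o), holo_at g w) /\
  (\forall w \near (z : R[i]^o), nonreal w -> g w = Q w).

Definition rho (R : realType) (Q : R[i] -> R[i]) : set R[i] :=
  [set z | exists g, holo_ext Q g z].

(* [z \in rho(Q) and Q(z) = w], Q(z) being the value of the holomorphic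
   extension when z is real. *)
Definition has_value (R : realType) (Q : R[i] -> R[i]) (z w : R[i]) : Prop :=
  exists g, holo_ext Q g z /\ g z = w.

Definition isolated_pole (R : realType) (Q : R[i] -> R[i]) (z : R[i]) : Prop :=
  exists g : R[i] -> R[i],
  [/\ \forall w \near (z : R[i]^o)^', holo_at g w,
      \forall w \near (z : R[i]^o)^', nonreal w -> g w = Q w &
      (Re `|g w|) @[w --> (z : R[i]^o)^'] --> +oo].

Definition isolated_zero (R : realType) (Q : R[i] -> R[i]) (z : R[i]) : Prop :=
  has_value Q z 0.

(* A subset of R \cup {oo}, the point oo being None. *)
Definition spectrum (R : realType) (Q : R[i] -> R[i]) : set (option R) :=
  [set x | match x with
           | Some t => ~ rho Q t%:C
           | None => exists2 beta : R, 0 < beta & linear_coeff Q beta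
           end].

Record ratfun (R : realType) := RatFun {
  rnum : {poly R[i]};
  rden : {poly R[i]};
  rden_neq0 : rden != 0;
  rnum_coprime : coprimep rnum rden
}.

Definition rdeg (R : realType) (r : ratfun R) : nat :=
  maxn (size (rnum r)).-1 (size (rden r)).-1.

(* r as a map of the Riemann sphere option R[i] to itself, with None = oo. At oo
   and for deg(rnum) <= deg(rden), the numerator of the quotient below is the
   coefficient of degree deg(rden) of rnum, hence 0 if deg(rnum) < deg(rden). *)
Definition rsph (R : realType) (r : ratfun R) (x : option R[i]) : option R[i] :=
  match x with
  | Some z => if root (rden r) z then None
              else Some ((rnum r).[z] / (rden r).[z])
  | None => if (size (rden r) < size (rnum r))%N then None
            else Some ((rnum r)`_(size (rden r)).-1 / lead_coef (rden r))
  end.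

(* r as a function C -> C; the value at a pole of r is irrelevant. *)
Definition rfun (R : realType) (r : ratfun R) (z : R[i]) : R[i] :=
  (rnum r).[z] / (rden r).[z].

Definition rsymmetric (R : realType) (r : ratfun R) : Prop :=
  forall z : R[i], rsph r (Some z^*) = omap (fun w => w^*) (rsph r (Some z)).

(* Order of a finite zero, resp. pole: the order is 0 at other points. *)
Definition zero_order (R : realType) (r : ratfun R) (z : R[i]) : nat :=
  mup z (rnum r).
Definition pole_order (R : realType) (r : ratfun R) (z : R[i]) : nat :=
  mup z (rden r).

(* [rQ \in N] is a statement about the meromorphic function rQ, whence the
   quantification over F: the points where r has a pole are not compared. *)
Definition N00 (R : realType) (r : ratfun R) (Q : R[i] -> R[i]) : Prop :=
  nevanlinna Q /\
  exists2 F, nevanlinna F &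
    forall z, nonreal z -> ~~ root (rden r) z -> F z = rfun r z * Q z.

(* Nontangential limits are taken from the upper half-plane; for symmetric f the
   lower half-plane yields the conjugate limit. A limit equal to oo only asks
   that the modulus tend to +oo. *)
Definition stolz (R : realType) (c M : R) : set R[i]^o :=
  [set z | 0 < Im z /\ `|Re z - c| <= M * Im z].

Definition nt_lim (R : realType) (f : R[i] -> R[i]) (c : R) (l : R[i]) : Prop :=
  forall M : R, 0 < M ->
    f z @[z --> within (stolz c M) (nbhs (c%:C : R[i]^o))] --> (l : R[i]^o).

Definition nt_lim_oo (R : realType) (f : R[i] -> R[i]) (c : R) : Prop :=
  forall M : R, 0 < M ->
    (Re `|f z|) @[z --> within (stolz c M) (nbhs (c%:C : R[i]^o))] --> +oo.

Definition ge0_sph (R : realType) (v : option R[i]) : Prop :=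
  if v is Some w then 0 <= w else True.

Definition lt0_sph (R : realType) (v : option R[i]) : Prop :=
  if v is Some w then w < 0 else False.

Definition cond_i (R : realType) (r : ratfun R) (Q : R[i] -> R[i]) : Prop :=
  (forall x : option R, spectrum Q x ->
     ge0_sph (rsph r (omap (fun t : R => t%:C) x))) /\
  (forall x : R, lt0_sph (rsph r (Some x%:C)) -> ~ has_value Q x%:C 0).

Definition cond_ii_order (R : realType) (r : ratfun R) : Prop :=
  forall z : R[i],
    ((0 < zero_order r z)%N -> Im z = 0 /\ (zero_order r z <= 2)%N) /\
    ((0 < pole_order r z)%N -> Im z = 0 /\ (pole_order r z <= 2)%N).

Definition cond_ii_a (R : realType) (r : ratfun R) (Q : R[i] -> R[i]) : Prop :=
  forall c : R,
    (zero_order r c%:C = 2%N ->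
       isolated_pole Q c%:C /\
       exists2 l : R, nt_lim (fun z => rfun r z / (z - c%:C) ^+ 2) c l%:C
                    & l < 0) /\
    (pole_order r c%:C = 2%N ->
       isolated_zero Q c%:C /\
       exists2 l : R, nt_lim (fun z => (z - c%:C) ^+ 2 * rfun r z) c l%:C
                    & l < 0).

Definition cond_ii_b (R : realType) (r : ratfun R) (Q : R[i] -> R[i]) : Prop :=
  forall c : R,
    (zero_order r c%:C = 1%N ->
       exists2 l : R, nt_lim (fun z => rfun r z / (z - c%:C)) c l%:C &
         (exists2 q : R, nt_lim (fun z => (Num.sg l)%:C * Q z) c q%:C & 0 < q) \/
         nt_lim_oo (fun z => (Num.sg l)%:C * Q z) c) /\
    (pole_order r c%:C = 1%N ->
       exists2 l : R, nt_lim (fun z => (z - c%:C) * rfun r z) c l%:C &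
         exists2 q : R, nt_lim (fun z => (Num.sg l)%:C * Q z) c q%:C & q <= 0).

(* Main.v *)
Require Import Defs.
From mathcomp Require Import all_boot all_order all_algebra.
From mathcomp Require Import complex.
From mathcomp Require Import all_classical all_reals all_analysis.
From mathcomp Require Import ring lra.

Set Implicit Arguments.
Unset Strict Implicit.
Unset Printing Implicit Defensive.

Import Order.TTheory GRing.Theory Num.Theory.
Import numFieldNormedType.Exports.
Import Normc.

Local Open Scope classical_set_scope.
Local Open Scope ring_scope.
Local Open Scope complex_scope.

Local Notation Re := (@complex.Re _).
Local Notation Im := (@complex.Im _).
Local Notation "z ^*" := (conjc z) : ring_scope.

(* The Schwarz-Pick inequality [Im z |Q'(z)| <= Im Q(z)] does the work of the integral
   representation.

   Necessity, with [F = r Q].  Where [r < 0] on the real line, [Im Q >= 0] and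
   [Im F >= 0] force [|Q'| <= C |Q|]; hence [Q] has real nonzero boundary values there
   and extends by reflection.  On a vertical line both [|Q|] and [|F|] stay between
   multiples of [y] and of [1/y], so zeros of [r] have order at most two; for order two
   the same comparison, carried into the sectors along the real line by Schwarz-Pick,
   gives [|Q| >= C / |z - c|].  At a simple zero [Q] and [F] both increase on the side
   where [r < 0], which determines the sign of [Q] there, and by Lindelof's theorem the
   nontangential limit is the limit along that side.  Poles reduce to zeros by passing
   from [(r, Q, F)] to [(1/r, -1/Q, -1/F)].

   Sufficiency.  As its zeros and poles are real, [r] has a continuous argument on the
   closed upper half-plane off the zeros and poles, with jump [pi] times the order at
   each of them.  Conditions (i) and (ii) say that the argument which [r] must have for
   [arg (r Q)] to lie in [0, pi] on the boundary ([0] where [r > 0], [pi] or [- pi]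
   where [r < 0], according to the sign of [Q]) has the same jumps.  So [arg Q + arg r],
   suitably normalized, has boundary values in [0, pi] off a finite set, and a
   Phragmen-Lindelof principle for arguments concludes. *)

(** Nothing is known beforehand about $Q$ on the real line: boundary values exist only where sign
    conditions create them. Estimates therefore start in the open half-plane and travel along paths.
    Schwarz-Pick is a differential inequality for $|Q|$ along a path, and [gronwall] integrates it:
    on vertical lines it costs powers of the height, at height [m] the factor [expR (length / m)],
    and where the multiplier is negative a factor independent of the height, which is what lets the
    real line be reached. The integral representation enters only through [b * y <= Im (Q (iy))],
    used at oo.

    For sufficiency, the argument of $rQ$ is controlled on the real line only off finitely many
    points, and not at oo. Since it is bounded, this is repaired by barriers that are themselves
    arguments, built from angles under which short or long segments are seen. Comparing jumps
    determines the argument of $r$ only up to an additive constant; one real point where $r$ is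
    finite and nonzero shows that this constant is a multiple of $2\pi$. *)

Section Caratheodory.
Variable K : numFieldType.
Implicit Types (f g : K -> K) (z w c d e : K).

Definition ccont f z : Prop := {for z, continuous (f : K^o -> K^o)}.

Lemma ccont_cst c z : ccont (fun=> c) z.
Proof. exact: cst_continuous. Qed.

Lemma ccont_id z : ccont id z.
Proof. by move=> A. Qed.

Lemma ccontD f g z : ccont f z -> ccont g z -> ccont (fun w => f w + g w) z.
Proof. exact: continuousD. Qed.

Lemma ccontN f z : ccont f z -> ccont (fun w => - f w) z.
Proof. exact: continuousN. Qed.

Lemma ccontB f g z : ccont f z -> ccont g z -> ccont (fun w => f w - g w) z.
Proof. exact: continuousB. Qed.

Lemma ccontM f g z : ccont f z -> ccont g z -> ccont (fun w => f w * g w) z.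
Proof. exact: continuousM. Qed.

Lemma ccontV f z : f z != 0 -> ccont f z -> ccont (fun w => (f w)^-1) z.
Proof. exact: continuousV. Qed.

Lemma ccont_comp f g z : ccont f (g z) -> ccont g z -> ccont (fun w => f (g w)) z.
Proof. by move=> cf cg; exact: (@continuous_comp K^o K^o K^o g f z). Qed.

Lemma ccont_near f g z : (\forall w \near (z : K^o), f w = g w) ->
  ccont f z -> ccont g z.
Proof.
move=> fg cf A; rewrite -(nbhs_singleton fg) => /cf fA.
by apply: filterS2 fg fA => w /= ->.
Qed.

Lemma ccont_neq0 f z : ccont f z -> f z != 0 -> \forall w \near (z : K^o), f w != 0.
Proof.
by move=> cf fz; exact: cvgr_neq0 cf fz.
Qed.

(* Caratheodory's form of [f'(z) = d]: the algebra of derivatives reduces to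
   that of continuous functions. *)
Definition cder f z d := exists phi,
  [/\ ccont phi z, phi z = d & forall w, f w = f z + phi w * (w - z)].

Definition slope f z d w := if w == z then d else (f w - f z) / (w - z).

Lemma slopeE f z d w : f w = f z + slope f z d w * (w - z).
Proof.
rewrite /slope; case: eqVneq => [->|wz]; first by rewrite subrr mulr0 addr0.
by rewrite divfK ?subr_eq0// addrC subrK.
Qed.

Lemma cder_slope f z d : cder f z d <-> ccont (slope f z d) z.
Proof.
split=> [[phi [cphi phiz fE]]|cs].
  apply: ccont_near cphi; near=> w.
  rewrite /slope; case: eqVneq => [->//|wz].
  by rewrite fE addrC addKr mulfK ?subr_eq0.
exists (slope f z d); split => //; first by rewrite /slope eqxx.
exact: slopeE.
Unshelve. all: by end_near. Qed.

Lemma cder_cont f z d : cder f z d -> ccont f z.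
Proof.
move=> [phi [cphi phiz fE]].
have : ccont (fun w => f z + phi w * (w - z)) z.
  exact: (ccontD (@ccont_cst _ _)
    (ccontM cphi (ccontB (@ccont_id _) (@ccont_cst _ _)))).
by apply: ccont_near; near=> w; rewrite -fE.
Unshelve. all: by end_near. Qed.

Lemma cder_near f g z d : (\forall w \near (z : K^o), f w = g w) ->
  cder f z d -> cder g z d.
Proof.
move=> fg /cder_slope fd; apply/cder_slope; apply: ccont_near fd.
near=> w; rewrite /slope (nbhs_singleton fg) (_ : f w = g w)//.
by near: w.
Unshelve. all: by end_near. Qed.

Lemma cder_cst c z : cder (fun=> c) z 0.
Proof. by exists (fun=> 0); split=> // [|w]; [exact: ccont_cst|rewrite mul0r addr0]. Qed.

Lemma cder_id z : cder id z 1.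
Proof.
by exists (fun=> 1); split=> // [|w]; [exact: ccont_cst|rewrite mul1r addrC subrK].
Qed.

Lemma cderD f g z d e : cder f z d -> cder g z e ->
  cder (fun w => f w + g w) z (d + e).
Proof.
move=> [p [cp <- fE]] [q [cq <- gE]]; exists (fun w => p w + q w); split=> //.
  exact: ccontD.
by move=> w; rewrite fE gE; ring.
Qed.

Lemma cderN f z d : cder f z d -> cder (fun w => - f w) z (- d).
Proof.
move=> [p [cp <- fE]]; exists (fun w => - p w); split=> //; first exact: ccontN.
by move=> w; rewrite fE; ring.
Qed.

Lemma cderB f g z d e : cder f z d -> cder g z e ->
  cder (fun w => f w - g w) z (d - e).
Proof. by move=> fd /cderN; exact: cderD. Qed.

Lemma cderM f g z d e : cder f z d -> cder g z e ->
  cder (fun w => f w * g w) z (d * g z + f z * e).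
Proof.
move=> fd gd; have cg := cder_cont gd.
move: fd gd => [p [cp <- fE]] [q [cq <- gE]].
exists (fun w => p w * g w + f z * q w); split=> //.
  by apply: ccontD; apply: ccontM => //; exact: ccont_cst.
by move=> w; rewrite fE mulrDl {1}gE; ring.
Qed.

Lemma cderV f z d : f z != 0 -> cder f z d ->
  cder (fun w => (f w)^-1) z (- d / f z ^+ 2).
Proof.
move=> fz fd; have cf := cder_cont fd.
have nz := ccont_neq0 cf fz.
move: fd => [p [cp <- fE]]; apply/cder_slope.
have : ccont (fun w => - p w / (f w * f z)) z.
  apply: ccontM; first exact: ccontN.
  by apply: ccontV; rewrite ?mulf_neq0//; apply: ccontM => //; exact: ccont_cst.
apply: ccont_near; apply: filterS nz => w fw.
rewrite /slope; case: eqVneq => [->|wz]; first by rewrite expr2.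
have wz0 : w - z != 0 by rewrite subr_eq0.
have -> : p w = (f w - f z) / (w - z).
  by rewrite [in RHS]fE addrC addKr mulfK.
by field; rewrite fw fz wz0.
Qed.

Lemma cder_comp f g z d e : cder f (g z) d -> cder g z e ->
  cder (fun w => f (g w)) z (d * e).
Proof.
move=> [p [cp <- fE]] gd; have cg := cder_cont gd.
move: gd => [q [cq <- gE]].
exists (fun w => p (g w) * q w); split=> //.
  by apply: ccontM => //; apply: ccont_comp.
by move=> w; rewrite fE -mulrA; congr (_ + _ * _); rewrite gE addrC addKr.
Qed.

Lemma cderZ c f z d : cder f z d -> cder (fun w => c * f w) z (c * d).
Proof.
by move=> fd; have := cderM (cder_cst c z) fd; rewrite mul0r add0r.
Qed.

Lemma cder_subc w z : cder (fun u => u - w) z 1.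
Proof. by have := cderB (cder_id z) (cder_cst w z); rewrite subr0. Qed.

Lemma ccont_inv_sub w z : z - w != 0 -> ccont (fun u => (u - w)^-1) z.
Proof.
move=> zw; apply: (@ccontV (fun u => u - w)) => //.
exact: (cder_cont (cder_subc w z)).
Qed.

Lemma cder_inv_sub w z : z - w != 0 ->
  cder (fun u => (u - w)^-1) z (- 1 / (z - w) ^+ 2).
Proof. by move=> zw; apply: (@cderV (fun u => u - w)) => //; exact: cder_subc. Qed.

Lemma cder_slope_neq f a d z k : z != a -> cder f z k ->
  exists k', cder (slope f a d) z k'.
Proof.
move=> za fk; have za0 : z - a != 0 by rewrite subr_eq0.
have H := cderM (cderB fk (cder_cst (f a) z)) (cder_inv_sub za0).
eexists; apply: cder_near H; near=> v; rewrite /slope ifN// -subr_eq0.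
near: v; exact: (ccont_neq0 (cder_cont (cder_subc a z))).
Unshelve. all: by end_near. Qed.

(* The combination [f (1 - Re (u^* e^{it}))] on the circle of radius [r] about [a]
   is the trace of such a function, up to a term of mean zero. *)
Definition pick_aux f a d c1 c2 z := f z - c1 * (z - a) * f z - c2 * slope f a d z.

Lemma ccont_pick_aux f a d c1 c2 : cder f a d -> ccont (pick_aux f a d c1 c2) a.
Proof.
move=> fd; have cf := cder_cont fd.
apply: ccontB; last by apply: ccontM; [exact: ccont_cst|apply/cder_slope].
apply: ccontB => //; apply: ccontM => //; apply: ccontM; first exact: ccont_cst.
exact: (cder_cont (cder_subc _ _)).
Qed.

(** At [a] itself the slope is only known to be continuous; this is why [mean_value] asks for
    derivatives off the centre and for mere continuity at it. *)
Lemma cder_pick_aux f a d c1 c2 z k : z != a -> cder f z k ->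
  exists k', cder (pick_aux f a d c1 c2) z k'.
Proof.
move=> za fk; have [k' sk] := cder_slope_neq d za fk.
eexists; apply: cderB; last by apply: cderM; [exact: cder_cst|exact: sk].
apply: cderB; first exact: fk.
apply: cderM; last exact: fk.
by apply: cderM; [exact: cder_cst|exact: cder_subc].
Qed.

End Caratheodory.

(** * Real-valued modulus, real and imaginary parts, and the link between [holo_at] and [cder] *)

Section ComplexNorm.
Variable R : realType.
Implicit Types (z w : R[i]) (x y t : R).

Lemma normC_normc z : `|z| = (normc z)%:C.
Proof. by []. Qed.

Lemma normc_ge0 z : 0 <= normc z.
Proof. by case: z => a b; rewrite /normc sqrtr_ge0. Qed.

Lemma normc_sqr z : normc z ^+ 2 = Re z ^+ 2 + Im z ^+ 2.
Proof. by case: z => a b; rewrite /normc sqr_sqrtr ?addr_ge0 ?sqr_ge0. Qed.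

Lemma normc_eq0 z : (normc z == 0) = (z == 0).
Proof. by apply/eqP/eqP => [/eq0_normc//|->]; rewrite normc0. Qed.

Lemma normc_gt0 z : (0 < normc z) = (z != 0).
Proof. by rewrite lt_def normc_ge0 andbT normc_eq0. Qed.

Lemma normcB z w : normc (z - w) = normc (w - z).
Proof. by rewrite -normcN opprB. Qed.

Lemma le_normcB z w : normc (z - w) <= normc z + normc w.
Proof. by rewrite -(normcN w); exact: le_normcD. Qed.

Lemma ler_normcB z w : normc z - normc w <= normc (z - w).
Proof. by rewrite lerBlDr -{1}(subrK w z); exact: le_normcD. Qed.

Lemma normcX z n : normc (z ^+ n) = normc z ^+ n.
Proof.
elim: n => [|n IH]; first by rewrite !expr0 normc1.
by rewrite !exprS normcM IH.
Qed.

Lemma normcR x : normc x%:C = `|x|.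
Proof. by rewrite /normc /= expr0n /= addr0 sqrtr_sqr. Qed.

Lemma normcJ z : normc z^* = normc z.
Proof. by case: z => a b; rewrite /normc /= sqrrN. Qed.

Lemma normc_Re z : `|Re z| <= normc z.
Proof.
rewrite -(ler_pXn2r (n := 2)) ?nnegrE ?normc_ge0// normc_sqr real_normK ?num_real//.
by rewrite lerDl sqr_ge0.
Qed.

Lemma normc_Im z : `|Im z| <= normc z.
Proof.
rewrite -(ler_pXn2r (n := 2)) ?nnegrE ?normc_ge0// normc_sqr real_normK ?num_real//.
by rewrite lerDr sqr_ge0.
Qed.

Lemma normc_le_ReIm z : normc z <= `|Re z| + `|Im z|.
Proof.
rewrite -(ler_pXn2r (n := 2)) ?nnegrE ?normc_ge0 ?addr_ge0// normc_sqr.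
rewrite sqrrD !real_normK ?num_real// -addrA lerD2l lerDr.
by rewrite mulrn_wge0// mulr_ge0.
Qed.

Lemma ReD z w : Re (z + w) = Re z + Re w. Proof. by case: z w => ? ? [? ?]. Qed.

Lemma ImD z w : Im (z + w) = Im z + Im w. Proof. by case: z w => ? ? [? ?]. Qed.

Lemma ReN z : Re (- z) = - Re z. Proof. by case: z. Qed.

Lemma ImN z : Im (- z) = - Im z. Proof. by case: z. Qed.

Lemma ReB z w : Re (z - w) = Re z - Re w. Proof. by rewrite ReD ReN. Qed.

Lemma ImB z w : Im (z - w) = Im z - Im w. Proof. by rewrite ImD ImN. Qed.

Lemma ReM z w : Re (z * w) = Re z * Re w - Im z * Im w.
Proof. by case: z w => ? ? [? ?]. Qed.

Lemma ImM z w : Im (z * w) = Re z * Im w + Im z * Re w.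
Proof. by case: z w => ? ? [? ?]. Qed.

Lemma ReJ z : Re z^* = Re z. Proof. by case: z. Qed.

Lemma ImJ z : Im z^* = - Im z. Proof. by case: z. Qed.

Lemma ReRM x z : Re (x%:C * z) = x * Re z.
Proof. by rewrite ReM /= mul0r subr0. Qed.

Lemma ImRM x z : Im (x%:C * z) = x * Im z.
Proof. by rewrite ImM /= mul0r addr0. Qed.

Lemma ReV z : Re z^-1 = Re z / normc z ^+ 2.
Proof. by rewrite normc_sqr; case: z. Qed.

Lemma ImV z : Im z^-1 = - Im z / normc z ^+ 2.
Proof. by rewrite normc_sqr; case: z => a b /=; rewrite mulNr. Qed.

Lemma eq_ReIm z w : Re z = Re w -> Im z = Im w -> z = w.
Proof. by case: z w => ? ? [? ?] /= -> ->. Qed.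

Lemma ReImE z : z = Re z +i* Im z. Proof. by case: z. Qed.

Lemma real_of_Im0 z : Im z = 0 -> z = (Re z)%:C.
Proof. by case: z => a b /= ->. Qed.

Lemma RCM x y : (x * y)%:C = x%:C * y%:C :> R[i]. Proof. exact: rmorphM. Qed.

Lemma RCV x : (x^-1)%:C = x%:C^-1 :> R[i]. Proof. exact: fmorphV. Qed.

Lemma conjcM z w : (z * w)^* = z^* * w^*. Proof. exact: rmorphM. Qed.

Lemma conjcB z w : (z - w)^* = z^* - w^*. Proof. exact: rmorphB. Qed.

Lemma conjcc z : z^*^* = z. Proof. exact: conjcK. Qed.

Lemma nonreal_neq0 z : Im z != 0 -> z != 0.
Proof. by apply: contraNneq => ->. Qed.

(** The norm of [R[i]^o] takes its values in [R[i]], so the radius of a ball is a complex number;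
    being positive, it is real. From here on all radii are taken in [R]. *)
Lemma nbhsCP (P : set R[i]) z : nbhs (z : R[i]^o) P <->
  exists2 d : R, 0 < d & forall w, normc (w - z) < d -> P w.
Proof.
split => [/nbhs_ballP[e /= e0 eP]|[d d0 dP]].
  have [k ek] : exists k : R, e = k%:C.
    by apply/complex_realP; rewrite gtr0_real.
  exists k; first by rewrite -ltcR -ek.
  move=> w wz; apply: eP; rewrite -ball_normE /= ek normC_normc ltcR normcB.
  exact: wz.
apply/nbhs_ballP; exists d%:C => /=; first by rewrite ltcR.
by move=> w; rewrite -ball_normE /= normC_normc ltcR normcB; exact: dP.
Qed.

Lemma ccontP f z : ccont f z <-> forall e : R, 0 < e ->
  exists2 d : R, 0 < d & forall w, normc (w - z) < d -> normc (f w - f z) < e.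
Proof.
split => [fz e e0|fz A /nbhsCP[e e0 eA]].
  apply/nbhsCP.
  have := fz [set u | normc (u - f z) < e].
  by apply; apply/nbhsCP; exists e.
have [d d0 dP] := fz e e0.
by apply/nbhsCP; exists d => // w /dP /eA.
Qed.

Lemma cderP f z d : cder f z d <-> forall e : R, 0 < e ->
  exists2 r : R, 0 < r & forall w, normc (w - z) < r ->
    normc (f w - f z - d * (w - z)) <= e * normc (w - z).
Proof.
split=> [[phi [/ccontP cphi phiz fE]] e /cphi[r r0 rP]|H].
  exists r => // w /rP; rewrite phiz => /ltW H.
  by rewrite fE (addrC (f z)) addrK -mulrBl normcM ler_wpM2r ?normc_ge0.
apply/cder_slope/ccontP => e e0.
have [|r r0 rP] := H (e / 2); first by rewrite divr_gt0.
exists r => // w /rP; rewrite /slope eqxx; case: eqVneq => [->|wz].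
  by rewrite (subrr d) normc0.
have wz0 : w - z != 0 by rewrite subr_eq0.
have -> : (f w - f z) / (w - z) - d = (f w - f z - d * (w - z)) / (w - z).
  by field.
move=> Hw; rewrite normcM normcV ltr_pdivrMr ?normc_gt0//.
apply: le_lt_trans Hw _; rewrite ltr_pM2r ?normc_gt0//.
by rewrite ltr_pdivrMr// ltr_pMr// ltr1n.
Qed.

Lemma holo_atP f z : holo_at f z <-> exists d, cder f z d.
Proof.
split=> [H|[d fd]].
  exists ('D_1 (f : R[i]^o -> R[i]^o) z).
  apply/cderP => e e0.
  have /cvg_ex[/= l lP] := H.
  have := cvg_lim (@norm_hausdorff _ _) lP => lE.
  rewrite /derive lE.
  have /(_ [set u | normc (u - l) < e]) := lP.
  case/(_ _)/nbhsCP; first by apply/nbhsCP; exists e.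
  move=> r r0 rP; exists r => // w wr.
  have [->|wz] := eqVneq w z; first by rewrite !subrr mulr0 subr0 normc0 mulr0.
  have wz0 : w - z != 0 by rewrite subr_eq0.
  have := rP (w - z); rewrite subr0 => /(_ wr wz0) /=.
  rewrite [_ *: 1]mulr1 subrK => /ltW H1.
  have -> : f w - f z - l * (w - z) = ((w - z)^-1 *: (f w - f z) - l) * (w - z).
    by rewrite /GRing.scale /=; field.
  by rewrite normcM ler_wpM2r ?normc_ge0.
apply/cvg_ex; exists d => A /nbhsCP[e e0 eA].
move/cderP : fd => /(_ (e / 2)) [|r r0 rP]; first by rewrite divr_gt0.
apply/nbhsCP; exists r => // h; rewrite subr0 => hr h0 /=.
apply: eA; rewrite [_ *: 1]mulr1.
have := rP (h + z); rewrite addrK => /(_ hr) H1.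
have -> : h^-1 *: (f (h + z) - f z) - d = (f (h + z) - f z - d * h) / h.
  by rewrite /GRing.scale /=; field.
rewrite normcM normcV ltr_pdivrMr ?normc_gt0//.
apply: le_lt_trans H1 _; rewrite ltr_pM2r ?normc_gt0//.
by rewrite ltr_pdivrMr// ltr_pMr// ltr1n.
Qed.

End ComplexNorm.

(** * Compactness of segments, and integrals of continuous real functions *)

Section RealIntegral.
Variable R : realType.
Implicit Types (a b c t x y M : R) (f g : R -> R).

Lemma rcontP f t : {for t, continuous f} <-> forall e : R, 0 < e ->
  exists2 d : R, 0 < d & forall s, `|s - t| < d -> `|f s - f t| < e.
Proof.
split=> [/cvgrPdist_lt ft e /ft/nbhs_ballP[d /= d0 dP]|ft].
  exists d => // s sd; rewrite distrC; apply: dP.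
  by rewrite /ball /= distrC.
apply/cvgrPdist_lt => e /ft[d d0 dP]; apply/nbhs_ballP; exists d => // s.
by rewrite /ball /= distrC => /dP; rewrite distrC.
Qed.

(** This is the form in which compactness of [[a, b]] serves throughout: for bounds, for uniform
    continuity and for maxima. Stability under passage to a smaller [d] plays the part of taking the
    least radius of a finite subcover. *)
Lemma segment_uniform a b (P : R -> R -> Prop) :
  (forall t d d', P t d -> 0 < d' -> d' <= d -> P t d') ->
  (forall t, a <= t <= b -> exists2 d : R, 0 < d &
     forall s, `|s - t| < d -> a <= s <= b -> P s d) ->
  exists2 d : R, 0 < d & forall s, a <= s <= b -> P s d.
Proof.
move=> Pmono Ploc.
have /compact_near_coveringP/near_covering_withinP cab := @segment_compact R a b.
have : \forall d \near (0 : R)^'+, `[a, b]%classic `<=` P^~ d.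
  apply: cab => t; rewrite /= in_itv /= => /Ploc[d d0 dP].
  exists (ball t d, [set e | 0 < e <= d]).
    split=> /=; first exact: nbhsx_ballx.
    near=> e; apply/andP; split; first by near: e; exact: nbhs_right_gt.
    by near: e; exact: nbhs_right_le.
  move=> [s e] /= [ts /andP[e0 ed]]; rewrite /= in_itv /= => sab.
  by apply: Pmono ed => //; apply: dP => //; rewrite distrC.
move=> H.
have : \forall d \near (0 : R)^'+, 0 < d /\ (`[a, b]%classic `<=` P^~ d).
  near=> d; split; last by near: d.
  by near: d; exact: nbhs_right_gt.
by case/filter_ex => d [d0 dP]; exists d => // s sab; apply: dP; rewrite /= in_itv.
Unshelve. all: by end_near. Qed.

Definition rcon a b f := forall t, a <= t <= b -> {for t, continuous f}.

Lemma rcon_within a b f : rcon a b f -> {within `[a, b], continuous f}.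
Proof.
move=> cf; apply: continuous_in_subspaceT => t; rewrite inE /= in_itv /=.
exact: cf.
Qed.

Lemma rcon_bounded a b f : rcon a b f ->
  exists2 M : R, 0 < M & forall t, a <= t <= b -> `|f t| <= M.
Proof.
move=> cf.
(* A bound is encoded as the inverse of [d], because [segment_uniform] produces small numbers and
   not large ones. *)
pose P t d := `|f t| <= d^-1.
suff [d d0 dP] : exists2 d : R, 0 < d & forall t, a <= t <= b -> P t d.
  by exists d^-1; rewrite ?invr_gt0.
apply: segment_uniform => [t d d' H d'0 d'd|t tab].
  by apply: le_trans H _; rewrite lef_pV2 ?posrE// (lt_le_trans d'0).
have [e e0 eP] := (rcontP f t).1 (cf t tab) 1 ltr01.
have p0 : 0 < (`|f t| + 1)^-1 by rewrite invr_gt0 ltr_pwDr.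
exists (Num.min e (`|f t| + 1)^-1); first by rewrite lt_min e0.
move=> s; rewrite lt_min => /andP[/eP H _] _.
have : `|f s| <= `|f t| + 1.
  by rewrite -lerBlDl; apply: le_trans (lerB_dist _ _) (ltW H).
move/le_trans; apply; rewrite -[leLHS]invrK lef_pV2 ?posrE ?ge_min ?lexx ?orbT//.
by rewrite lt_min e0.
Qed.

Definition rint a b f : R := \int[@lebesgue_measure R]_(x in `[a, b]) f x.

Lemma rcon_int a b f : rcon a b f ->
  (@lebesgue_measure R).-integrable `[a, b] (EFin \o f).
Proof.
move=> cf; apply: continuous_compact_integrable; first exact: segment_compact.
exact: rcon_within.
Qed.

Lemma rint_eq a b f g : (forall t, a <= t <= b -> f t = g t) ->
  rint a b f = rint a b g.
Proof.
move=> fg; apply: eq_Rintegral => t; rewrite inE /= in_itv /=; exact: fg.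
Qed.

Lemma rconD a b f g : rcon a b f -> rcon a b g -> rcon a b (fun t => f t + g t).
Proof. by move=> cf cg t tab; apply: (@continuousD R R); [exact: cf|exact: cg]. Qed.

Lemma rconM a b f g : rcon a b f -> rcon a b g -> rcon a b (fun t => f t * g t).
Proof. by move=> cf cg t tab; apply: (@continuousM R R); [exact: cf|exact: cg]. Qed.

Lemma rcon_cst a b c : rcon a b (fun=> c).
Proof. by move=> t _; exact: cst_continuous. Qed.

Lemma rconN a b f : rcon a b f -> rcon a b (fun t => - f t).
Proof. by move=> cf t tab; apply: (@continuousN R R); exact: cf. Qed.

Lemma rconS a b c d f : a <= c -> d <= b -> rcon a b f -> rcon c d f.
Proof.
move=> ac db cf t /andP[ct td]; apply: cf.
by rewrite (le_trans ac ct) (le_trans td db).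
Qed.

Lemma rintD a b f g : rcon a b f -> rcon a b g ->
  rint a b (fun t => f t + g t) = rint a b f + rint a b g.
Proof. by move=> cf cg; rewrite /rint RintegralD//; exact: rcon_int. Qed.

Lemma rintZ a b c f : rcon a b f -> rint a b (fun t => c * f t) = c * rint a b f.
Proof. by move=> cf; rewrite /rint RintegralZl//; exact: rcon_int. Qed.

Lemma rintN a b f : rcon a b f -> rint a b (fun t => - f t) = - rint a b f.
Proof.
move=> cf; rewrite -mulN1r -rintZ//; apply: rint_eq => t _.
by rewrite mulN1r.
Qed.

Lemma rint_cst a b c : a <= b -> rint a b (fun=> c) = c * (b - a).
Proof.
move=> ab; rewrite /rint Rintegral_cst//= lebesgue_measure_itv /= lte_fin.
by move: ab; rewrite le_eqVlt => /predU1P[->|->//]; rewrite ltxx subrr.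
Qed.

Lemma rint_le a b f g : rcon a b f -> rcon a b g ->
  (forall t, a <= t <= b -> f t <= g t) -> rint a b f <= rint a b g.
Proof.
by move=> cf cg fg; apply: le_Rintegral => //; exact: rcon_int.
Qed.

Lemma rint_ge0 a b f : (forall t, a <= t <= b -> 0 <= f t) -> 0 <= rint a b f.
Proof.
by move=> f0; apply: Rintegral_ge0 => t; rewrite /= in_itv /=; exact: f0.
Qed.

Lemma rint_norm a b f M : a <= b -> rcon a b f ->
  (forall t, a <= t <= b -> `|f t| <= M) -> `|rint a b f| <= M * (b - a).
Proof.
move=> ab cf fM; rewrite ler_norml -mulNr -!rint_cst//.
have cc c : rcon a b (fun=> c) by exact: rcon_cst.
by apply/andP; split; apply: rint_le => // t /fM; rewrite ler_norml => /andP[].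
Qed.

Lemma rint_cat a b c f : a <= b -> b <= c -> rcon a c f ->
  rint a c f = rint a b f + rint b c f.
Proof.
move=> ab bc cf; have /(_ (BLeft a) (BRight c) b) := @Rintegral_itvB R f.
move=> /(_ (rcon_int cf)); rewrite !bnd_simp => /(_ ab bc).
rewrite (@Rintegral_itv_obnd_cbnd _ _ (BRight c)); last first.
  have := rcon_int (rconS ab (lexx c) cf).
  apply: integrableS => //; apply: subset_itvr.
  by rewrite bnd_simp.
by rewrite /rint => <-; rewrite addrC subrK.
Qed.

End RealIntegral.

(** * Complex integrals over segments and over boundaries of rectangles *)

Section PathIntegral.
Variable R : realType.
Implicit Types (a b c d t x y M : R) (g h : R -> R[i]) (z w : R[i]).

Definition gcon a b g := rcon a b (Re \o g) /\ rcon a b (Im \o g).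

Definition cint a b g : R[i] := rint a b (Re \o g) +i* rint a b (Im \o g).

Lemma cint_eq a b g h : (forall t, a <= t <= b -> g t = h t) ->
  cint a b g = cint a b h.
Proof. by move=> gh; congr (_ +i* _); apply: rint_eq => t /gh /= ->. Qed.

Lemma rcon_eq a b (f f' : R -> R) : f =1 f' -> rcon a b f -> rcon a b f'.
Proof. by move=> /funext ->. Qed.

Lemma gcon_eq a b g h : g =1 h -> gcon a b g -> gcon a b h.
Proof. by move=> /funext ->. Qed.

Lemma gcon_cst a b z : gcon a b (fun=> z).
Proof. by split; exact: rcon_cst. Qed.

Lemma gconD a b g h : gcon a b g -> gcon a b h -> gcon a b (fun t => g t + h t).
Proof.
move=> [g1 g2] [h1 h2]; split.
  by apply: (rcon_eq _ (rconD g1 h1)) => t /=; rewrite ReD.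
by apply: (rcon_eq _ (rconD g2 h2)) => t /=; rewrite ImD.
Qed.

Lemma gconZ a b z g : gcon a b g -> gcon a b (fun t => z * g t).
Proof.
move=> [g1 g2]; have cc c : rcon a b (fun=> c) by exact: rcon_cst.
split.
  apply: (rcon_eq _ (rconD (rconM (cc (Re z)) g1) (rconM (cc (- Im z)) g2))).
  by move=> t; rewrite /comp ReM mulNr.
apply: (rcon_eq _ (rconD (rconM (cc (Re z)) g2) (rconM (cc (Im z)) g1))).
by move=> t; rewrite /comp ImM.
Qed.

Lemma gconS a b c d g : a <= c -> d <= b -> gcon a b g -> gcon c d g.
Proof. by move=> ac db [g1 g2]; split; [exact: rconS g1|exact: rconS g2]. Qed.

Lemma cintD a b g h : gcon a b g -> gcon a b h ->
  cint a b (fun t => g t + h t) = cint a b g + cint a b h.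
Proof.
move=> [g1 g2] [h1 h2]; apply: eq_ReIm; rewrite ?ReD ?ImD /= -rintD//.
  by apply: rint_eq => t _ /=; rewrite ReD.
by apply: rint_eq => t _ /=; rewrite ImD.
Qed.

Lemma cintZ a b z g : gcon a b g -> cint a b (fun t => z * g t) = z * cint a b g.
Proof.
move=> [g1 g2]; have cc c : rcon a b (fun=> c) by exact: rcon_cst.
have r1 := rconM (cc (Re z)) g1; have r2 := rconM (cc (Im z)) g2.
have i1 := rconM (cc (Re z)) g2; have i2 := rconM (cc (Im z)) g1.
apply: eq_ReIm.
  rewrite ReM -[RHS]/(Re z * rint a b (Re \o g) - Im z * rint a b (Im \o g)).
  rewrite -!rintZ// -rintN// -rintD//; last exact: rconN.
  by apply: rint_eq => t _; rewrite /comp ReM.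
rewrite ImM -[RHS]/(Re z * rint a b (Im \o g) + Im z * rint a b (Re \o g)).
rewrite -!rintZ// -rintD//.
by apply: rint_eq => t _; rewrite /comp ImM.
Qed.

Lemma cintB a b g h : gcon a b g -> gcon a b h ->
  cint a b (fun t => g t - h t) = cint a b g - cint a b h.
Proof.
move=> cg ch; rewrite -(mulN1r (cint a b h)) -cintZ// -cintD//; last exact: gconZ.
by apply: cint_eq => t _; rewrite mulN1r.
Qed.

Lemma cint_cst a b z : a <= b -> cint a b (fun=> z) = z * (b - a)%:C.
Proof.
move=> ab; transitivity ((Re z * (b - a)) +i* (Im z * (b - a))).
  by congr (_ +i* _); exact: rint_cst.
by apply: eq_ReIm; rewrite ?ReM ?ImM /=; ring.
Qed.

(** Real and imaginary parts are bounded separately, which costs the factor 2; this is harmless,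
    since the lemma serves limit arguments. *)
Lemma cint_norm a b g M : a <= b -> gcon a b g ->
  (forall t, a <= t <= b -> normc (g t) <= M) ->
  normc (cint a b g) <= 2 * M * (b - a).
Proof.
move=> ab [g1 g2] gM; apply: le_trans (normc_le_ReIm _) _ => /=.
rewrite -mulrA mulr_natl mulr2n lerD// rint_norm// => t /gM; apply: le_trans.
  exact: normc_Re.
exact: normc_Im.
Qed.

Lemma cint_cat a b c g : a <= b -> b <= c -> gcon a c g ->
  cint a c g = cint a b g + cint b c g.
Proof.
by move=> ab bc [g1 g2]; apply: eq_ReIm; rewrite ?ReD ?ImD /= (rint_cat ab bc).
Qed.

Implicit Types f : R[i] -> R[i].

Definition onb a b c d z :=
  (a <= Re z <= b /\ (Im z = c \/ Im z = d)) \/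
  (c <= Im z <= d /\ (Re z = a \/ Re z = b)).

Definition hor (f : R[i] -> R[i]) a b y := cint a b (fun t => f (t +i* y)).
Definition ver (f : R[i] -> R[i]) x c d := cint c d (fun t => f (x +i* t)).

(** This is the contour integral of [f] along the boundary, counterclockwise; the factor ['i] comes
    from [dz = i dt] on the vertical sides. *)
Definition rect (f : R[i] -> R[i]) a b c d :=
  hor f a b c - hor f a b d + 'i * (ver f b c d - ver f a c d).

Definition bcont (f : R[i] -> R[i]) a b c d := forall z, onb a b c d z -> ccont f z.

Definition inrect a b c d z := a <= Re z <= b /\ c <= Im z <= d.

Lemma onb_inrect a b c d z : a <= b -> c <= d -> onb a b c d z -> inrect a b c d z.
Proof.
move=> ab cd [[Hr [Hi|Hi]]|[Hi [Hr|Hr]]]; split=> //; rewrite ?Hi ?Hr ?lexx ?ab ?cd//.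
Qed.

Lemma normc_horB t s y : normc ((t +i* y) - (s +i* y)) = `|t - s|.
Proof.
rewrite -normcR; congr normc.
by apply: eq_ReIm; rewrite ?ReB ?ImB /= ?subrr.
Qed.

Lemma normc_verB t s x : normc ((x +i* t) - (x +i* s)) = `|t - s|.
Proof.
have -> : (x +i* t) - (x +i* s) = 'i * (t - s)%:C.
  by apply: eq_ReIm; rewrite ?ReB ?ImB ?ReM ?ImM /=; ring.
by rewrite normcM normcR /normc /= expr0n expr1n add0r sqrtr1 mul1r.
Qed.

Lemma gcon_path (f : R[i] -> R[i]) (p : R -> R[i]) a b :
  (forall t, a <= t <= b -> ccont f (p t)) ->
  (forall s t, normc (p s - p t) = `|s - t|) -> gcon a b (fun t => f (p t)).
Proof.
move=> cf pE.
have key t e : a <= t <= b -> 0 < e -> exists2 d : R, 0 < d &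
    forall s, `|s - t| < d -> normc (f (p s) - f (p t)) < e.
  move=> tab e0; have [d d0 dP] := (ccontP f (p t)).1 (cf t tab) e e0.
  by exists d => // s st; apply: dP; rewrite pE.
split=> t tab; apply/rcontP => e e0; have [d d0 dP] := key t e tab e0;
  exists d => // s /dP; apply: le_lt_trans; rewrite /comp.
  by rewrite -ReB; exact: normc_Re.
by rewrite -ImB; exact: normc_Im.
Qed.

Lemma gcon_hor f a b y : (forall t, a <= t <= b -> ccont f (t +i* y)) ->
  gcon a b (fun t => f (t +i* y)).
Proof. by move=> cf; apply: gcon_path => // s t; exact: normc_horB. Qed.

Lemma gcon_ver f x c d : (forall t, c <= t <= d -> ccont f (x +i* t)) ->
  gcon c d (fun t => f (x +i* t)).
Proof. by move=> cf; apply: gcon_path => // s t; exact: normc_verB. Qed.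

Lemma bcont_gcon f a b c d : bcont f a b c d ->
  [/\ gcon a b (fun t => f (t +i* c)), gcon a b (fun t => f (t +i* d)),
      gcon c d (fun t => f (a +i* t)) & gcon c d (fun t => f (b +i* t))].
Proof.
move=> cf; split.
- by apply: gcon_hor => t tab; apply: cf; left; split=> //; left.
- by apply: gcon_hor => t tab; apply: cf; left; split=> //; right.
- by apply: gcon_ver => t tab; apply: cf; right; split=> //; left.
- by apply: gcon_ver => t tab; apply: cf; right; split=> //; right.
Qed.

Lemma rect_eq f f' a b c d : (forall z, onb a b c d z -> f z = f' z) ->
  rect f a b c d = rect f' a b c d.
Proof.
move=> fg; congr (_ - _ + 'i * (_ - _)); apply: cint_eq => t tab; apply: fg.
- by left; split=> //; left.
- by left; split=> //; right.
- by right; split=> //; right.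
- by right; split=> //; left.
Qed.

Lemma rectZ (u : R[i]) f a b c d : bcont f a b c d ->
  rect (fun z => u * f z) a b c d = u * rect f a b c d.
Proof.
move=> /bcont_gcon[f1 f2 f3 f4]; rewrite /rect /hor /ver !cintZ//; ring.
Qed.

Lemma bcontZ (u : R[i]) f a b c d : bcont f a b c d -> bcont (fun z => u * f z) a b c d.
Proof. by move=> cf z /cf fz; exact: (ccontM (@ccont_cst _ _ _) fz). Qed.

Lemma rectB f f' a b c d : bcont f a b c d -> bcont f' a b c d ->
  rect (fun z => f z - f' z) a b c d = rect f a b c d - rect f' a b c d.
Proof.
move=> /bcont_gcon[f1 f2 f3 f4] /bcont_gcon[g1 g2 g3 g4]; rewrite /rect /hor /ver.
rewrite (cintB f1 g1) (cintB f2 g2) (cintB f3 g3) (cintB f4 g4); ring.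
Qed.

Lemma normci : normc ('i : R[i]) = 1.
Proof. by rewrite /normc expr0n expr1n add0r sqrtr1. Qed.

Lemma rect_norm f a b c d M : a <= b -> c <= d -> bcont f a b c d ->
  (forall z, onb a b c d z -> normc (f z) <= M) ->
  normc (rect f a b c d) <= 4 * M * ((b - a) + (d - c)).
Proof.
move=> ab cd /bcont_gcon[f1 f2 f3 f4] fM.
have h1 : normc (hor f a b c) <= 2 * M * (b - a).
  by apply: cint_norm => // t tab; apply: fM; left; split=> //; left.
have h2 : normc (hor f a b d) <= 2 * M * (b - a).
  by apply: cint_norm => // t tab; apply: fM; left; split=> //; right.
have v1 : normc (ver f a c d) <= 2 * M * (d - c).
  by apply: cint_norm => // t tab; apply: fM; right; split=> //; left.
have v2 : normc (ver f b c d) <= 2 * M * (d - c).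
  by apply: cint_norm => // t tab; apply: fM; right; split=> //; right.
apply: le_trans (le_normcD _ _) _.
rewrite normcM normci mul1r.
have := le_normcB (hor f a b c) (hor f a b d).
have := le_normcB (ver f b c d) (ver f a c d).
lra.
Qed.

Lemma rect_splitv f a b c m d : a <= b -> c <= m -> m <= d ->
  (forall z, inrect a b c d z -> ccont f z) ->
  rect f a b c d = rect f a b c m + rect f a b m d.
Proof.
move=> ab cm md cf.
have vE x : a <= x <= b -> ver f x c d = ver f x c m + ver f x m d.
  move=> xab; apply: cint_cat => //; apply: gcon_ver => t tcd.
  by apply: cf; split.
by rewrite /rect !vE ?lexx ?ab//; ring.
Qed.

Lemma rect_splith f a m b c d : a <= m -> m <= b -> c <= d ->
  (forall z, inrect a b c d z -> ccont f z) ->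
  rect f a b c d = rect f a m c d + rect f m b c d.
Proof.
move=> am mb cd cf.
have hE y : c <= y <= d -> hor f a b y = hor f a m y + hor f m b y.
  move=> ycd; apply: cint_cat => //; apply: gcon_hor => t tab.
  by apply: cf; split.
by rewrite /rect !hE ?lexx ?cd//; ring.
Qed.

(** Opposite sides differ by a translation, under which an affine integrand changes by a constant:
    the horizontal sides contribute [v * 'i * (c - d) * (b - a)], the vertical ones the opposite. *)
Lemma rect_affine (u v : R[i]) a b c d : a <= b -> c <= d ->
  rect (fun z => u + v * z) a b c d = 0.
Proof.
move=> ab cd.
pose f z := u + v * z.
have cf z : ccont f z.
  exact: (ccontD (@ccont_cst _ _ _) (ccontM (@ccont_cst _ _ _) (@ccont_id _ _))).
have hE : hor f a b c - hor f a b d = v * 'i * (c - d)%:C * (b - a)%:C.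
  rewrite -cint_cst// -cintB; try by apply: gcon_hor => t _.
  apply: cint_eq => t _; rewrite /f.
  have E y : t +i* y = t%:C + 'i * y%:C :> R[i].
    by apply: eq_ReIm; rewrite ?ReD ?ImD ?ReM ?ImM /=; ring.
  by rewrite !E rmorphB /=; ring.
have vE : ver f b c d - ver f a c d = v * (b - a)%:C * (d - c)%:C.
  rewrite -cint_cst// -cintB; try by apply: gcon_ver => t _.
  apply: cint_eq => t _; rewrite /f.
  have E x : x +i* t = x%:C + 'i * t%:C :> R[i].
    by apply: eq_ReIm; rewrite ?ReD ?ImD ?ReM ?ImM /=; ring.
  by rewrite !E rmorphB /=; ring.
by rewrite /rect hE vE !rmorphB /=; ring.
Qed.

End PathIntegral.

(** * Cauchy's theorem *)

Section Goursat.
Variable R : realType.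
Implicit Types (a b c d t x y w h M e : R) (f : R[i] -> R[i]) (z : R[i]).

Lemma le0_of_lee M (C : R) : (forall e, 0 < e -> M <= C * e) -> M <= 0.
Proof.
move=> H; rewrite leNgt; apply/negP => M0.
have C0 : 0 < `|C| + 1 by rewrite ltr_pwDr.
have := H (M / (2 * (`|C| + 1))); rewrite divr_gt0 ?mulr_gt0// => /(_ isT).
have -> : C * (M / (2 * (`|C| + 1))) = C / (`|C| + 1) * (M / 2).
  by field; rewrite (gt_eqF C0).
have : C / (`|C| + 1) <= 1.
  by rewrite ler_pdivrMr// mul1r (le_trans (ler_norm _))// lerDl.
move=> H1 H2.
have : C / (`|C| + 1) * (M / 2) <= 1 * (M / 2).
  by rewrite ler_pM2r// divr_gt0.
lra.
Qed.

Lemma quarter_le (m x y z t : R) : m <= x + y + (z + t) ->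
  m <= 4 * x \/ m <= 4 * y \/ m <= 4 * z \/ m <= 4 * t.
Proof.
move=> H; have [|H1] := leP m (4 * x); first by left.
have [|H2] := leP m (4 * y); first by right; left.
have [|H3] := leP m (4 * z); first by do 2 right; left.
by do 3 right; lra.
Qed.

Lemma rect_quarter f a b w h : 0 <= w -> 0 <= h ->
  (forall z, inrect a (a + w) b (b + h) z -> ccont f z) ->
  exists p : R * R, [/\ a <= p.1, p.1 + w / 2 <= a + w, b <= p.2,
    p.2 + h / 2 <= b + h &
    normc (rect f a (a + w) b (b + h)) <=
    4 * normc (rect f p.1 (p.1 + w / 2) p.2 (p.2 + h / 2))].
Proof.
move=> w0 h0 cf.
have E x y : x + y / 2 + y / 2 = x + y by field.
have am : a <= a + w / 2 by lra.
have mb : a + w / 2 <= a + w by lra.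
have cm : b <= b + h / 2 by lra.
have md : b + h / 2 <= b + h by lra.
have awb : a <= a + w by lra.
pose r p := rect f p.1 (p.1 + w / 2) p.2 (p.2 + h / 2).
have sum : rect f a (a + w) b (b + h) = r (a, b) + r (a + w / 2, b) +
   (r (a, b + h / 2) + r (a + w / 2, b + h / 2)).
  rewrite (rect_splitv awb cm md cf) (rect_splith am mb cm); last first.
    by move=> z [z1 /andP[z2 z3]]; apply: cf; split; rewrite // z2 (le_trans z3).
  rewrite (rect_splith am mb md); last first.
    by move=> z [z1 /andP[z2 z3]]; apply: cf; split; rewrite // z3 (le_trans _ z2).
  by rewrite /r /= !E.
have tri : normc (rect f a (a + w) b (b + h)) <= normc (r (a, b)) +
    normc (r (a + w / 2, b)) +
   (normc (r (a, b + h / 2)) + normc (r (a + w / 2, b + h / 2))).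
  by rewrite sum; apply: le_trans (le_normcD _ _) (lerD (le_normcD _ _) (le_normcD _ _)).
have [H|[H|[H|H]]] := quarter_le tri;
  [exists (a, b)|exists (a + w / 2, b)|exists (a, b + h / 2)|
   exists (a + w / 2, b + h / 2)]; (split; [| | | |exact: H]);
  rewrite /=; clear -w0 h0; lra.
Qed.

(** Applied to each coordinate of the lower left corners of nested quarters, this yields their
    common point: left ends increase and stay below every right end, so their supremum works. *)
Lemma nested_sup (u : nat -> R) w : (forall n, u n <= u n.+1) ->
  (forall n, u n.+1 + w / 2 ^+ n.+1 <= u n + w / 2 ^+ n) -> 0 <= w ->
  exists l, forall n, u n <= l <= u n + w / 2 ^+ n.
Proof.
move=> u1 u2 w0.
have p0 n : 0 <= w / 2 ^+ n by rewrite divr_ge0// exprn_ge0.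
have umono m n : u m <= u (m + n)%N.
  by elim: n => [|n IH]; rewrite ?addn0// addnS (le_trans IH).
have uanti m n : u (m + n)%N + w / 2 ^+ (m + n) <= u m + w / 2 ^+ m.
  by elim: n => [|n IH]; rewrite ?addn0// addnS (le_trans _ IH).
have ub m n : u m <= u n + w / 2 ^+ n.
  have [mn|nm] := leqP m n.
    have H := umono m (n - m)%N; rewrite subnKC// in H.
    by apply: (le_trans H); rewrite lerDl.
  have H := uanti n (m - n)%N; rewrite subnKC ?(ltnW nm)// in H.
  by apply: le_trans H; rewrite lerDl.
have hs : has_sup (range u).
  by split; [exists (u 0%N), 0%N|exists (u 0%N + w / 2 ^+ 0) => _ [m _ <-]].
exists (sup (range u)) => n; apply/andP; split.
  by apply: ub_le_sup; [exact: hs.2|exists n].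
by apply: ge_sup; [exact: hs.1|move=> _ [m _ <-]].
Qed.

(** The affine approximation at [p] has integral 0, so only the remainder counts. It is at most [e]
    times the half-perimeter on the boundary, and integration brings a second factor of that
    size. *)
Lemma rect_affine_at f p (dp : R[i]) a b c d e : a <= b -> c <= d ->
  (forall z, inrect a b c d z -> ccont f z) ->
  inrect a b c d p -> 0 <= e ->
  (forall z, inrect a b c d z ->
     normc (f z - f p - dp * (z - p)) <= e * normc (z - p)) ->
  normc (rect f a b c d) <= 4 * e * ((b - a) + (d - c)) ^+ 2.
Proof.
move=> ab cd cf pin e0 fp.
pose A z := (f p - dp * p) + dp * z.
have cA z : ccont A z.
  exact: (ccontD (@ccont_cst _ _ _) (ccontM (@ccont_cst _ _ _) (@ccont_id _ _))).
have bA : bcont A a b c d by move=> z _.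
have bf : bcont f a b c d by move=> z /(onb_inrect ab cd)/cf.
have -> : rect f a b c d = rect (fun z => f z - A z) a b c d.
  rewrite (rectB bf bA) (_ : rect A a b c d = 0) ?subr0//.
  exact: rect_affine.
have bfA : bcont (fun z => f z - A z) a b c d.
  by move=> z zb; exact: (ccontB (bf z zb) (cA z)).
have := @rect_norm _ _ _ _ _ _ (e * ((b - a) + (d - c))) ab cd bfA.
rewrite expr2 !mulrA; apply => z zb.
have zin := onb_inrect ab cd zb.
have -> : f z - A z = f z - f p - dp * (z - p) by rewrite /A; ring.
apply: le_trans (fp z zin) _; rewrite ler_wpM2l//.
apply: le_trans (normc_le_ReIm _) _; rewrite ReB ImB.
case: zin pin => /andP[z1 z2] /andP[z3 z4] [/andP[p1 p2] /andP[p3 p4]].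
have : `|Re z - Re p| <= b - a by rewrite ler_norml; lra.
have : `|Im z - Im p| <= d - c by rewrite ler_norml; lra.
lra.
Qed.

(** Bisection: some quarter retains at least a fourth of the modulus of the integral. At the common
    point of the nested quarters, [rect_affine_at] bounds it by [e] times the square of the
    half-perimeter, which is also divided by 4 at each step. *)
Theorem goursat f a b c d : a <= b -> c <= d ->
  (forall z, inrect a b c d z -> exists k, cder f z k) -> rect f a b c d = 0.
Proof.
move=> ab cd df.
have cf z : inrect a b c d z -> ccont f z by move=> /df[k /cder_cont].
pose w := b - a; pose h := d - c.
have w0 : 0 <= w by rewrite subr_ge0.
have h0 : 0 <= h by rewrite subr_ge0.
pose good (n : nat) (p : R * R) := [/\ a <= p.1, p.1 + w / 2 ^+ n <= b,
  c <= p.2 & p.2 + h / 2 ^+ n <= d].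
pose rr (n : nat) (p : R * R) :=
  rect f p.1 (p.1 + w / 2 ^+ n) p.2 (p.2 + h / 2 ^+ n).
have half (x : R) n : x / 2 ^+ n.+1 = x / 2 ^+ n / 2.
  by rewrite exprSr invfM mulrA.
have pw (x : R) n : 0 <= x -> 0 <= x / 2 ^+ n.
  by move=> x0; rewrite divr_ge0// exprn_ge0.
have step n p : good n p -> exists q, [/\ good n.+1 q, p.1 <= q.1, p.2 <= q.2,
    q.1 + w / 2 ^+ n.+1 <= p.1 + w / 2 ^+ n /\
    q.2 + h / 2 ^+ n.+1 <= p.2 + h / 2 ^+ n &
    normc (rr n p) <= 4 * normc (rr n.+1 q)].
  move=> [g1 g2 g3 g4].
  have [|q [q1 q2 q3 q4 q5]] := rect_quarter (pw w n w0) (pw h n h0)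
      (f := f) (a := p.1) (b := p.2).
    move=> z [/andP[z1 z2] /andP[z3 z4]]; apply: cf; split.
      by rewrite (le_trans g1 z1) (le_trans z2 g2).
    by rewrite (le_trans g3 z3) (le_trans z4 g4).
  exists q; rewrite /rr /good !half; split=> //; split; lra.
(* The choice of a quarter is made total by keeping [p] when it is not good; [sg] shows that this
   default never occurs. *)
pose nxt n p := if pselect (good n p) is left H then projT1 (cid (step n p H)) else p.
pose s := fix s n := if n is m.+1 then nxt m (s m) else (a, c).
have sg n : good n (s n).
  elim: n => [|n IH] /=; first by rewrite /good /= expr0 !divr1 /w /h; split; lra.
  by rewrite /nxt; case: pselect => // H; case: cid => q /= [].
have sS n : [/\ (s n).1 <= (s n.+1).1, (s n).2 <= (s n.+1).2,
    (s n.+1).1 + w / 2 ^+ n.+1 <= (s n).1 + w / 2 ^+ n /\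
    (s n.+1).2 + h / 2 ^+ n.+1 <= (s n).2 + h / 2 ^+ n &
    normc (rr n (s n)) <= 4 * normc (rr n.+1 (s n.+1))].
  rewrite /= /nxt; case: pselect => [H|/(_ (sg n))//].
  by case: cid => q /= [].
have [x xP] : exists l, forall n, (s n).1 <= l <= (s n).1 + w / 2 ^+ n.
  by apply: nested_sup => // n; case: (sS n) => // _ _ [].
have [y yP] : exists l, forall n, (s n).2 <= l <= (s n).2 + h / 2 ^+ n.
  by apply: nested_sup => // n; case: (sS n) => // _ _ [].
have big n : normc (rect f a b c d) <= 4 ^+ n * normc (rr n (s n)).
  elim: n => [|n IH].
    by rewrite /rr /= !expr0 !divr1 /w /h mul1r (addrC a) (addrC c) !subrK.
  apply: le_trans IH _; rewrite exprSr -mulrA ler_wpM2l ?exprn_ge0//.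
  by case: (sS n).
pose p := x +i* y.
have pin n : inrect (s n).1 ((s n).1 + w / 2 ^+ n) (s n).2 ((s n).2 + h / 2 ^+ n) p.
  by split; rewrite /p /=.
have [k /cderP fk] : exists k, cder f p k.
  apply: df; have [/andP[p1 p2] /andP[p3 p4]] := pin 0%N; split; move: p1 p2 p3 p4;
  rewrite /= !expr0 !divr1 /w /h => *; lra.
apply/eqP; rewrite -normc_eq0 eq_le normc_ge0 andbT.
apply: (@le0_of_lee _ (4 * (w + h) ^+ 2)) => e e0.
have [r r0 rP] := fk e e0.
have [n nP] : exists n : nat, (w + h) / 2 ^+ n < r.
  have [n nP] : exists n : nat, (w + h) / r < n%:R.
    by exists (Num.truncn ((w + h) / r)).+1; exact: truncnS_gt.
  exists n; rewrite ltr_pdivrMr ?exprn_gt0//.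
  move: nP; rewrite ltr_pdivrMr// mulrC => /lt_le_trans; apply.
  rewrite ler_wpM2l ?(ltW r0)// -natrX ler_nat ltnW//; exact: ltn_expl.
have [g1 g2 g3 g4] := sg n.
have wn := pw w n w0; have hn := pw h n h0.
have insq z : inrect (s n).1 ((s n).1 + w / 2 ^+ n) (s n).2
    ((s n).2 + h / 2 ^+ n) z -> inrect a b c d z.
  by move=> [/andP[z1 z2] /andP[z3 z4]]; split; lra.
have := big n.
have : normc (rr n (s n)) <= 4 * e *
    (((s n).1 + w / 2 ^+ n - (s n).1) + ((s n).2 + h / 2 ^+ n - (s n).2)) ^+ 2.
  apply: (rect_affine_at (p := p) (dp := k)); [lra|lra| |exact: pin|exact: ltW|].
  - by move=> z /insq/cf.
  - move=> z zin; apply: rP; apply: le_lt_trans (normc_le_ReIm _) _.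
    rewrite ReB ImB; apply: le_lt_trans nP.
    case: (pin n) => /andP[p1 p2] /andP[p3 p4].
    case: zin => /andP[z1 z2] /andP[z3 z4].
    have -> : (w + h) / 2 ^+ n = w / 2 ^+ n + h / 2 ^+ n by rewrite mulrDl.
    by apply: lerD; rewrite ler_norml; lra.
have -> : ((s n).1 + w / 2 ^+ n - (s n).1) + ((s n).2 + h / 2 ^+ n - (s n).2) =
   (w + h) / 2 ^+ n.
  by rewrite [RHS]mulrDl (addrAC (s n).1) subrr add0r (addrAC (s n).2) subrr add0r.
move=> H1 H2; apply: (le_trans H2); apply: (le_trans (ler_wpM2l _ H1)).
  by rewrite exprn_ge0.
rewrite le_eqVlt; apply/orP; left; apply/eqP.
rewrite expr_div_n -exprM mulnC exprM -(_ : 4 = 2 ^+ 2 :> R); last by ring.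
by field; rewrite expf_neq0.
Qed.

End Goursat.

(** * Cauchy integrals over squares, and removability of the real line *)

Section Cauchy.
Variable R : realType.
Implicit Types (a b c d t x y s M e : R) (f : R[i] -> R[i]) (z w : R[i]).

Lemma hor_uniform f a b y0 e : (forall t, a <= t <= b -> ccont f (t +i* y0)) ->
  0 < e -> exists2 d : R, 0 < d & forall t y, a <= t <= b -> `|y - y0| < d ->
    normc (f (t +i* y) - f (t +i* y0)) <= e.
Proof.
move=> cf e0.
pose P t d := forall y, `|y - y0| < d -> normc (f (t +i* y) - f (t +i* y0)) <= e.
suff [d d0 dP] : exists2 d : R, 0 < d & forall t, a <= t <= b -> P t d.
  by exists d => // t y tab; exact: dP.
apply: segment_uniform => [t d d' H d'0 d'd y yd|t tab].
  by apply: H; exact: lt_le_trans d'd.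
have e2 : 0 < e / 2 by rewrite divr_gt0.
have [r r0 rP] := (ccontP f (t +i* y0)).1 (cf t tab) _ e2.
exists (r / 2) => [|s st sab y yr]; first by rewrite divr_gt0.
have st' : `|s - t| < r.
  by apply: lt_trans st _; rewrite ltr_pdivrMr// ltr_pMr// ltr1n.
have H1 : normc (f (s +i* y0) - f (t +i* y0)) < e / 2.
  by apply: rP; rewrite normc_horB.
have H2 : normc (f (s +i* y) - f (t +i* y0)) < e / 2.
  apply: rP; rewrite -(subrK (s +i* y0) (s +i* y)) -addrA.
  apply: le_lt_trans (le_normcD _ _) _; rewrite normc_verB normc_horB.
  by rewrite [ltRHS]splitr ltrD.
rewrite -(subrK (f (t +i* y0)) (f (s +i* y))) -addrA.
rewrite [leRHS]splitr; apply: le_trans (le_normcD _ _) _.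
by rewrite (normcB _ (f (s +i* y0))) ltW// ltrD.
Qed.

Lemma gcon_bounded a b (g : R -> R[i]) : gcon a b g ->
  exists2 M, 0 < M & forall t, a <= t <= b -> normc (g t) <= M.
Proof.
move=> [/rcon_bounded[M M0 MP] /rcon_bounded[N N0 NP]].
exists (M + N) => [|t tab]; first by rewrite addr_gt0.
by apply: le_trans (normc_le_ReIm _) _; rewrite lerD ?MP ?NP.
Qed.

(** The rectangle is shortened by [k] at the bottom and at the top, so that [goursat] applies. The
    horizontal sides then move little by uniform continuity, and the vertical pieces cut off have
    length [k]. *)
Lemma goursat_strip f a b c d : a <= b -> c < d ->
  (forall z, inrect a b c d z -> ccont f z) ->
  (forall z, a <= Re z <= b -> c < Im z < d -> exists k, cder f z k) ->
  rect f a b c d = 0.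
Proof.
move=> ab cd cf df; have lcd := ltW cd.
have bf : bcont f a b c d by move=> z /(onb_inrect ab lcd)/cf.
have [h1 h2 v1 v2] := bcont_gcon bf.
have [M M0 MP] := gcon_bounded v1; have [N N0 NP] := gcon_bounded v2.
apply/eqP; rewrite -normc_eq0 eq_le normc_ge0 andbT.
apply: (@le0_of_lee _ _ (4 * (b - a) + 4 * (M + N))) => e e0.
have cin y : c <= y <= d -> forall t, a <= t <= b -> ccont f (t +i* y).
  by move=> ycd t tab; apply: cf; split.
have ccd : c <= c <= d by rewrite lexx.
have dcd : c <= d <= d by rewrite lexx andbT.
have [dc dc0 dcP] := hor_uniform (cin c ccd) e0.
have [dd dd0 ddP] := hor_uniform (cin d dcd) e0.
(* [k] stays below both radii of uniform continuity, below [e], and below a third of the height, so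
   that [c + k <= d - k]. *)
pose k := Num.min (Num.min dc dd) (Num.min e ((d - c) / 3)) / 2.
have m0 : 0 < Num.min (Num.min dc dd) (Num.min e ((d - c) / 3)).
  by rewrite !lt_min dc0 dd0 e0 divr_gt0 ?subr_gt0.
have k0 : 0 < k by rewrite divr_gt0.
have : k < Num.min (Num.min dc dd) (Num.min e ((d - c) / 3)).
  by rewrite ltr_pdivrMr// ltr_pMr ?ltr1n.
rewrite !lt_min => /andP[/andP[kc kd] /andP[ke kcd]].
have o1 : c <= c + k <= d by clear -k0 kcd cd; lra.
have o2 : c <= d - k <= d by clear -k0 kcd cd; lra.
have o3 : c + k <= d - k by clear -k0 kcd cd; lra.
have r0 : rect f a b (c + k) (d - k) = 0.
  by apply: goursat => // z [z1 /andP[z2 z3]]; apply: df => //; clear -z2 z3 k0; lra.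
have Hc : normc (hor f a b c - hor f a b (c + k)) <= 2 * e * (b - a).
  have gk : gcon a b (fun t => f (t +i* (c + k))).
    by apply: gcon_hor; exact: cin.
  rewrite normcB -(cintB gk h1); apply: cint_norm => // [|t tab].
    exact: (gconD gk (gcon_eq (fun=> mulN1r _) (gconZ (-1) h1))).
  by apply: dcP => //; rewrite addrC addKr gtr0_norm.
have Hd : normc (hor f a b d - hor f a b (d - k)) <= 2 * e * (b - a).
  have gk : gcon a b (fun t => f (t +i* (d - k))).
    by apply: gcon_hor; exact: cin.
  rewrite normcB -(cintB gk h2); apply: cint_norm => // [|t tab].
    exact: (gconD gk (gcon_eq (fun=> mulN1r _) (gconZ (-1) h2))).
  by apply: ddP => //; rewrite addrC addKr normrN gtr0_norm.
have [/andP[c1 c2] /andP[d1 d2]] := (o1, o2).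
have vE u : gcon c d (fun t => f (u +i* t)) ->
    ver f u c d = ver f u c (c + k) + (ver f u (c + k) (d - k) + ver f u (d - k) d).
  move=> gu; rewrite /ver (cint_cat c1 c2 gu) (cint_cat o3 d2)//.
  by apply: gconS gu.
have vN u (L : R) : gcon c d (fun t => f (u +i* t)) ->
    (forall t, c <= t <= d -> normc (f (u +i* t)) <= L) ->
    normc (ver f u c (c + k)) <= 2 * L * k /\ normc (ver f u (d - k) d) <= 2 * L * k.
  move=> gu LP; have E1 : k = c + k - c by rewrite addrC addKr.
  have E2 : k = d - (d - k) by rewrite opprB addrC subrK.
  split; [rewrite [X in _ * X]E1|rewrite [X in _ * X]E2]; apply: cint_norm => //.
  - exact: gconS gu.
  - by move=> t /andP[t1 t2]; apply: LP; rewrite t1 (le_trans t2).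
  - exact: gconS gu.
  - by move=> t /andP[t1 t2]; apply: LP; rewrite t2 (le_trans _ t1).
have [A1 A2] := vN _ _ v1 MP; have [B1 B2] := vN _ _ v2 NP.
have -> : rect f a b c d = (hor f a b c - hor f a b (c + k)) -
    (hor f a b d - hor f a b (d - k)) +
    'i * ((ver f b c (c + k) + ver f b (d - k) d) -
          (ver f a c (c + k) + ver f a (d - k) d)).
  by rewrite -[LHS]subr0 -r0 /rect (vE _ v1) (vE _ v2); ring.
apply: le_trans (le_normcD _ _) _; rewrite normcM normci mul1r.
have T1 := le_normcB (hor f a b c - hor f a b (c + k)) (hor f a b d - hor f a b (d - k)).
have T2 := le_normcB (ver f b c (c + k) + ver f b (d - k) d)
   (ver f a c (c + k) + ver f a (d - k) d).
have T3 := le_normcD (ver f b c (c + k)) (ver f b (d - k) d).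
have T4 := le_normcD (ver f a c (c + k)) (ver f a (d - k) d).
have Mk : M * k <= M * e by rewrite ler_pM2l// ltW.
have Nk : N * k <= N * e by rewrite ler_pM2l// ltW.
move: T1 T2 T3 T4 Hc Hd A1 A2 B1 B2 Mk Nk.
set n1 := normc (_ - _ - _); set n2 := normc (_ - (_ + _)).
set n3 := normc (_ - hor _ _ _ _); set n4 := normc (_ - hor _ _ _ _).
set n5 := normc (_ + _); set n6 := normc (_ + _).
set n7 := normc (ver _ _ _ _); set n8 := normc (ver _ _ _ _).
set n9 := normc (ver _ _ _ _); set n10 := normc (ver _ _ _ _).
clear; nra.
Qed.

Definition insq x s z := inrect (x - s) (x + s) (- s) s z.

(* Cut the square along the two lines. *)
Lemma goursat_lines f x s p q : 0 < s -> - s < p -> p <= q -> q < s ->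
  (forall z, insq x s z -> ccont f z) ->
  (forall z, insq x s z -> Im z != p -> Im z != q -> exists k, cder f z k) ->
  rect f (x - s) (x + s) (- s) s = 0.
Proof.
move=> s0 sp pq qs cf df.
have xs : x - s <= x + s by clear -s0; lra.
have part c d : - s <= c -> c < d -> d <= s ->
    (forall y, c < y < d -> y != p /\ y != q) -> rect f (x - s) (x + s) c d = 0.
  move=> sc cd ds npq; apply: goursat_strip => //.
    move=> z [z1 /andP[z2 z3]]; apply: cf; split=> //.
    by rewrite (le_trans sc z2) (le_trans z3 ds).
  move=> z z1 /andP[z2 z3]; have [np nq] := npq (Im z) (introT andP (conj z2 z3)).
  apply: df => //; split=> //.
  by rewrite (le_trans sc (ltW z2)) (le_trans (ltW z3) ds).
have sub c d : - s <= c -> d <= s ->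
    forall z, inrect (x - s) (x + s) c d z -> ccont f z.
  move=> sc ds z [z1 /andP[z2 z3]]; apply: cf; split=> //.
  by rewrite (le_trans sc z2) (le_trans z3 ds).
rewrite (rect_splitv xs (ltW sp) (le_trans pq (ltW qs)) cf).
rewrite part//; last 2 first.
  - exact: le_trans pq (ltW qs).
  - move=> y /andP[_ yp]; rewrite !lt_eqF//; exact: lt_le_trans pq.
rewrite add0r (rect_splitv xs pq (ltW qs) (sub _ _ (ltW sp) (lexx _))).
rewrite [X in _ + X]part//; last 2 first.
  - by rewrite (le_trans (ltW sp)).
  - move=> y /andP[qy _]; rewrite !gt_eqF//; exact: le_lt_trans qy.
rewrite addr0; move: pq; rewrite le_eqVlt => /predU1P[->|pq].
  have vz u : ver f u q q = 0 by rewrite /ver /cint /rint set_itv1 !Rintegral_set1.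
  by rewrite /rect !vz !subrr mulr0 addr0.
apply: part => //; [exact: ltW|exact: ltW|].
by move=> y /andP[py yq]; rewrite gt_eqF// lt_eqF.
Qed.

Lemma bcont_bounded f a b c d : a <= b -> c <= d -> bcont f a b c d ->
  exists2 M, 0 < M & forall z, onb a b c d z -> normc (f z) <= M.
Proof.
move=> ab cd /bcont_gcon[/gcon_bounded[M1 M10 MP1] /gcon_bounded[M2 M20 MP2]
  /gcon_bounded[M3 M30 MP3] /gcon_bounded[M4 M40 MP4]].
exists (M1 + M2 + M3 + M4) => [|z]; first by rewrite !addr_gt0.
rewrite {2}(ReImE z); move=> [[Hr [->|->]]|[Hi [->|->]]].
- by move: (MP1 _ Hr) M20 M30 M40; set n := normc _; clear; lra.
- by move: (MP2 _ Hr) M10 M30 M40; set n := normc _; clear; lra.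
- by move: (MP3 _ Hi) M10 M20 M40; set n := normc _; clear; lra.
- by move: (MP4 _ Hi) M10 M20 M30; set n := normc _; clear; lra.
Qed.

Definition cauchyI f x s w :=
  rect (fun z => f z * (z - w)^-1) (x - s) (x + s) (- s) s.

Definition onsq x s z := onb (x - s) (x + s) (- s) s z.

Lemma onsq_dist x s r z w : `|Re w - x| + r <= s -> `|Im w| + r <= s ->
  onsq x s z -> r <= normc (z - w).
Proof.
move=> wr wi; have := normc_Re (z - w); have := normc_Im (z - w).
rewrite ReB ImB.
have A : `|Re w - x| <= s - r by clear -wr; lra.
have B : `|Im w| <= s - r by clear -wi; lra.
move: A B; rewrite !ler_norml => /andP[A1 A2] /andP[B1 B2].
move: (normc _) => n.
move=> /andP[C1 C2] /andP[D1 D2].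
by case=> [[/andP[H1 H2] [H|H]]|[/andP[H1 H2] [H|H]]]; clear wr wi; lra.
Qed.

Lemma bcontM f g a b c d : bcont f a b c d -> bcont g a b c d ->
  bcont (fun z => f z * g z) a b c d.
Proof. by move=> cf cg z zb; exact: (ccontM (cf z zb) (cg z zb)). Qed.

(** The kernel is expanded exactly: [1/(z - w') = 1/(z - w) + (w' - w)/(z - w)^2 + (w' - w)^2/((z -
    w)^2 (z - w'))]. The last term is quadratic in [w' - w], with an integral bounded uniformly for
    [w'] near [w]. *)
Lemma cauchyI_der f x s w : 0 < s -> bcont f (x - s) (x + s) (- s) s ->
  `|Re w - x| < s -> `|Im w| < s -> exists k, cder (cauchyI f x s) w k.
Proof.
move=> s0 bf wr wi.
have xs : x - s <= x + s by clear -s0; lra.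
have ss : - s <= s by clear -s0; lra.
have [M M0 MP] := bcont_bounded xs ss bf.
pose r := Num.min (s - `|Re w - x|) (s - `|Im w|).
have r0 : 0 < r by rewrite lt_min !subr_gt0 wr.
have rd z : onsq x s z -> r <= normc (z - w).
  apply: onsq_dist.
    by rewrite addrC -lerBrDr /r ge_min lexx.
  by rewrite addrC -lerBrDr /r ge_min lexx orbT.
have nz z : onsq x s z -> z - w != 0.
  by move=> /rd H; rewrite -normc_gt0; exact: lt_le_trans H.
pose p z := (z - w)^-1.
have bp : bcont p (x - s) (x + s) (- s) s by move=> z /nz /ccont_inv_sub.
pose k := rect (fun z => f z * p z * p z) (x - s) (x + s) (- s) s.
pose C : R := 4 * (M / (r ^+ 2 * (r / 2))) * ((x + s - (x - s)) + (s - - s)).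
have C0 : 0 <= C.
  apply: mulr_ge0; last by rewrite addr_ge0 ?subr_ge0.
  by rewrite mulr_ge0// divr_ge0 ?(ltW M0)// mulr_ge0 ?sqr_ge0 ?divr_ge0 ?(ltW r0).
exists k; apply/cderP => e e0.
have C1 : 0 < C + 1 by rewrite ltr_wpDl.
(* The first entry keeps [w'] at distance at least [r / 2] from the boundary; the second makes
   [C * normc (w' - w)] at most [e]. *)
exists (Num.min (r / 2) (e / (C + 1))) => [|w'].
  by rewrite lt_min !divr_gt0.
rewrite lt_min => /andP[H1 H2].
have rd' z : onsq x s z -> r / 2 <= normc (z - w').
  move=> /rd H; have := ler_normcB (z - w) (w' - w).
  rewrite (_ : z - w - (w' - w) = z - w'); last by ring.
  by move: H H1; set n1 := normc _; set n2 := normc _; set n3 := normc _; clear; lra.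
have nz' z : onsq x s z -> z - w' != 0.
  move=> /rd' H; rewrite -normc_gt0; apply: lt_le_trans H.
  by rewrite divr_gt0.
pose p' z := (z - w')^-1.
have bp' : bcont p' (x - s) (x + s) (- s) s by move=> z /nz'/ccont_inv_sub.
have b1 := bcontM bf bp'; have b2 := bcontM bf bp; have b3 := bcontM b2 bp.
have b4 := bcontM b3 bp'.
have -> : cauchyI f x s w' - cauchyI f x s w - k * (w' - w) =
    (w' - w) ^+ 2 * rect (fun z => f z * p z * p z * p' z) (x - s) (x + s) (- s) s.
  rewrite /cauchyI /k (mulrC _ (w' - w)) -(rectZ _ b3) -(rectZ _ b4).
  have b5 := bcontZ (u := w' - w) b3.
  have b6 : bcont (fun z => f z * p' z - f z * p z) (x - s) (x + s) (- s) s.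
    by move=> z zb; exact: (ccontB (b1 z zb) (b2 z zb)).
  rewrite -(rectB b1 b2) -(rectB b6 b5).
  apply: rect_eq => z zb; rewrite /p /p'; field.
  by rewrite nz// nz'.
have bnd : normc (rect (fun z => f z * p z * p z * p' z) (x - s) (x + s) (- s) s) <= C.
  apply: rect_norm => // z zb; rewrite !normcM !normcV -!mulrA ler_pM ?normc_ge0//.
  - by rewrite !mulr_ge0 ?invr_ge0 ?normc_ge0.
  - exact: MP.
  have i1 : (normc (z - w))^-1 <= r^-1 by rewrite lef_pV2 ?posrE ?rd// normc_gt0 nz.
  have i2 : (normc (z - w'))^-1 <= (r / 2)^-1.
    by rewrite lef_pV2 ?posrE ?rd' ?divr_gt0// normc_gt0 nz'.
  rewrite (invfM r (r * (r / 2))) (invfM r (r / 2)).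
  by rewrite ler_pM ?mulr_ge0 ?invr_ge0 ?normc_ge0// ler_pM ?invr_ge0 ?normc_ge0.
rewrite normcM normcX expr2 mulrAC; apply: ler_wpM2r; first exact: normc_ge0.
apply: le_trans (ler_wpM2l (normc_ge0 _) bnd) _.
move: H2; rewrite ltr_pdivlMr// => /ltW; apply: le_trans.
by rewrite ler_wpM2l ?normc_ge0// lerDl.
Qed.

Lemma rint_gt0 a b (g : R -> R) m : a < b -> rcon a b g -> 0 < m ->
  (forall t, a <= t <= b -> m <= g t) -> 0 < rint a b g.
Proof.
move=> ab cg m0 gm; apply: (@lt_le_trans _ _ (m * (b - a))).
  by rewrite mulr_gt0// subr_gt0.
rewrite -rint_cst; last exact: ltW.
by apply: rint_le => //; exact: rcon_cst.
Qed.

(** The imaginary part of [dz / (z - w)] measures the increase of the angle around [w]. Each side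
    contributes a nonnegative amount, and the bottom side a positive one. *)
Lemma cauchyI1_neq0 x s w : 0 < s -> `|Re w - x| < s -> `|Im w| < s ->
  cauchyI (fun=> 1) x s w != 0.
Proof.
move=> s0 wr wi; apply: nonreal_neq0.
have xs : x - s < x + s by clear -s0; lra.
have ss : - s < s by clear -s0; lra.
pose r := Num.min (s - `|Re w - x|) (s - `|Im w|).
have r0 : 0 < r by rewrite lt_min !subr_gt0 wr.
have rd z : onsq x s z -> r <= normc (z - w).
  apply: onsq_dist.
    by rewrite addrC -lerBrDr /r ge_min lexx.
  by rewrite addrC -lerBrDr /r ge_min lexx orbT.
have nz z : onsq x s z -> z - w != 0.
  by move=> /rd H; rewrite -normc_gt0; exact: lt_le_trans H.
pose p z : R[i] := 1 * (z - w)^-1.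
have bp : bcont p (x - s) (x + s) (- s) s.
  by move=> z /nz/ccont_inv_sub cz; exact: (ccontM (@ccont_cst _ _ _) cz).
have [[h11 h12] [h21 h22] [v11 v12] [v21 v22]] := bcont_gcon bp.
have [wr1 wr2] := andP (etrans (esym (ltr_norml _ _)) wr).
have [wi1 wi2] := andP (etrans (esym (ltr_norml _ _)) wi).
have E : Im (cauchyI (fun=> 1) x s w) =
   rint (x - s) (x + s) (fun t => Im (p (t +i* - s))) +
   - rint (x - s) (x + s) (fun t => Im (p (t +i* s))) +
   (rint (- s) s (fun t => Re (p ((x + s) +i* t))) -
   rint (- s) s (fun t => Re (p ((x - s) +i* t)))).
  by rewrite ImD ImB ImM /= mul0r add0r mul1r.
have N z : onsq x s z -> 0 < normc (z - w).
  by move=> /nz; rewrite normc_gt0.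
have hin t (y : R) : (y = - s \/ y = s) -> x - s <= t <= x + s -> onsq x s (t +i* y).
  by move=> ys ts; left.
have vin t (y : R) : (y = x - s \/ y = x + s) -> - s <= t <= s -> onsq x s (y +i* t).
  by move=> ys ts; right.
rewrite E gt_eqF// ltr_pwDl//.
  rewrite ltr_pwDl//.
    have [M M0 MP] : exists2 M : R, 0 < M & forall t, x - s <= t <= x + s ->
        normc (t +i* - s - w) ^+ 2 <= M.
      exists ((2 * s + 2 * s) ^+ 2) => [|t /andP[t1 t2]].
        by rewrite exprn_gt0// addr_gt0// mulr_gt0.
      rewrite ler_pXn2r ?nnegrE ?normc_ge0 ?addr_ge0 ?mulr_ge0 ?(ltW s0)//.
      apply: le_trans (normc_le_ReIm _) _; rewrite ReB ImB /=.
      by apply: lerD; rewrite ler_norml; clear wr wi; lra.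
    apply: (@rint_gt0 _ _ _ ((s + Im w) / M)) => //.
      by rewrite divr_gt0//; clear -wi1; lra.
    move=> t ts; have tN := N _ (hin t _ (or_introl erefl) ts).
    rewrite /p mul1r ImV ImB /=.
    have -> : - (- s - Im w) = s + Im w by ring.
    rewrite ler_wpM2l//; first by clear -wi1; lra.
    by rewrite lef_pV2 ?posrE ?exprn_gt0// MP.
  rewrite -rintN//; apply: rint_ge0 => t ts.
  rewrite /p mul1r ImV ImB /= -mulNr opprK divr_ge0 ?sqr_ge0//.
  by clear -wi2; lra.
rewrite -rintN//; apply: addr_ge0; apply: rint_ge0 => t ts.
  rewrite /p mul1r ReV ReB /= divr_ge0 ?sqr_ge0//.
  by clear -wr2; lra.
rewrite /p mul1r ReV ReB /= -mulNr divr_ge0 ?sqr_ge0//.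
by clear -wr1; lra.
Qed.

Lemma ccont_eq0 f w : ccont f w ->
  (forall e, 0 < e -> exists2 w', normc (w' - w) < e & f w' = 0) -> f w = 0.
Proof.
move=> /ccontP cf H; apply/eqP; apply/negPn/negP => fw.
have [|d d0 dP] := cf (normc (f w)); first by rewrite normc_gt0.
have [w' /dP + fw'] := H d d0.
by rewrite fw' sub0r normcN ltxx.
Qed.

(* The Cauchy integral of [f] is divided by that of the constant [1], so that the
   value [2 i pi] of the latter need not be computed. *)
Theorem painleve f x s w : 0 < s ->
  (forall z, insq x s z -> ccont f z) ->
  (forall z, insq x s z -> Im z != 0 -> exists k, cder f z k) ->
  `|Re w - x| < s -> `|Im w| < s -> exists k, cder f w k.
Proof.
move=> s0 cf df wr wi.
have xs : x - s <= x + s by clear -s0; lra.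
have ss : - s <= s by clear -s0; lra.
have bf : bcont f (x - s) (x + s) (- s) s.
  by move=> z /(onb_inrect xs ss)/cf.
have b1 : bcont (fun=> 1) (x - s) (x + s) (- s) s.
  by move=> z _; exact: ccont_cst.
have inin u : `|Re u - x| < s -> `|Im u| < s -> insq x s u.
  rewrite !ltr_norml => /andP[u1 u2] /andP[u3 u4]; split; rewrite ?(ltW u3) ?(ltW u4)//.
  by apply/andP; split; [clear -u1|clear -u2]; lra.
(* Off the axis, the slope of [f] at [u] is continuous on the square and differentiable off two
   horizontal lines, the real axis and the line through [u]; hence its integral vanishes. *)
have off u : `|Re u - x| < s -> `|Im u| < s -> Im u != 0 ->
    f u * cauchyI (fun=> 1) x s u - cauchyI f x s u = 0.
  move=> ur ui u0; have [k fk] := df u (inin u ur ui) u0.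
  pose q := slope f u k.
  have nz z : onsq x s z -> z - u != 0.
    move=> zb; rewrite -normc_gt0.
    apply: lt_le_trans (onsq_dist (r := Num.min (s - `|Re u - x|) (s - `|Im u|)) _ _ zb).
    - by rewrite lt_min !subr_gt0 ur.
    - by rewrite addrC -lerBrDr ge_min lexx.
    - by rewrite addrC -lerBrDr ge_min lexx orbT.
  have cq z : insq x s z -> ccont q z.
    have [->|zu] := eqVneq z u; first by move=> _; apply/cder_slope.
    move=> zin; apply: (@ccont_near _ (fun v => (f v - f u) / (v - u))).
      near=> v; rewrite /q /slope ifN//.
      near: v; apply/nbhsCP; exists (normc (z - u)).
        by rewrite normc_gt0 subr_eq0.
      move=> v; apply: contraTneq => ->.
      by rewrite normcB ltxx.
    have zu0 : z - u != 0 by rewrite subr_eq0.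
    exact: (ccontM (ccontB (cf z zin) (@ccont_cst _ _ _)) (ccont_inv_sub zu0)).
  have dq z : insq x s z -> Im z != 0 -> Im z != Im u -> exists k, cder q z k.
    move=> zin z0 zu; have [kz fz] := df z zin z0.
    have nzu : z != u by apply: contraNneq zu => ->.
    exact: (cder_slope_neq _ nzu fz).
  have q0 : rect q (x - s) (x + s) (- s) s = 0.
    have [ui1 ui2] := andP (etrans (esym (ltr_norml _ _)) ui).
    have [u1|u1] := leP (Im u) 0.
      apply: (@goursat_lines _ _ _ (Im u) 0) => // z zin H1 H2.
      exact: dq.
    apply: (@goursat_lines _ _ _ 0 (Im u)) => //.
    - by rewrite oppr_lt0.
    - exact: ltW.
  have bi : bcont (fun z => (z - u)^-1) (x - s) (x + s) (- s) s.
    by move=> z /nz /ccont_inv_sub.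
  have bfi := bcontM bf bi; have b1i := bcontM b1 bi; have bu := bcontZ (u := f u) b1i.
  rewrite /cauchyI -(rectZ _ b1i) -(rectB bu bfi).
  have bq : bcont q (x - s) (x + s) (- s) s by move=> z /(onb_inrect xs ss)/cq.
  rewrite -[RHS](mulr0 (-1)) -q0 -(rectZ _ bq).
  apply: rect_eq => z zb; rewrite /q /slope ifN.
    by rewrite mul1r; field; rewrite nz.
  by rewrite -subr_eq0 nz.
(* At a real point the identity follows by continuity from the points just above it. *)
have all u : `|Re u - x| < s -> `|Im u| < s ->
    f u * cauchyI (fun=> 1) x s u - cauchyI f x s u = 0.
  move=> ur ui; have [u0|] := eqVneq (Im u) 0; last exact: off.
  pose D v := f v * cauchyI (fun=> 1) x s v - cauchyI f x s v.
  have [k1 /cder_cont c1] := cauchyI_der s0 b1 ur ui.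
  have [k2 /cder_cont c2] := cauchyI_der s0 bf ur ui.
  apply: (@ccont_eq0 D); first exact: (ccontB (ccontM (cf u (inin u ur ui)) c1) c2).
  move=> e e0; pose h := Num.min e s / 2.
  have m0 : 0 < Num.min e s by rewrite lt_min e0.
  have h0 : 0 < h by rewrite divr_gt0.
  have : h < Num.min e s by rewrite ltr_pdivrMr// ltr_pMr ?ltr1n.
  rewrite lt_min => /andP[he hs].
  have E : u = Re u +i* 0 by rewrite [LHS]ReImE u0.
  exists (Re u +i* h); first by rewrite {2}E normc_verB subr0 gtr0_norm.
  by apply: off => //=; rewrite ?gtr0_norm// gt_eqF.
have [k1 d1] := cauchyI_der s0 b1 wr wi.
have [k2 d2] := cauchyI_der s0 bf wr wi.
have I0 := cauchyI1_neq0 s0 wr wi.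
have := cderM d2 (cderV I0 d1) => /cder_near H; eexists; apply: H.
apply/nbhsCP; exists (Num.min (s - `|Re w - x|) (s - `|Im w|)).
  by rewrite lt_min !subr_gt0 wr.
move=> v; rewrite lt_min => /andP[v1 v2].
have vr : `|Re v - x| < s.
  have := normc_Re (v - w); rewrite ReB => H3.
  have := ler_normD (Re v - Re w) (Re w - x).
  rewrite addrA subrK; move: H3 v1.
  by set n := normc _; set a := `|Re v - _|; set b := `|_|; set c := `|_|; clear; lra.
have vi : `|Im v| < s.
  have := normc_Im (v - w); rewrite ImB => H3.
  have := ler_normD (Im v - Im w) (Im w); rewrite subrK; move: H3 v2.
  by set n := normc _; set a := `|Im v - _|; set b := `|_|; set c := `|_|; clear; lra.
have /eqP := all v vr vi; rewrite subr_eq0 => /eqP <-.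
by rewrite mulfK// cauchyI1_neq0.
Unshelve. all: by end_near. Qed.

End Cauchy.

(** * The complex exponential and its derivative *)

Section ComplexExp.
Variable R : realType.
Implicit Types (x y t s e r : R) (z w : R[i]).

Definition circ r t : R[i] := (r * cos t) +i* (r * sin t).

Definition cexp z : R[i] := circ (expR (Re z)) (Im z).

Lemma normc_circ r t : 0 <= r -> normc (circ r t) = r.
Proof.
move=> r0; apply: (@pexpIrn _ 2); rewrite ?nnegrE ?normc_ge0//.
by rewrite normc_sqr /= !exprMn -mulrDr cos2Dsin2 mulr1.
Qed.

Lemma circM r s x y : circ r x * circ s y = circ (r * s) (x + y).
Proof.
by apply: eq_ReIm; rewrite ?ReM ?ImM /= ?cosD ?sinD; ring.
Qed.

Lemma cexpD z w : cexp (z + w) = cexp z * cexp w.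
Proof. by rewrite /cexp ReD ImD expRD circM. Qed.

Lemma real_slope (f : R -> R) x d : is_derive x 1 f d -> forall e, 0 < e ->
  exists2 r : R, 0 < r & forall y, `|y - x| < r ->
    `|f y - f x - d * (y - x)| <= e * `|y - x|.
Proof.
move=> /is_derive1_caratheodory[g [fE cg gx]] e e0.
have [r r0 rP] := (rcontP g x).1 cg e e0.
exists r => // y /rP/ltW H; rewrite fE -mulrBl normrM -gx.
by rewrite ler_wpM2r.
Qed.

(** The derivatives of [expR], [cos] and [sin] at 0 suffice here; the functional equation [cexpD]
    then moves the result to every point. *)
Lemma cder_cexp0 : cder cexp 0 1.
Proof.
apply/cderP => e e0.
(* The real and imaginary parts of the remainder are bounded by [3 * (h * n)] each, and [h <= 1]
   keeps the exponential below 2. *)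
pose h := Num.min 1 (e / 8).
have h0 : 0 < h by rewrite lt_min ltr01 divr_gt0.
have h1 : h <= 1 by rewrite /h ge_min lexx.
have he : 8 * h <= e.
  by rewrite mulrC -ler_pdivlMr// /h ge_min lexx orbT.
have [r1 r10 P1] := real_slope (is_derive_expR 0) h0.
have [r2 r20 P2] := real_slope (is_derive_sin 0) h0.
have [r3 r30 P3] := real_slope (is_derive_cos 0) h0.
have [r4 r40 P4] := (rcontP expR 0).1 (@continuous_expR R 0) h h0.
exists (Num.min (Num.min r1 r2) (Num.min r3 r4)).
  by rewrite !lt_min r10 r20 r30.
move=> w; rewrite subr0 !lt_min => /andP[/andP[w1 w2] /andP[w3 w4]].
have wr := normc_Re w; have wi := normc_Im w.
have := P1 (Re w); have := P2 (Im w); have := P3 (Im w); have := P4 (Re w).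
rewrite !subr0 expR0 sin0 cos0 oppr0 !mul1r mul0r !subr0 !addr0.
move=> /(_ (le_lt_trans wr w4)) A4 /(_ (le_lt_trans wi w3)) A3.
move=> /(_ (le_lt_trans wi w2)) A2 /(_ (le_lt_trans wr w1)) A1.
have E0 : cexp 0 = 1.
  by apply: eq_ReIm; rewrite /cexp /= expR0 ?cos0 ?sin0 mul1r.
rewrite E0; apply: le_trans (normc_le_ReIm _) _.
rewrite !ReB !ImB /= subr0.
move: wr wi A1 A2 A3 A4; set x := Re w; set y := Im w; set n := normc w.
set E := expR x; set c := cos y; set s := sin y => wr wi A1 A2 A3 A4.
have E2 : `|E| <= 2.
  rewrite -(subrK 1 E); apply: le_trans (ler_normD _ _) _; rewrite normr1.
  by clear -A4 h1; lra.
have -> : E * c - 1 - x = E * (c - 1) + (E - 1 - x) by ring.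
have -> : E * s - y = E * (s - y) + (E - 1) * y by ring.
have B1 : `|E * (c - 1) + (E - 1 - x)| <= 2 * (h * n) + h * n.
  apply: le_trans (ler_normD _ _) _; apply: lerD.
    rewrite normrM ler_pM//; apply: le_trans A3 _.
    by rewrite ler_wpM2l ?(ltW h0).
  by apply: le_trans A1 _; rewrite ler_wpM2l ?(ltW h0).
have B2 : `|E * (s - y) + (E - 1) * y| <= 2 * (h * n) + h * n.
  apply: le_trans (ler_normD _ _) _; apply: lerD; rewrite normrM ler_pM//.
    by apply: le_trans A2 _; rewrite ler_wpM2l ?(ltW h0).
  exact: ltW.
have n0 : 0 <= n := normc_ge0 w.
have : 8 * h * n <= e * n by rewrite ler_wpM2r.
have : 0 <= h * n by rewrite mulr_ge0 ?(ltW h0).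
move: B1 B2; set u := `|_|; set v := `|_|; clear; nra.
Qed.

Lemma cder_cexp z : cder cexp z (cexp z).
Proof.
have H : cder (fun w => cexp z * cexp (w - z)) z (cexp z * (1 * 1)).
  apply: cderZ; apply: (cder_comp (g := fun w => w - z)); last exact: cder_subc.
  by rewrite subrr; exact: cder_cexp0.
rewrite !mulr1 in H.
have : (fun w => cexp z * cexp (w - z)) = cexp.
  by apply/funext => w; rewrite -cexpD addrC subrK.
by move=> E; move: H; rewrite E.
Qed.

End ComplexExp.

(** * Mean value property and Schwarz-Pick inequality *)

Section MeanValue.
Variable R : realType.
Implicit Types (r s t e M : R) (f : R[i] -> R[i]) (a z w d : R[i]).

Local Notation tau := (pi *+ 2 : R).

Lemma normc_disc a r t : 0 <= r -> normc (a + circ r t - a) = r.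
Proof. by move=> r0; rewrite addrC addKr normc_circ. Qed.

Lemma gcon_circ f a r : 0 < r ->
  (forall z, normc (z - a) = r -> ccont f z) ->
  gcon 0 tau (fun t => f (a + circ r t)).
Proof.
move=> r0 cf.
have E t : a + circ r t = a + cexp (ln r +i* t).
  by rewrite /cexp /= lnK// posrE.
apply: (@gcon_eq _ _ _ (fun t => f (a + cexp (ln r +i* t)))) => [t|].
  by rewrite E.
apply: (@gcon_ver _ (fun z => f (a + cexp z))) => t _.
apply: (@ccont_comp _ f (fun z => a + cexp z)).
  by apply: cf; rewrite -E normc_disc// ltW.
exact: (ccontD (@ccont_cst _ _ _) (cder_cont (cder_cexp _))).
Qed.

Lemma tau_gt0 : 0 < tau.
Proof. by rewrite pmulrn_rgt0// pi_gt0. Qed.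

(** In the coordinate [a + cexp z] circles about [a] become vertical segments of length [tau]. For
    the rectangle between two of them the horizontal sides cancel by periodicity, so the mean does
    not depend on the radius; for small radii it is close to [f a]. *)
Theorem mean_value f a M r : 0 < r -> r < M ->
  (forall z, normc (z - a) < M -> z != a -> exists k, cder f z k) ->
  ccont f a -> cint 0 tau (fun t => f (a + circ r t)) = f a * tau%:C.
Proof.
move=> r0 rM df ca.
pose G z := f (a + cexp z).
have GE x t : G (x +i* t) = f (a + circ (expR x) t) by [].
apply/eqP; rewrite -subr_eq0 -normc_eq0 eq_le normc_ge0 andbT.
apply: (@le0_of_lee _ _ (2 * tau)) => e e0.
have [d d0 dP] := (ccontP f a).1 ca e e0.
pose q := Num.min (d / 2) r.
have q0 : 0 < q by rewrite lt_min r0 andbT divr_gt0.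
have qd : q < d.
  by rewrite gt_min; apply/orP; left; rewrite ltr_pdivrMr// ltr_pMr// ltr1n.
have qr : q <= r by rewrite ge_min lexx orbT.
have lqr : ln q <= ln r by rewrite ler_ln.
have dG z : Re z <= ln r -> exists k, cder G z k.
  move=> zr; have zn : normc (a + cexp z - a) = expR (Re z).
    by rewrite normc_disc// expR_ge0.
  have zM : normc (a + cexp z - a) < M.
    by rewrite zn (le_lt_trans _ rM)// -[leRHS]lnK ?posrE// ler_expR.
  have za : a + cexp z != a.
    by rewrite -subr_eq0 -normc_gt0 zn; exact: expR_gt0.
  have [k fk] := df _ zM za.
  exists (k * (0 + cexp z)).
  exact: (cder_comp (g := fun z => a + cexp z) fk
    (cderD (@cder_cst _ _ _) (cder_cexp _))).
have G0 : rect G (ln q) (ln r) 0 tau = 0.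
  apply: goursat => //; first exact: ltW tau_gt0.
  by move=> z [/andP[_ zr] _]; exact: dG.
have hE : hor G (ln q) (ln r) 0 = hor G (ln q) (ln r) tau.
  apply: cint_eq => t _; rewrite !GE; congr (f (a + _)).
  by apply: eq_ReIm; rewrite /circ /= -(add0r tau) ?cosD2pi ?sinD2pi.
have vE : ver G (ln r) 0 tau = ver G (ln q) 0 tau.
  move: G0; rewrite /rect hE subrr add0r => /eqP; rewrite mulf_eq0.
  by rewrite -normc_eq0 normci oner_eq0 /= subr_eq0 => /eqP.
have -> : cint 0 tau (fun t => f (a + circ r t)) = ver G (ln q) 0 tau.
  by rewrite -vE; apply: cint_eq => t _; rewrite GE lnK ?posrE.
have gG : gcon 0 tau (fun t => G (ln q +i* t)).
  by apply: gcon_ver => t _; have [k /cder_cont] := dG (ln q +i* t) lqr.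
have t0 := ltW tau_gt0.
have -> : f a * tau%:C = cint 0 tau (fun=> f a) by rewrite (cint_cst _ t0) subr0.
have gB : gcon 0 tau (fun t => G (ln q +i* t) - f a).
  exact: (gconD gG (gcon_cst _ _ (- f a))).
rewrite -(cintB gG (gcon_cst _ _ _)).
apply: (le_trans (cint_norm (M := e) t0 gB _)) => [t _|].
  apply/ltW/dP; rewrite normc_disc; last exact: expR_ge0.
  by rewrite lnK ?posrE.
by rewrite subr0 -mulrA (mulrC e) mulrA.
Qed.

Lemma cint_circ_inv : cint 0 tau (fun t => circ 1 (- t)) = 0.
Proof.
have H : cint 0 tau (fun t => circ 1 t) = 0.
  have := @mean_value id 0 2 1 ltr01 (ltr1n _ _).
  rewrite mul0r => <-.
  - by apply: cint_eq => t _; rewrite add0r.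
  - by move=> z _ _; exists 1; exact: cder_id.
  - exact: ccont_id.
have [r1 r2] : rint 0 tau (Re \o circ 1) = 0 /\ rint 0 tau (Im \o circ 1) = 0.
  by split; [exact: (congr1 (@complex.Re R) H)|exact: (congr1 (@complex.Im R) H)].
have [_ g2] : gcon 0 tau (fun t => id (0 + circ 1 t)).
  by apply: (@gcon_circ id 0 1 ltr01) => z _; exact: ccont_id.
apply: eq_ReIm => /=; first by rewrite -[RHS]r1; apply: rint_eq => t _; rewrite /= cosN.
rewrite -[RHS]oppr0 -[in RHS]r2 -rintN.
  by apply: rint_eq => t _; rewrite /= sinN mulrN.
by apply: rcon_eq g2 => t; rewrite /= add0r.
Qed.

(** For [u] of modulus 1 the weight [1 - Re (u^* e^{it})] is nonnegative, so its mean against [Im f]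
    is nonnegative too. By [mean_value] that mean is [Im (f a) - Im (c2 * d)], up to the factor
    [tau], and [u] is chosen so that [Im (c2 * d) = r * normc d / 2]. *)
Lemma disc_pick_lt f a d M r : 0 < r -> r < M ->
  (forall z, normc (z - a) < M -> exists k, cder f z k) ->
  (forall z, normc (z - a) < M -> 0 <= Im (f z)) ->
  cder f a d -> r * normc d <= 2 * Im (f a).
Proof.
move=> r0 rM df f0 fd.
have M0 : 0 < M by exact: lt_trans rM.
have fa0 : 0 <= Im (f a) by apply: f0; rewrite subrr normc0.
have [->|d0] := eqVneq d 0; first by rewrite normc0 mulr0 mulr_ge0.
have nd : 0 < normc d by rewrite normc_gt0.
pose u : R[i] := 'i * d^* / (normc d)%:C.
have nu : normc u = 1.
  rewrite /u !normcM normci mul1r normcJ -RCV normcR gtr0_norm ?invr_gt0//.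
  by rewrite mulfV// gt_eqF.
have ud : u * d = 'i * (normc d)%:C.
  have E : d^* * d = (normc d)%:C * (normc d)%:C.
    rewrite -RCM -expr2 normc_sqr; clear; case: d => p q.
    by apply: eq_ReIm; rewrite ?ReM ?ImM /=; ring.
  have n0 : (normc d)%:C != 0 by rewrite -normc_eq0 normcR normr_eq0 gt_eqF.
  by rewrite /u mulrAC -(mulrA 'i) E mulrA mulfK.
clearbody u.
pose c1 : R[i] := u^* / (2 * r)%:C; pose c2 : R[i] := u * (r / 2)%:C.
pose T := pick_aux f a d c1 c2.
have cT : ccont T a by exact: ccont_pick_aux.
have dT z : normc (z - a) < M -> z != a -> exists k, cder T z k.
  by move=> zM za; have [k fk] := df z zM; exact: cder_pick_aux fk.
have Ta : T a = f a - c2 * d by rewrite /T /pick_aux subrr mulr0 mul0r subr0 /slope eqxx.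
have TE t : T (a + circ r t) =
    f (a + circ r t) * (1 - Re (u^* * circ 1 t))%:C + c2 / r%:C * f a * circ 1 (- t).
  have r0' : r%:C != 0 by rewrite -normc_eq0 normcR normr_eq0 gt_eqF.
  have cr : circ r t = r%:C * circ 1 t.
    by apply: eq_ReIm; rewrite ?ReM ?ImM /=; ring.
  have c0 : circ 1 t != 0 by rewrite -normc_eq0 normc_circ// oner_eq0.
  have ci : circ 1 (- t) = (circ 1 t)^-1.
    apply: (mulfI c0); rewrite divff// circM subrr.
    by apply: eq_ReIm; rewrite /= ?cos0 ?sin0 ?mulr1 ?mulr0.
  have cj : circ 1 (- t) = (circ 1 t)^*.
    by apply: eq_ReIm; rewrite /= ?cosN ?sinN ?mul1r.
  have RE : (Re (u^* * circ 1 t))%:C = (u^* * circ 1 t + u * circ 1 (- t)) / 2.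
    by rewrite ReJ_add conjcM conjcc -cj.
  rewrite /T /pick_aux /slope ifN; last first.
    by rewrite -subr_eq0 addrC addKr cr mulf_neq0.
  have aE : a + circ r t - a = r%:C * circ 1 t by rewrite addrC addKr cr.
  have two : (2 : R)%:C = 2 :> R[i] by rewrite rmorph_nat.
  have c1E : c1 = u^* / (2 * r%:C) by rewrite /c1 RCM two.
  have c2E : c2 = u * (r%:C / 2) by rewrite /c2 RCM RCV two.
  have -> : (1 - Re (u^* * circ 1 t))%:C = 1 - (u^* * circ 1 t + u * circ 1 (- t)) / 2.
    by rewrite -RE; apply: eq_ReIm; rewrite ?ReB ?ImB /= ?subr0.
  rewrite aE ci c1E c2E; move: (circ 1 t) c0 r%:C r0' (f _) (f a) (u^*).
  by clear => X X0 r r0 F G v; field; rewrite r0 X0.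
have gf : gcon 0 tau (fun t => f (a + circ r t)).
  apply: (gcon_circ r0) => z zr.
  have zM : normc (z - a) < M by rewrite zr.
  by have [k /cder_cont] := df z zM.
have gT : gcon 0 tau (fun t => T (a + circ r t)).
  apply: (gcon_circ r0) => z zr; have za : z != a by rewrite -subr_eq0 -normc_gt0 zr.
  have zM : normc (z - a) < M by rewrite zr.
  by have [k /cder_cont] := dT z zM za.
have gc : gcon 0 tau (fun t => circ 1 (- t)).
  have [g1 g2] : gcon 0 tau (fun t => id (0 + circ 1 t)).
    by apply: (@gcon_circ id 0 1 ltr01) => z _; exact: ccont_id.
  split; first by apply: rcon_eq g1 => t; rewrite /= add0r cosN.
  by apply: rcon_eq (rconN g2) => t; rewrite /= add0r sinN mulrN.
have Tmean := mean_value r0 rM dT cT.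
have : 0 <= Im (cint 0 tau (fun t => T (a + circ r t)) -
   cint 0 tau (fun t => c2 / r%:C * f a * circ 1 (- t))).
  rewrite -(cintB gT (gconZ _ gc)) /=; apply: rint_ge0 => t _ /=.
  rewrite TE addrK ImM /= mulr0 add0r mulr_ge0//.
    by apply: f0; rewrite normc_disc// ltW.
  by rewrite subr_ge0 (le_trans (ler_norm _))// (le_trans (normc_Re _))//
    normcM normcJ nu mul1r normc_circ.
rewrite Tmean (cintZ _ gc) cint_circ_inv mulr0 subr0 Ta ImM /= mulr0 add0r.
rewrite pmulr_lge0 ?tau_gt0// ImB /c2 mulrAC ud.
rewrite !ImM !ReM /=; clear -r0 nd; set n := normc d; nra.
Qed.

Lemma disc_pick f a d M : 0 < M ->
  (forall z, normc (z - a) < M -> exists k, cder f z k) ->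
  (forall z, normc (z - a) < M -> 0 <= Im (f z)) ->
  cder f a d -> M * normc d <= 2 * Im (f a).
Proof.
move=> M0 df f0 fd; rewrite leNgt; apply/negP => H.
have nd : 0 < normc d.
  rewrite normc_gt0; apply: contraTneq H => ->.
  by rewrite normc0 mulr0 -leNgt mulr_ge0// f0// subrr normc0.
pose r := Num.max (M / 2) (2 * Im (f a) / normc d).
have [q rq qM] : exists2 q, r < q & q < M.
  exists ((r + M) / 2); [rewrite ltr_pdivlMr// mulr2n mulrDr mulr1 ltrD2l|
    rewrite ltr_pdivrMr// mulr2n mulrDr mulr1 ltrD2r];
  by rewrite gt_max ltr_pdivrMr// ltr_pMr ?ltr1n// ltr_pdivrMr.
have rq1 : M / 2 < q by apply: le_lt_trans rq; rewrite le_max lexx.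
have rq2 : 2 * Im (f a) / normc d < q.
  by apply: le_lt_trans rq; rewrite le_max lexx orbT.
have q0 : 0 < q by apply: lt_trans rq1; rewrite divr_gt0.
have := disc_pick_lt q0 qM df f0 fd.
by rewrite leNgt -ltr_pdivrMr// rq2.
Qed.

(** The disc estimate is carried over by a Moebius map; its factor 2 cancels against that of the
    derivative [2 i Im a] of the map. *)
Theorem schwarz_pick f a d :
  (forall z, 0 < Im z -> exists k, cder f z k) ->
  (forall z, 0 < Im z -> 0 <= Im (f z)) ->
  0 < Im a -> cder f a d -> Im a * normc d <= Im (f a).
Proof.
move=> df f0 a0 fd.
(* [m] maps the unit disc into the upper half-plane and 0 to [a]. *)
pose m (z : R[i]) := a^* + (a^* - a) * (z - 1)^-1.
have m0 : m 0 = a by rewrite /m sub0r invrN1 mulrN1 opprB addrC subrK.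
have mim z : normc (z - 0) < 1 -> 0 < Im (m z) /\ z - 1 != 0.
  rewrite subr0 => z1; have z10 : z - 1 != 0.
    by apply: contraTneq z1 => /eqP; rewrite subr_eq0 => /eqP ->; rewrite normc1 ltxx.
  split=> //; rewrite /m ImD ImJ ImM ReB ImB ReJ ImJ subrr mul0r add0r ReV ReB /=.
  have n0 : 0 < normc (z - 1) ^+ 2 by rewrite exprn_gt0// normc_gt0.
  rewrite addrC subr_gt0 mulrA ltr_pdivlMr// normc_sqr ReB ImB /= subr0.
  have : Re z ^+ 2 + Im z ^+ 2 < 1.
    rewrite -normc_sqr -(expr1n _ 2) ltr_pXn2r ?nnegrE ?normc_ge0//.
  clear -a0; move: (Re z) (Im z) => x y H; nra.
have dm z : normc (z - 0) < 1 -> cder m z (0 + (a^* - a) * (- 1 / (z - 1) ^+ 2)).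
  move=> /mim[_ z1]; apply: cderD; first exact: cder_cst.
  by apply: cderZ; exact: cder_inv_sub.
have := @disc_pick (fun z => f (m z)) 0 (d * (0 + (a^* - a) * (- 1 / (0 - 1) ^+ 2))) 1 ltr01.
rewrite m0 mul1r => H.
have E : 0 + (a^* - a) * (- 1 / (0 - 1) ^+ 2) = 'i * (2 * Im a)%:C.
  rewrite sub0r sqrrN expr1n divr1 mulrN1 opprB add0r.
  by apply: eq_ReIm; rewrite ?ReB ?ImB ?ReM ?ImM ?ReJ ?ImJ /=; ring.
have : normc (d * (0 + (a^* - a) * (- 1 / (0 - 1) ^+ 2))) <= 2 * Im (f a).
  apply: H.
  - move=> z z1; have [zi _] := mim z z1; have [k fk] := df _ zi.
    by eexists; apply: (cder_comp fk); exact: dm.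
  - by move=> z /mim[zi _]; exact: f0.
  - by apply: (cder_comp (g := m)); [rewrite m0|apply: dm; rewrite subrr normc0].
rewrite E normcM normcM normci mul1r normcR gtr0_norm ?mulr_gt0//.
by rewrite mulrCA ler_pM2l// mulrC.
Qed.

End MeanValue.

(** * Growth of holomorphic functions along segments *)

Section Gronwall.
Variable R : realType.
Implicit Types (s t x y k e m : R) (f : R[i] -> R[i]) (a b z w d : R[i]).

Lemma is_derive_mono (f df : R -> R) x y : x <= y ->
  (forall t, x <= t <= y -> is_derive t 1 f (df t)) ->
  (forall t, x <= t <= y -> 0 <= df t) -> f x <= f y.
Proof.
move=> xy Df df0.
have [||c cxy E] := @MVT_segment R f df x y xy.
- by move=> t /[!in_itv]/= /andP[t1 t2]; apply: Df; rewrite !ltW.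
- apply: rcon_within => t /Df[Dt _].
  exact/differentiable_continuous/derivable1_diffP.
rewrite -subr_ge0 E mulr_ge0 ?subr_ge0//.
by apply: df0; move: cxy; rewrite in_itv.
Qed.

Lemma path_der f a b d t : cder f (a + t%:C * b) d ->
  is_derive t 1 (fun s => Re (f (a + s%:C * b))) (Re (d * b)) /\
  is_derive t 1 (fun s => Im (f (a + s%:C * b))) (Im (d * b)).
Proof.
move=> [p [cp <- fE]].
have E s : f (a + s%:C * b) - f (a + t%:C * b) = (s - t)%:C * (p (a + s%:C * b) * b).
  rewrite fE addrC addKr opprD addrACA subrr add0r -mulrBl.
  have -> : s%:C - t%:C = (s - t)%:C :> R[i] by rewrite rmorphB.
  by rewrite mulrCA mulrA mulrC mulrA mulrC.
have cc e : 0 < e -> exists2 r : R, 0 < r & forall s, `|s - t| < r ->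
    normc (p (a + s%:C * b) * b - p (a + t%:C * b) * b) < e.
  move=> e0; have nb : 0 < normc b + 1 by rewrite ltr_wpDl ?normc_ge0.
  have [r r0 rP] := (ccontP p _).1 cp (e / (normc b + 1)) (divr_gt0 e0 nb).
  exists (r / (normc b + 1)) => [|s sr]; first by rewrite divr_gt0.
  rewrite -mulrBl normcM.
  have : normc (p (a + s%:C * b) - p (a + t%:C * b)) < e / (normc b + 1).
    apply: rP; rewrite opprD addrACA subrr add0r -mulrBl normcM -rmorphB normcR.
    move: sr; rewrite ltr_pdivlMr//; apply: le_lt_trans.
    by rewrite ler_wpM2l// lerDl.
  rewrite ltr_pdivlMr//; apply: le_lt_trans.
  by rewrite ler_wpM2l ?normc_ge0// lerDl.
split; apply/is_derive1_caratheodory.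
  exists (fun s => Re (p (a + s%:C * b) * b)); split=> //.
    by move=> s; rewrite -ReB E ReRM mulrC.
  apply/rcontP => e /cc[r r0 rP]; exists r => // s /rP; apply: le_lt_trans.
  by rewrite -ReB; exact: normc_Re.
exists (fun s => Im (p (a + s%:C * b) * b)); split=> //.
  by move=> s; rewrite -ImB E ImRM mulrC.
apply/rcontP => e /cc[r r0 rP]; exists r => // s /rP; apply: le_lt_trans.
by rewrite -ImB; exact: normc_Im.
Qed.

Lemma path_lip f a b k :
  (forall t, 0 <= t <= 1 -> exists2 d, cder f (a + t%:C * b) d & normc (d * b) <= k) ->
  normc (f (a + b) - f a) <= 2 * k.
Proof.
move=> H.
pose d t := xget 0 [set d | cder f (a + t%:C * b) d /\ normc (d * b) <= k].
have dP t : 0 <= t <= 1 -> cder f (a + t%:C * b) (d t) /\ normc (d t * b) <= k.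
  move=> /H[d0 h1 h2]; rewrite /d; case: xgetP => [d1 _ //|/(_ d0)[]]; by split.
have d1 t : 0 <= t <= 1 -> `|Re (d t * b)| <= k /\ `|Im (d t * b)| <= k.
  move=> /dP[_ h]; split; [exact: le_trans (normc_Re _) h|exact: le_trans (normc_Im _) h].
have e0 : a + (0 : R)%:C * b = a by rewrite mul0r addr0.
have e1 : a + (1 : R)%:C * b = a + b by rewrite mul1r.
have key (F G : R -> R) : (forall t, 0 <= t <= 1 -> is_derive t 1 F (G t)) ->
    (forall t, 0 <= t <= 1 -> `|G t| <= k) -> `|F 1 - F 0| <= k.
  move=> FG Gk; have k0 : 0 <= k by apply: le_trans (Gk 0 _); rewrite ?lexx ?ler01.
  have [||c c01 ->] := @MVT_segment R F G 0 1 ler01.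
  - by move=> t /[!in_itv]/= /andP[t1 t2]; apply: FG; rewrite !ltW.
  - apply: rcon_within => t /FG[Dt _].
    exact/differentiable_continuous/derivable1_diffP.
  by rewrite subr0 mulr1; apply: Gk; move: c01; rewrite in_itv.
apply: le_trans (normc_le_ReIm _) _; rewrite ReB ImB mulr_natl mulr2n.
apply: lerD.
  have := key (fun t => Re (f (a + t%:C * b))) (fun t => Re (d t * b)).
  rewrite e0 e1; apply => t t01; first by have [/path_der[]] := dP t t01.
  by have [] := d1 t t01.
have := key (fun t => Im (f (a + t%:C * b))) (fun t => Im (d t * b)).
rewrite e0 e1; apply => t t01; first by have [/path_der[]] := dP t t01.
by have [] := d1 t t01.
Qed.

(** The hypothesis says that the logarithm of [normc f] varies at most as fast as that of [E]. As
    [f] may vanish, logarithms are avoided: [|f|^2 / E^2] is shown to decrease and [|f|^2 E^2] to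
    increase. *)
Lemma gronwall f a b (E E' : R -> R) :
  (forall t, 0 <= t <= 1 -> is_derive t 1 E (E' t)) ->
  (forall t, 0 <= t <= 1 -> 0 < E t) ->
  (forall t, 0 <= t <= 1 -> exists2 d, cder f (a + t%:C * b) d &
     normc (d * b) * E t <= normc (f (a + t%:C * b)) * E' t) ->
  normc (f (a + b)) * E 0 <= normc (f a) * E 1 /\
  normc (f a) * E 0 <= normc (f (a + b)) * E 1.
Proof.
move=> DE E0 H.
pose d t := xget 0 [set d | cder f (a + t%:C * b) d /\
  normc (d * b) * E t <= normc (f (a + t%:C * b)) * E' t].
have dP t : 0 <= t <= 1 -> cder f (a + t%:C * b) (d t) /\
    normc (d t * b) * E t <= normc (f (a + t%:C * b)) * E' t.
  move=> /H[d0 h1 h2]; rewrite /d; case: xgetP => [d1 _ //|/(_ d0)[]]; by split.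
pose U t := Re (f (a + t%:C * b)); pose V t := Im (f (a + t%:C * b)).
pose U' t := Re (d t * b); pose V' t := Im (d t * b).
have DU t : 0 <= t <= 1 -> is_derive t 1 U (U' t) by move=> /dP[/path_der[]].
have DV t : 0 <= t <= 1 -> is_derive t 1 V (V' t) by move=> /dP[/path_der[]].
have nUV t : normc (f (a + t%:C * b)) = Num.sqrt (U t ^+ 2 + V t ^+ 2).
  by rewrite -normc_sqr sqrtr_sqr ger0_norm ?normc_ge0.
have bound t : 0 <= t <= 1 ->
    `|U t * U' t + V t * V' t| * E t <= (U t ^+ 2 + V t ^+ 2) * E' t.
  move=> t01; have [_ h] := dP t t01.
  have -> : U t * U' t + V t * V' t = Re ((f (a + t%:C * b))^* * (d t * b)).
    by rewrite [RHS]ReM ReJ ImJ mulNr opprK.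
  rewrite -normc_sqr; apply: le_trans (_ : normc (f (a + t%:C * b)) *
     (normc (d t * b) * E t) <= _).
    rewrite mulrA; apply: ler_wpM2r; first exact/ltW/E0.
    by apply: le_trans (normc_Re _) _; rewrite normcM normcJ.
  by rewrite expr2 -mulrA ler_wpM2l ?normc_ge0.
have i01 (t : R) : (t = 0 \/ t = 1) -> 0 <= t <= 1.
  by case=> ->; rewrite ?lexx ?ler01.
have fin (u v p q : R) : 0 <= u -> 0 <= v -> 0 < p -> 0 < q ->
    u ^+ 2 * p ^+ 2 <= v ^+ 2 * q ^+ 2 -> u * p <= v * q.
  move=> u0 v0 p0 q0; rewrite -!exprMn ler_pXn2r ?nnegrE ?mulr_ge0 ?(ltW p0) ?(ltW q0)//.
have e0 : a + (0 : R)%:C * b = a by rewrite mul0r addr0.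
have e1 : a + (1 : R)%:C * b = a + b by rewrite mul1r.
have E00 := E0 0 (i01 0 (or_introl erefl)).
have E01 := E0 1 (i01 1 (or_intror erefl)).
have n0 := normc_sqr (f a); have n1 := normc_sqr (f (a + b)).
split; apply: fin; rewrite ?normc_ge0// n0 n1.
  pose H1 t := - ((U t * U t + V t * V t) * ((E t)^-1 * (E t)^-1)).
  pose H1' t := 2 * ((U t ^+ 2 + V t ^+ 2) * E' t - (U t * U' t + V t * V' t) * E t)
    / E t ^+ 3.
  have : H1 0 <= H1 1.
    apply: (@is_derive_mono H1 H1') => // t t01.
      have Et := E0 t t01; have ne : E t != 0 by rewrite gt_eqF.
      have h1 := DU t t01; have h2 := DV t t01; have h3 := DE t t01.
      have h4 := is_deriveV ne h3.
      rewrite /H1; apply: is_derive_eq; rewrite /H1' /GRing.scale /=.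
      by field.
    rewrite /H1' divr_ge0 ?exprn_ge0 ?(ltW (E0 _ _))// mulr_ge0// subr_ge0.
    apply: le_trans (bound t t01); rewrite ler_wpM2r ?ler_norm//.
    exact/ltW/E0.
  rewrite /H1 /U /V e0 e1 lerN2 -!expr2 !exprVn.
  by rewrite ler_pdivrMr ?exprn_gt0// mulrAC ler_pdivlMr ?exprn_gt0.
pose H2 t := (U t * U t + V t * V t) * (E t * E t).
pose H2' t := 2 * ((U t ^+ 2 + V t ^+ 2) * E' t + (U t * U' t + V t * V' t) * E t)
    * E t.
have : H2 0 <= H2 1.
  apply: (@is_derive_mono H2 H2') => // t t01.
    have h1 := DU t t01; have h2 := DV t t01; have h3 := DE t t01.
    rewrite /H2; apply: is_derive_eq; rewrite /H2' /GRing.scale /=.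
    by ring.
  rewrite /H2' mulr_ge0 ?(ltW (E0 _ _))// mulr_ge0// addrC -[X in _ + X]opprK subr_ge0.
  rewrite lerNl; apply: le_trans (bound t t01); rewrite -mulNr ler_wpM2r//.
    exact/ltW/E0.
  by rewrite -normrN ler_norm.
by rewrite /H2 /U /V e0 e1 -!expr2.
Qed.

Lemma gronwall_exp f a b k : 0 <= k ->
  (forall t, 0 <= t <= 1 -> exists2 d, cder f (a + t%:C * b) d &
     normc (d * b) <= k * normc (f (a + t%:C * b))) ->
  normc (f (a + b)) <= expR k * normc (f a) /\
  normc (f a) <= expR k * normc (f (a + b)).
Proof.
move=> k0 H; pose E t := expR (k * t).
have DE (t : R) : is_derive t 1 E (k * E t).
  apply: (@is_derive_eq _ _ _ E t 1); rewrite /GRing.scale /= mulr1 mulrC.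
  by [].
have [] := @gronwall f a b E (fun t => k * E t) (fun t _ => DE t)
    (fun t _ => expR_gt0 _).
  move=> t t01; have [d fd dk] := H t t01; exists d => //.
  by rewrite mulrCA mulrA ler_wpM2r ?expR_ge0.
by rewrite /E !mulr0 expR0 !mulr1 mulrC (mulrC _ (normc (f (a + b)))) mulrC.
Qed.

End Gronwall.

(** * Nevanlinna functions and their boundary behaviour *)

Section Nevanlinna.
Variable R : realType.
Implicit Types (x y t k e m M c : R) (f g Q : R[i] -> R[i]) (a b z w d : R[i]).

Lemma nev_cder Q z : nevanlinna Q -> Im z != 0 -> exists d, cder Q z d.
Proof. by case=> H _ _ z0; apply/holo_atP; exact: H. Qed.

Lemma nev_im Q z : nevanlinna Q -> 0 < Im z -> 0 <= Im (Q z).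
Proof.
case=> _ _ H z0; have := H z; rewrite /nonreal /= gt_eqF// => /(_ isT).
by rewrite pmulr_lge0// invr_gt0.
Qed.

Lemma nev_sym Q z : nevanlinna Q -> Im z != 0 -> Q z^* = (Q z)^*.
Proof. by case=> _ H _ z0; exact: H. Qed.

Lemma nev_pick Q a d : nevanlinna Q -> 0 < Im a -> cder Q a d ->
  Im a * normc d <= Im (Q a).
Proof.
move=> nQ a0; apply: schwarz_pick => // z z0; last exact: nev_im.
by apply: nev_cder => //; rewrite gt_eqF.
Qed.

Lemma Im_path a b t : Im (a + t%:C * b) = Im a + t * Im b.
Proof. by rewrite ImD ImRM. Qed.

(** The segment from [a] to [b] stays at height at least [m], where Schwarz-Pick gives
    [|Q'| <= |Q| / m]. *)
Lemma nev_harnack Q a b m : nevanlinna Q -> 0 < m -> m <= Im a -> m <= Im b ->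
  normc (Q b) <= expR (normc (b - a) / m) * normc (Q a).
Proof.
move=> nQ m0 ma mb.
have := @gronwall_exp R Q a (b - a) (normc (b - a) / m).
rewrite (addrC a) subrK; case=> //.
  by rewrite divr_ge0 ?normc_ge0 ?(ltW m0).
move=> t /andP[t0 t1].
have zm : m <= Im (a + t%:C * (b - a)).
  by rewrite Im_path ImB; clear -ma mb t0 t1; nra.
have z0 : 0 < Im (a + t%:C * (b - a)) by exact: lt_le_trans zm.
have [d fd] := nev_cder nQ (lt0r_neq0 z0); exists d => //.
have := nev_pick nQ z0 fd => H.
rewrite normcM mulrC -mulrA; apply: ler_wpM2l; first exact: normc_ge0.
rewrite ler_pdivlMl//; apply: le_trans (_ : Im (a + t%:C * (b - a)) * normc d <= _).
  by rewrite ler_wpM2r ?normc_ge0.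
apply: (le_trans H); apply: le_trans (normc_Im _).
exact: ler_norm.
Qed.

(** By [nev_neq0] this is the class of Nevanlinna functions other than 0; unlike [nevanlinna], it is
    closed under the passage to [-1/Q]. *)
Definition nevpos Q := nevanlinna Q /\ forall z, Im z != 0 -> Q z != 0.

Lemma Im_conj_gt0 z : Im z != 0 -> 0 < Im z \/ 0 < Im z^*.
Proof.
by rewrite ImJ oppr_gt0 => z0; case: (ltgtP (Im z) 0) z0 => // h _; [right|left].
Qed.

(** By [nev_harnack] a zero at one point of the upper half-plane would spread to all of it. *)
Lemma nev_neq0 Q : nevanlinna Q -> (exists2 z, nonreal z & Q z <> 0) -> nevpos Q.
Proof.
move=> nQ [z1 z10 Qz1]; split=> //.
have up : exists2 w, 0 < Im w & Q w != 0.
  have [h|h] := Im_conj_gt0 z10; first by exists z1 => //; apply/eqP.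
  exists z1^* => //; rewrite (nev_sym nQ z10) -normc_eq0 normcJ normc_eq0.
  exact/eqP.
have [w w0 Qw] := up.
have U z : 0 < Im z -> Q z != 0.
  move=> z0; apply: contraNneq Qw => Qz.
  pose m := Num.min (Im z) (Im w).
  have m0 : 0 < m by rewrite lt_min z0.
  have := @nev_harnack Q z w m nQ m0; rewrite !ge_min !lexx orbT => /(_ isT isT).
  by rewrite Qz normc0 mulr0 => h; rewrite -normc_eq0 eq_le h normc_ge0.
move=> z z0; have [h|h] := Im_conj_gt0 z0; first exact: U.
by have := U _ h; rewrite (nev_sym nQ z0) -normc_eq0 normcJ normc_eq0.
Qed.

(** On a vertical line the logarithmic derivative is at most [1 / y], so [gronwall] applies with the
    height itself as [E]. *)
Lemma nev_vert Q x y0 y1 : nevanlinna Q -> 0 < y0 -> y0 <= y1 ->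
  normc (Q (x +i* y1)) * y0 <= normc (Q (x +i* y0)) * y1 /\
  normc (Q (x +i* y0)) * y0 <= normc (Q (x +i* y1)) * y1.
Proof.
move=> nQ y00 y01.
pose E t := y0 + t * (y1 - y0).
have DE (t : R) : is_derive t 1 E (y1 - y0).
  by apply: is_derive_eq; rewrite /GRing.scale /=; ring.
have pE t : (x +i* y0) + t%:C * (0 +i* (y1 - y0)) = x +i* E t.
  by apply: eq_ReIm; rewrite ?ReD ?ImD ?ReM ?ImM /= /E; ring.
have e1 : (x +i* y0) + (0 +i* (y1 - y0)) = x +i* y1.
  by apply: eq_ReIm; rewrite ?ReD ?ImD /=; ring.
have E0 t : 0 <= t <= 1 -> 0 < E t.
  by move=> /andP[t0 t1]; rewrite /E; clear -y00 y01 t0 t1; nra.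
have := @gronwall R Q (x +i* y0) (0 +i* (y1 - y0)) E (fun=> y1 - y0) (fun t _ => DE t) E0.
rewrite e1 /E mul0r addr0 mul1r (addrC y0) subrK; apply => t t01.
have z0 : 0 < Im (x +i* E t) by exact: E0.
have [d fd] := nev_cder nQ (lt0r_neq0 z0); rewrite pE; exists d => //.
rewrite normcM mulrAC.
have -> : normc (0 +i* (y1 - y0)) = y1 - y0.
  by rewrite /normc expr0n add0r sqrtr_sqr ger0_norm// subr_ge0.
rewrite ler_wpM2r ?subr_ge0//.
apply: le_trans (normc_Im _); apply: le_trans (ler_norm _).
by have := nev_pick nQ z0 fd; rewrite mulrC.
Qed.

(** This is a minimum principle for [Im f]. As [f a] is real, [disc_pick] about a nearby [w] gives
    [|f'(w)| <= (4 / M) Im (f w) <= (4 / M) |f w - f a|], and [gronwall_exp] keeps [f - f a] equal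
    to its value 0 at [a]. *)
Lemma cder_cst0 f a M : 0 < M -> Im (f a) = 0 ->
  (forall z, normc (z - a) < M -> exists d, cder f z d) ->
  (forall z, normc (z - a) < M -> 0 <= Im (f z)) ->
  forall z, normc (z - a) < M / 2 -> f z = f a.
Proof.
move=> M0 fa0 df f0 z za; have M2 : 0 < M / 2 by rewrite divr_gt0.
pose g w := f w - f a.
have gim w : Im (g w) = Im (f w) by rewrite /g ImB fa0 subr0.
have cg w d : cder f w d -> cder g w d.
  by move=> fd; rewrite -(subr0 d); apply: cderB => //; exact: cder_cst.
have [||h _] := @gronwall_exp R g a (z - a) (4 / M * normc (z - a)).
- by rewrite mulr_ge0 ?normc_ge0 ?divr_ge0 ?(ltW M0).
- move=> t /andP[t0 t1].
  have wa : normc (a + t%:C * (z - a) - a) < M / 2.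
    rewrite addrC addKr normcM normcR ger0_norm//.
    by apply: le_lt_trans za; rewrite ler_piMl ?normc_ge0.
  set w := a + _ in wa *.
  have near v : normc (v - w) < M / 2 -> normc (v - a) < M.
    move=> vw; have := le_normcD (v - w) (w - a); rewrite addrA subrK.
    by move/le_lt_trans; apply; rewrite (splitr M) ltrD.
  have [|d fd] := df w; first by apply: near; rewrite subrr normc0.
  exists d; first exact: cg.
  have H : M / 2 * normc d <= 2 * Im (f w).
    by apply: disc_pick => // v /near; [exact: df|exact: f0].
  suff : normc d <= 4 / M * normc (g w).
    by move=> h; rewrite normcM mulrAC ler_wpM2r ?normc_ge0.
  have := le_trans (ler_norm _) (normc_Im (g w)); rewrite gim.
  rewrite mulrAC ler_pdivlMr//; move: H.
  set n := normc d; set i := Im _; set j := normc _; clear -M0; nra.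
have ga : g a = 0 by rewrite /g subrr.
move: h; rewrite (addrC a) subrK ga normc0 mulr0 => h.
by apply/eqP; rewrite -subr_eq0 -normc_eq0 eq_le h normc_ge0.
Qed.

Lemma holo_extP Q g z : holo_ext Q g z <-> exists2 e : R, 0 < e &
  forall w, normc (w - z) < e -> (exists d, cder g w d) /\ (Im w != 0 -> g w = Q w).
Proof.
split=> [[/nbhsCP[e1 e10 H1] /nbhsCP[e2 e20 H2]]|[e e0 H]].
  exists (Num.min e1 e2); first by rewrite lt_min e10.
  move=> w; rewrite lt_min => /andP[/H1 w1 /H2 w2]; split=> //.
  exact/holo_atP.
split; apply/nbhsCP; exists e => // w /H[h1 h2] //; exact/holo_atP.
Qed.

Lemma holo_ext_near Q g z : holo_ext Q g z ->
  exists2 e : R, 0 < e & forall w, normc (w - z) < e -> holo_ext Q g w.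
Proof.
move=> /holo_extP[e e0 H]; exists (e / 2); first by rewrite divr_gt0.
move=> w wz; apply/holo_extP; exists (e / 2); first by rewrite divr_gt0.
move=> v vw; apply: H; have := le_normcD (v - w) (w - z); rewrite addrA subrK.
by move/le_lt_trans; apply; rewrite (splitr e) ltrD.
Qed.

Lemma nonreal_dense x e : 0 < e -> exists2 w, normc (w - x%:C) < e & 0 < Im w.
Proof.
move=> e0; exists (x +i* (e / 2)); last by rewrite divr_gt0.
rewrite -(complexr0 x) normc_verB subr0 gtr0_norm ?divr_gt0//.
by rewrite ltr_pdivrMr// ltr_pMr// ltr1n.
Qed.

Lemma holo_ext_uniq Q g h z : holo_ext Q g z -> holo_ext Q h z -> g z = h z.
Proof.
move=> /holo_extP[e e0 H] /holo_extP[k k0 K].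
have zz r : 0 < r -> normc (z - z) < r by rewrite subrr normc0.
have [z0|z0] := eqVneq (Im z) 0; last first.
  by have [_ ->//] := H _ (zz _ e0); have [_ ->] := K _ (zz _ k0).
have [[d1 /cder_cont cg] _] := H _ (zz _ e0).
have [[d2 /cder_cont ch] _] := K _ (zz _ k0).
apply/eqP; rewrite -subr_eq0; apply/eqP.
apply: (@ccont_eq0 _ (fun w => g w - h w)); first exact: ccontB.
move=> r r0; rewrite {1}(real_of_Im0 z0).
have m0 : 0 < Num.min r (Num.min e k) by rewrite !lt_min r0 e0.
have [w] := nonreal_dense (Re z) m0; rewrite !lt_min => /andP[wr /andP[we wk]] w0.
exists w => //; rewrite -real_of_Im0// in we wk.
have [_ ->] := H w we; rewrite ?gt_eqF//.
by have [_ ->] := K w wk; rewrite ?gt_eqF// subrr.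
Qed.

(** A total function that carries the boundary values, so that derivatives and order can be used
    across the real line. At real points outside [rho Q] it takes the default value 0, which means
    nothing. *)
Definition ext Q z : R[i] :=
  if Im z != 0 then Q z else xget 0 [set w | has_value Q z w].

Lemma extE Q z : Im z != 0 -> ext Q z = Q z.
Proof. by rewrite /ext => ->. Qed.

Lemma ext_val Q g z : holo_ext Q g z -> ext Q z = g z.
Proof.
move=> Hg; have := Hg => /holo_extP[e e0 H]; rewrite /ext; case: ifPn => z0.
  by have [|_ ->] := H z; rewrite ?subrr ?normc0.
case: xgetP => [w _ [h [Hh <-]]|/(_ (g z)) []]; first exact: holo_ext_uniq Hh Hg.
by exists g.
Qed.

Lemma ext_near Q g z : holo_ext Q g z ->
  exists2 e : R, 0 < e & forall w, normc (w - z) < e -> ext Q w = g w.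
Proof. by move=> /holo_ext_near[e e0 H]; exists e => // w /H /ext_val. Qed.

Lemma ext_cder Q z : rho Q z -> exists d, cder (ext Q) z d.
Proof.
move=> [g Hg]; have [e e0 H] := ext_near Hg.
have [k k0 K] := (holo_extP Q g z).1 Hg.
have [|[d gd] _] := K z; first by rewrite subrr normc0.
exists d; apply: cder_near gd; apply/nbhsCP; exists e => // w /H.
by move=> ->.
Qed.

Lemma ext_cder_nonreal Q z : nevanlinna Q -> Im z != 0 -> exists d, cder (ext Q) z d.
Proof.
move=> nQ z0; have [d fd] := nev_cder nQ z0; exists d; apply: cder_near fd.
apply/nbhsCP; exists `|Im z|; first by rewrite normr_gt0.
move=> w wz; rewrite extE//; apply: contraTneq wz => w0; rewrite -leNgt.
by apply: le_trans (normc_Im _); rewrite ImB w0 sub0r normrN.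
Qed.

Lemma rho_has_value Q z : rho Q z -> has_value Q z (ext Q z).
Proof. by move=> [g Hg]; exists g; split=> //; rewrite (ext_val Hg). Qed.

Lemma has_value_ext Q z w : has_value Q z w -> rho Q z /\ ext Q z = w.
Proof. by move=> [g [Hg <-]]; split; [exists g|exact: ext_val]. Qed.

Lemma Im0_lim f x : ccont f x%:C ->
  (forall e, 0 < e -> exists2 w, normc (w - x%:C) < e & `|Im (f w)| < e) ->
  Im (f x%:C) = 0.
Proof.
move=> /ccontP cf H; apply/eqP/negPn/negP => n0.
have h : 0 < `|Im (f x%:C)| / 2 by rewrite divr_gt0 ?normr_gt0.
have [d d0 dP] := cf _ h.
have [|w] := H (Num.min d (`|Im (f x%:C)| / 2)); first by rewrite lt_min d0.
rewrite !lt_min => /andP[/dP w1 _] /andP[_ w2].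
have := le_trans (normc_Im _) (ltW w1); rewrite ImB.
have := ler_normD (Im (f x%:C) - Im (f w)) (Im (f w)); rewrite subrK distrC.
move: w2 h; set p := `|Im (f x%:C)|; set q := `|_|; set r := `|_|; clear; lra.
Qed.

Lemma ext_real Q x : nevanlinna Q -> rho Q x%:C -> Im (ext Q x%:C) = 0.
Proof.
move=> nQ rx; have [d /cder_cont/ccontP cx] := ext_cder rx.
apply/eqP/negPn/negP => n0.
have n0' : 0 < `|Im (ext Q x%:C)| by rewrite normr_gt0.
have [r r0 rP] := cx _ n0'.
have [w wx w0] := nonreal_dense x r0.
have w0' : Im w != 0 by rewrite gt_eqF.
have wj : normc (w^* - x%:C) < r by rewrite -normcJ conjcB conjcc conjc_real.
have wj0 : Im w^* != 0 by rewrite ImJ oppr_eq0.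
have := rP _ wx; have := rP _ wj; rewrite (extE Q w0') (extE Q wj0) (nev_sym nQ w0').
move=> /(le_lt_trans (normc_Im _)) + /(le_lt_trans (normc_Im _)).
rewrite !ImB ImJ; clear; set u := Im (ext _ _); set v := Im _.
rewrite ltr_norml => /andP[h1 h2]; rewrite ltr_norml => /andP[h3 h4].
by have [u0|u0] := leP 0 u; [rewrite ger0_norm// in h1 h2 h3 h4|
  rewrite ltr0_norm// in h1 h2 h3 h4]; lra.
Qed.

End Nevanlinna.

(** * Nontangential limits, reflection, and Lindelof's theorem *)

Section BoundaryBehaviour.
Variable R : realType.
Implicit Types (x y t k e m M c r : R) (f g Q : R[i] -> R[i]) (a b z w d l : R[i]).

Lemma conjcN z : (- z)^* = - z^*.
Proof. exact: rmorphN. Qed.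

Lemma normcJR z x : normc (z^* - x%:C) = normc (z - x%:C).
Proof. by rewrite -[LHS]normcJ conjcB conjcc conjc_real. Qed.

Lemma nt_limP f c l : nt_lim f c l <-> forall M e, 0 < M -> 0 < e ->
  exists2 d : R, 0 < d & forall z, stolz c M z -> normc (z - c%:C) < d ->
    normc (f z - l) < e.
Proof.
split=> [H M e M0 e0|H M M0].
  have := H M M0 [set u | normc (u - l) < e].
  case/(_ _)/nbhsCP; first by apply/nbhsCP; exists e.
  by move=> d d0 dP; exists d => // z zs zd; exact: dP.
move=> A /nbhsCP[e e0 eA]; have [d d0 dP] := H M e M0 e0.
by apply/nbhsCP; exists d => // z zd zs; apply: eA; exact: dP.
Qed.

Lemma nt_lim_ooP f c : nt_lim_oo f c <-> forall M r, 0 < M ->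
  exists2 d : R, 0 < d & forall z, stolz c M z -> normc (z - c%:C) < d ->
    r < normc (f z).
Proof.
split=> [H M r M0|H M M0].
  have := H M M0 [set u | r < u].
  case/(_ _)/nbhsCP; first by exists r; split; rewrite ?num_real.
  by move=> d d0 dP; exists d => // z zs zd; exact: dP.
move=> A [r [_ rA]]; have [d d0 dP] := H M r M0.
by apply/nbhsCP; exists d => // z zd zs; apply: rA; exact: dP.
Qed.

Lemma stolz_pt c M e : 0 < M -> 0 < e -> exists2 z, stolz c M z & normc (z - c%:C) < e.
Proof.
move=> M0 e0; exists (c +i* (e / 2)).
  by split=> /=; rewrite ?subrr ?normr0 ?mulr_ge0 ?divr_gt0 ?(ltW M0) ?divr_ge0 ?(ltW e0).
rewrite -(complexr0 c) normc_verB subr0 gtr0_norm ?divr_gt0//.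
by rewrite ltr_pdivrMr// ltr_pMr// ltr1n.
Qed.

Lemma nt_lim_uniq f c l l' : nt_lim f c l -> nt_lim f c l' -> l = l'.
Proof.
move=> /nt_limP H /nt_limP H'; apply/eqP; rewrite -subr_eq0 -normc_eq0.
apply/negPn/negP => n0.
have e0 : 0 < normc (l - l') / 2.
  by rewrite divr_gt0// lt_def n0 normc_ge0.
have [d d0 dP] := H 1 _ ltr01 e0; have [d' d'0 d'P] := H' 1 _ ltr01 e0.
have m0 : 0 < Num.min d d' by rewrite lt_min d0.
have [z zs] := stolz_pt c ltr01 m0; rewrite lt_min => /andP[/(dP z zs) h /(d'P z zs) h'].
have := le_normcB (f z - l') (f z - l).
rewrite (_ : f z - l' - (f z - l) = l - l'); last by ring.
by rewrite leNgt [ltRHS]splitr ltrD.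
Qed.

Lemma nt_lim_not_oo f c l : nt_lim f c l -> nt_lim_oo f c -> False.
Proof.
move=> /nt_limP H /nt_lim_ooP H'.
have [d d0 dP] := H 1 1 ltr01 ltr01; have [d' d'0 d'P] := H' 1 (normc l + 1) ltr01.
have m0 : 0 < Num.min d d' by rewrite lt_min d0.
have [z zs] := stolz_pt c ltr01 m0; rewrite lt_min => /andP[/(dP z zs) h /(d'P z zs) h'].
have := ler_normcB (f z) l; rewrite leNgt.
by rewrite (lt_le_trans h)// lerBrDl ltW.
Qed.

Lemma nt_limZ f c l k : nt_lim f c l -> nt_lim (fun z => k%:C * f z) c (k%:C * l).
Proof.
move=> /nt_limP H; apply/nt_limP => M e M0 e0.
have k0 : 0 < `|k| + 1 by rewrite ltr_wpDl.
have [d d0 dP] := H M (e / (`|k| + 1)) M0 (divr_gt0 e0 k0).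
exists d => // z zs /(dP z zs); rewrite ltr_pdivlMr// -mulrBr normcM normcR mulrC.
by apply: le_lt_trans; rewrite ler_wpM2r ?normc_ge0// lerDl.
Qed.

(** Symmetry provides the function on both sides of the line, real boundary values make it
    continuous across, and [painleve] makes it holomorphic. *)
Lemma rho_reflect Q c s (q : R -> R) : nevanlinna Q -> 0 < s ->
  (forall x, `|x - c| < s -> forall e, 0 < e -> exists2 d : R, 0 < d &
     forall z, 0 < Im z -> normc (z - x%:C) < d -> normc (Q z - (q x)%:C) < e) ->
  has_value Q c%:C (q c)%:C.
Proof.
move=> nQ s0 H.
pose g z := if Im z != 0 then Q z else (q (Re z))%:C.
have gE z : Im z != 0 -> g z = Q z by rewrite /g => ->.
have gR x : g x%:C = (q x)%:C by rewrite /g eqxx.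
have dg z : Im z != 0 -> exists d, cder g z d.
  move=> z0; have [d fd] := nev_cder nQ z0; exists d; apply: cder_near fd.
  apply/nbhsCP; exists `|Im z|; first by rewrite normr_gt0.
  move=> w wz; rewrite gE//; apply: contraTneq wz => w0; rewrite -leNgt.
  by apply: le_trans (normc_Im _); rewrite ImB w0 sub0r normrN.
have up x e : `|x - c| < s -> 0 < e -> exists2 d : R, 0 < d & forall z, Im z != 0 ->
    normc (z - x%:C) < d -> normc (Q z - (q x)%:C) < e.
  move=> xs e0; have [d d0 dP] := H x xs e e0; exists d => // z z0 zd.
  have [h|h] := Im_conj_gt0 z0; first exact: dP.
  by have := dP _ h; rewrite (nev_sym nQ z0) !normcJR => /(_ zd).
have cg x : `|x - c| < s -> ccont g x%:C.
  move=> xs; apply/ccontP => e e0; have e2 : 0 < e / 2 by rewrite divr_gt0.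
  have [d d0 dP] := up x _ xs e2.
  pose d' := Num.min (d / 2) (s - `|x - c|).
  have d2 : 0 < d / 2 by rewrite divr_gt0.
  exists d' => [|w]; first by rewrite lt_min d2 subr_gt0.
  rewrite lt_min => /andP[wd ws]; rewrite gR; have [w0|w0] := eqVneq (Im w) 0; last first.
    rewrite gE//; apply: (@lt_trans _ _ (e / 2)); last first.
      by rewrite ltr_pdivrMr// ltr_pMr// ltr1n.
    by apply: dP => //; apply: lt_trans wd _; rewrite ltr_pdivrMr// ltr_pMr// ltr1n.
  rewrite (real_of_Im0 w0) gR; set t := Re w.
  have tx : `|t - x| < s - `|x - c|.
    by apply: le_lt_trans ws; rewrite (real_of_Im0 w0) -rmorphB normcR.
  have ts : `|t - c| < s.
    have := ler_normD (t - x) (x - c); rewrite addrA subrK.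
    by move=> /le_lt_trans; apply; rewrite -ltrBrDr.
  have [d1 d10 d1P] := up t _ ts e2.
  have m0 : 0 < Num.min d1 (d / 2) by rewrite lt_min d10.
  (* [v] lies above the axis, close to both [t] and [x]. Comparing [q t] and [q x] with [Q v] makes
     [q] continuous, although the limits are not assumed uniform in the boundary point. *)
  have [v + v0] := nonreal_dense t m0.
  rewrite lt_min => /andP[v1 v2].
  have v0' : Im v != 0 by rewrite gt_eqF.
  have A := d1P v v0' v1.
  have vx : normc (v - x%:C) < d.
    have := le_normcD (v - t%:C) (t%:C - x%:C); rewrite addrA subrK.
    move=> /le_lt_trans; apply; rewrite (splitr d) ltrD//.
    by rewrite -(real_of_Im0 w0).
  have B := dP v v0' vx.
  have := le_normcB (Q v - (q x)%:C) (Q v - (q t)%:C).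
  rewrite (_ : Q v - (q x)%:C - (Q v - (q t)%:C) = (q t)%:C - (q x)%:C); last by ring.
  by move=> /le_lt_trans; apply; rewrite (splitr e) ltrD.
have s2 : 0 < s / 2 by rewrite divr_gt0.
have hs : s / 2 < s by rewrite ltr_pdivrMr// ltr_pMr// ltr1n.
have dall w : `|Re w - c| < s / 2 -> `|Im w| < s / 2 -> exists d, cder g w d.
  apply: (painleve s2) => [z|z _]; last exact: dg.
  move=> [/andP[z1 z2] _]; have [z0|z0] := eqVneq (Im z) 0.
    rewrite (real_of_Im0 z0); apply: cg; apply: le_lt_trans hs.
    by rewrite ler_norml; apply/andP; split; [clear -z1|clear -z2]; lra.
  by have [d /cder_cont] := dg z z0.
exists g; split; last by rewrite gR.
apply/holo_extP; exists (s / 2) => // w wc; split; last exact: gE.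
apply: dall; apply: le_lt_trans wc; last first.
  by apply: le_trans (normc_Im _); rewrite ImB subr0.
by apply: le_trans (normc_Re _); rewrite ReB.
Qed.

(** [Im (ext Q)] vanishes at [x] and is nonnegative just above, so the derivative in the direction
    [i] has nonnegative imaginary part. *)
Lemma ext_der_ge0 Q x d : nevanlinna Q -> rho Q x%:C -> cder (ext Q) x%:C d ->
  0 <= Re d.
Proof.
move=> nQ rx /cderP H; rewrite -oppr_le0; apply: (@le0_of_lee _ _ 1) => e e0.
have [r r0 rP] := H e e0.
pose h := r / 2; have h0 : 0 < h by rewrite divr_gt0.
have hr : h < r by rewrite ltr_pdivrMr// ltr_pMr// ltr1n.
have wx : normc (x +i* h - x%:C) = h.
  by rewrite -(complexr0 x) normc_verB subr0 gtr0_norm.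
have := rP (x +i* h); rewrite wx => /(_ hr) /(le_trans (normc_Im _)).
rewrite !ImB (ext_real nQ rx) extE ?gt_eqF// ImM ReB ImB /= subrr !subr0 mulr0 addr0.
have := nev_im nQ (h0 : 0 < Im (x +i* h)).
rewrite ler_norml => i0 /andP[_ h2].
have : - (Re d) * h <= e * h by clear -i0 h2; lra.
by rewrite ler_pM2r// mul1r.
Qed.

Lemma ext_mono Q x y : nevanlinna Q -> x <= y ->
  (forall t, x <= t <= y -> rho Q t%:C) -> Re (ext Q x%:C) <= Re (ext Q y%:C).
Proof.
move=> nQ xy rxy.
pose d t := xget 0 [set d | cder (ext Q) t%:C d].
have dP t : x <= t <= y -> cder (ext Q) t%:C (d t).
  move=> /rxy/ext_cder[d0 h]; rewrite /d; case: xgetP => [d1 _ //|/(_ d0)[]]; exact: h.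
have E (t : R) : 0 + t%:C * 1 = t%:C :> R[i] by rewrite mulr1 add0r.
apply: (@is_derive_mono _ (fun t => Re (ext Q t%:C)) (fun t => Re (d t))) => // t txy.
  have [] := @path_der _ (ext Q) 0 1 (d t) t.
    by rewrite E; exact: dP.
  rewrite mulr1 => h _; move: h.
  by under eq_fun do rewrite mulr1 add0r.
by apply: (ext_der_ge0 nQ (rxy t txy)); exact: dP.
Qed.

Lemma nev_subR Q r : nevanlinna Q -> nevanlinna (fun z => Q z - r%:C).
Proof.
move=> [h1 h2 h3]; split=> z z0.
- have /holo_atP[d fd] := h1 z z0; apply/holo_atP; exists (d - 0).
  by apply: cderB => //; exact: cder_cst.
- by rewrite h2// conjcB conjc_real.
- by rewrite ImB /= subr0; exact: h3.
Qed.

Lemma nev_inv Q : nevpos Q -> nevpos (fun z => - (Q z)^-1).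
Proof.
move=> [nQ Q0]; split; last by move=> z /Q0; rewrite oppr_eq0 invr_eq0.
split=> z z0.
- have [d fd] := nev_cder nQ z0; apply/holo_atP; exists (- (- d / Q z ^+ 2)).
  by apply: cderN; apply: cderV => //; exact: Q0.
- by rewrite (nev_sym nQ z0) rmorphN fmorphV.
- have [_ _ H] := nQ; have := H z z0.
  by rewrite ImN ImV !mulNr opprK mulrAC => h; rewrite divr_ge0 ?sqr_ge0.
Qed.

Lemma has_value_inv Q z w : has_value Q z w -> w != 0 ->
  has_value (fun z => - (Q z)^-1) z (- w^-1).
Proof.
move=> [g [/holo_extP[e e0 H] gz]] w0.
have zz : normc (z - z) < e by rewrite subrr normc0.
have [[d gd] _] := H z zz.
have /nbhsCP[k k0 K] : \forall v \near (z : R[i]^o), g v != 0.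
  by apply: ccont_neq0 (cder_cont gd) _; rewrite gz.
exists (fun z => - (g z)^-1); split; last by rewrite gz.
apply/holo_extP; exists (Num.min e k) => [|v]; first by rewrite lt_min e0.
rewrite lt_min => /andP[ve vk]; have [[dv gv] gQ] := H v ve.
split; last by move=> /gQ ->.
exists (- (- dv / g v ^+ 2)); apply: cderN; apply: cderV => //; exact: K.
Qed.

Lemma nev_mirror Q : nevanlinna Q -> nevanlinna (fun z => - Q (- z)).
Proof.
move=> [h1 h2 h3]; split=> z z0.
- have /holo_atP[d fd] : holo_at Q (- z) by apply: h1; rewrite /nonreal /= ImN oppr_eq0.
  apply/holo_atP; exists (- (d * - 1)).
  apply: cderN; apply: (cder_comp (g := fun z => - z) fd).
  by apply: cderN; exact: cder_id.
- rewrite -conjcN h2; first by rewrite conjcN.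
  by rewrite /nonreal /= ImN oppr_eq0.
- have := h3 (- z); rewrite /nonreal /= ImN oppr_eq0 => /(_ z0).
  by rewrite ImN invrN mulrN mulNr.
Qed.

Lemma has_value_mirror Q z w : has_value Q z w ->
  has_value (fun z => - Q (- z)) (- z) (- w).
Proof.
move=> [g [/holo_extP[e e0 H] gz]].
exists (fun z => - g (- z)); split; last by rewrite opprK gz.
apply/holo_extP; exists e => // v ve.
have [|[d gd] gQ] := H (- v); first by rewrite -normcN opprD opprK.
split; last by move=> v0; rewrite gQ// ImN oppr_eq0.
exists (- (d * - 1)); apply: cderN; apply: (cder_comp (g := fun z => - z) gd).
by apply: cderN; exact: cder_id.
Qed.

Lemma Re_sqrtc_gt0 w : (Im w = 0 -> 0 < Re w) -> 0 < Re (sqrtc w).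
Proof.
move=> H; have : - Re w < normc w.
  have [w0|w0] := eqVneq (Im w) 0.
    by apply: lt_le_trans (normc_ge0 w); rewrite oppr_lt0 H.
  rewrite ltNge; apply/negP => h.
  have : normc w ^+ 2 <= (- Re w) ^+ 2.
    by rewrite ler_pXn2r ?nnegrE ?normc_ge0// (le_trans (normc_ge0 _) h).
  rewrite normc_sqr sqrrN gerDl => h2.
  by move: w0; rewrite -sqrf_eq0 eq_le h2 sqr_ge0.
case: w {H} => x y /= h; rewrite sqrtr_gt0 divr_gt0//.
by rewrite -ltrBlDr sub0r.
Qed.

(** Off the slit the principal square root [S] of [f] has positive real part, so [disc_pick] for
    ['i * S] gives [|S'| <= (4 / M) |S|], hence [|f'| <= (8 / M) |f|]. A path of length at most
    [M / 2] then costs [expR 4]. *)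
Lemma disc_slit f a M : 0 < M ->
  (forall z, normc (z - a) < M -> exists d, cder f z d) ->
  (forall z, normc (z - a) < M -> Im (f z) = 0 -> 0 < Re (f z)) ->
  forall z, normc (z - a) < M / 2 -> normc (f z) <= expR 4 * normc (f a).
Proof.
move=> M0 df f0 z za.
pose S w := sqrtc (f w).
have SE w : S w * S w = f w by rewrite -expr2 sqr_sqrtc.
have S0 w : normc (w - a) < M -> 0 < Re (S w) by move=> /f0; exact: Re_sqrtc_gt0.
have Sd w : normc (w - a) < M -> exists d, cder S w d.
  move=> wa; have [d fd] := df w wa.
  have sw := S0 w wa.
  have /nbhsCP[k k0 K] : \forall v \near (w : R[i]^o), normc (v - w) < M - normc (w - a).
    by apply/nbhsCP; exists (M - normc (w - a)); rewrite ?subr_gt0.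
  have va v : normc (v - w) < k -> normc (v - a) < M.
    move=> /K; rewrite ltrBrDr; apply: le_lt_trans.
    by have := le_normcD (v - w) (w - a); rewrite addrA subrK.
  have sum v : normc (v - w) < k -> S v + S w != 0.
    move=> /va/S0 sv; apply: contraTneq sw => e.
    have := congr1 (@complex.Re R) e; rewrite ReD /= => e'.
    by rewrite -leNgt -e' lerDr ltW.
  have cS : ccont S w.
    have /ccontP cf := cder_cont fd; apply/ccontP => e e0.
    have [r r0 rP] := cf (e * Re (S w)) (mulr_gt0 e0 sw).
    exists (Num.min r k) => [|v]; first by rewrite lt_min r0.
    rewrite lt_min => /andP[/rP + vk]; rewrite -!SE.
    have -> : S v * S v - S w * S w = (S v - S w) * (S v + S w) by ring.
    rewrite normcM => h; rewrite -(ltr_pM2r sw); apply: le_lt_trans h.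
    apply: ler_wpM2l; first exact: normc_ge0.
    apply: le_trans (normc_Re _); apply: le_trans (ler_norm _).
    by rewrite ReD lerDr ltW// S0// va.
  move: fd => [p [cp pw fE]].
  exists (p w / (S w + S w)); apply/cder_slope.
  have ww : normc (w - w) < k by rewrite subrr normc0.
  have : ccont (fun v => p v / (S v + S w)) w.
    apply: (ccontM cp); apply: (@ccontV _ (fun v => S v + S w)); first exact: sum.
    exact: (ccontD cS (@ccont_cst _ _ _)).
  apply: ccont_near; apply/nbhsCP; exists k => // v vk.
  rewrite /slope; case: eqVneq => [->//|vw].
  have vw0 : v - w != 0 by rewrite subr_eq0.
  have sv := sum v vk.
  have E : (S v - S w) * (S v + S w) = p v * (v - w).
    have := fE v; rewrite -!SE => e.
    by rewrite mulrDr !mulrBl e; ring.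
  apply: (mulIf vw0); rewrite divfK//; apply: (mulIf sv).
  by rewrite E mulrAC divfK.
have [||h _] := @gronwall_exp R f a (z - a) 4 _ _; [|move=> t /andP[t0 t1]|]; last first.
- by move: h; rewrite (addrC a) subrK.
- set w := a + _.
  have wa : normc (w - a) < M / 2.
    rewrite /w addrC addKr normcM normcR ger0_norm//.
    by apply: le_lt_trans za; rewrite ler_piMl ?normc_ge0.
  have near v : normc (v - w) < M / 2 -> normc (v - a) < M.
    move=> vw; have := le_normcD (v - w) (w - a); rewrite addrA subrK.
    by move/le_lt_trans; apply; rewrite (splitr M) ltrD.
  have M2 : 0 < M / 2 by rewrite divr_gt0.
  have ww : normc (w - w) < M / 2 by rewrite subrr normc0.
  have [d sd] := Sd w (near w ww).
  exists (d * S w + S w * d).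
    have <- : (fun v => S v * S v) = f by apply/funext => v; exact: SE.
    exact: cderM.
  have H : M / 2 * normc ('i * d) <= 2 * Im ('i * S w).
    apply: (@disc_pick _ (fun v => 'i * S v)) => //.
    - by move=> v /near/Sd[d' sd']; exists ('i * d'); exact: cderZ.
    - by move=> v /near/S0; rewrite ImM /= mul0r add0r mul1r; exact: ltW.
    - exact: cderZ.
  rewrite ImM normcM normci /= mul0r add0r !mul1r in H.
  have -> : d * S w + S w * d = (2 : R)%:C * (d * S w) by rewrite rmorph_nat; ring.
  rewrite !normcM normcR -SE normcM ger0_norm//.
  have h2 := le_trans (ler_norm _) (normc_Re (S w)).
  have n0 := normc_ge0 (S w); have n1 := normc_ge0 d; have n2 := normc_ge0 (z - a).
  move: za H h2 n0 n1 n2; set p := normc d; set q := normc (S w); set s := Re _.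
  set u := normc _; clear -M0 => za H h2 q0 p0 u0.
  have A : p * u <= p * (M / 2) by rewrite ler_wpM2l// ltW.
  have B : p * u <= 2 * q by clear -A H h2; lra.
  have C : p * u * q <= 2 * q * q by rewrite ler_wpM2r.
  by clear -C; lra.
- by [].
Qed.

(** A real value at a nonreal point makes [Q] constant, by [nev_neq0] for [Q] minus that value; the
    constant is then also the boundary value at [x]. *)
Lemma ext_const_bound Q z x k : nevanlinna Q -> Im z != 0 -> Im (Q z) = 0 ->
  rho Q x%:C -> Re (ext Q x%:C) <= k -> Re (Q z) <= k.
Proof.
move=> nQ z0 Qz0 rx xk.
have E w : Im w != 0 -> Q w = (Re (Q z))%:C.
  move=> w0; apply/eqP; rewrite -subr_eq0; apply/negPn/negP => ne.
  have [|_ /(_ z z0)] := @nev_neq0 _ (fun w => Q w - (Re (Q z))%:C) (nev_subR _ nQ).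
    by exists w => //; exact/eqP.
  by rewrite -(real_of_Im0 Qz0) subrr eqxx.
have [d /cder_cont cx] := ext_cder rx.
have : ext Q x%:C - (Re (Q z))%:C = 0.
  apply: (@ccont_eq0 _ (fun w => ext Q w - (Re (Q z))%:C)).
    exact: (ccontB cx (@ccont_cst _ _ _)).
  move=> e /(nonreal_dense x)[w wx w0]; exists w => //.
  by rewrite extE ?gt_eqF// E ?gt_eqF// subrr.
by move/eqP; rewrite subr_eq0 => /eqP e; rewrite e in xk.
Qed.

(* Lindelof's theorem.  On the disc about [c - 4 y] of radius [4 y] the
   function [k + h - Q] avoids the negative axis, hence varies by a bounded factor;
   a horizontal segment then reaches the Stolz angle. *)
Lemma nt_lim_of_left Q c s k : nevanlinna Q -> 0 < s ->
  (forall x, c - s < x < c -> rho Q x%:C /\ Re (ext Q x%:C) <= k) ->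
  (forall e, 0 < e -> exists2 x, c - s < x < c & k - e < Re (ext Q x%:C)) ->
  nt_lim Q c k%:C.
Proof.
move=> nQ s0 H ksup; apply/nt_limP => M e M0 e0.
(* [expR 4] is the cost of [disc_slit], and [expR (M + 4)] that of the move at height [y] over a
   distance at most [(M + 4) * y] into the Stolz angle. *)
pose L := expR (M + 4) * expR 4.
have L0 : 0 < L by rewrite mulr_gt0 ?expR_gt0.
pose h := e / (4 * (1 + L)).
have h0 : 0 < h by rewrite divr_gt0// mulr_gt0// addr_gt0.
have hL : h + L * (2 * h) < e.
  have -> : e = h * (4 * (1 + L)) by rewrite /h divfK// gt_eqF// mulr_gt0// addr_gt0.
  by clear -h0 L0; nra.
have [x0 /andP[x1 x2] x0k] := ksup h h0.
have x0P x : x0 <= x < c -> k - h < Re (ext Q x%:C).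
  move=> /andP[xx xc]; apply: lt_le_trans x0k _; apply: ext_mono => // t /andP[t1 t2].
  by have [] := H t _; rewrite ?(lt_le_trans x1 t1) ?(le_lt_trans t2 xc).
(* The disc of radius [4 * y] about [c - 4 * y] then meets the real line inside []x0, c[], where
   [ext Q] lies between [k - h] and [k]. *)
exists ((c - x0) / 8) => [|z [z0 zM] zd]; first by rewrite divr_gt0// subr_gt0.
set y := Im z in z0 zM *.
have y8 : 8 * y < c - x0.
  rewrite mulrC -ltr_pdivlMr//; apply: le_lt_trans zd.
  by apply: le_trans (normc_Im _); rewrite ImB subr0 ler_norm.
pose a : R[i] := (c - 4 * y)%:C.
pose f w := (k + h)%:C - ext Q w.
have inI w : normc (w - a) < 4 * y -> x0 < Re w < c.
  move=> /(le_lt_trans (normc_Re _)); rewrite ReB /= ltr_norml => /andP[w1 w2].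
  by apply/andP; split; clear -w1 w2 y8; lra.
have ry w : normc (w - a) < 4 * y -> Im w = 0 ->
    rho Q w /\ Re (ext Q w) <= k.
  move=> /inI/andP[w1 w2] w0; rewrite (real_of_Im0 w0); apply: H.
  by rewrite w2 (lt_trans x1).
have fd w : normc (w - a) < 4 * y -> exists d, cder f w d.
  move=> wa; have [d ed] : exists d, cder (ext Q) w d.
    have [w0|w0] := eqVneq (Im w) 0; last exact: ext_cder_nonreal.
    by apply: ext_cder; have [] := ry w wa w0.
  by exists (0 - d); apply: (cderB _ ed); exact: cder_cst.
have f0 w : normc (w - a) < 4 * y -> Im (f w) = 0 -> 0 < Re (f w).
  move=> wa; rewrite /f ImB ReB /= sub0r => /eqP; rewrite oppr_eq0 => /eqP fw.
  suff : Re (ext Q w) <= k by clear -h0; lra.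
  have [w0|w0] := eqVneq (Im w) 0; first by have [] := ry w wa w0.
  have x0r : c - s < x0 < c by rewrite x1.
  have [r1 r2] := H x0 x0r; rewrite extE// in fw *.
  exact: ext_const_bound r1 r2.
have y40 : 0 < 4 * y by rewrite mulr_gt0.
pose zy : R[i] := (c - 4 * y) +i* y.
have zya : normc (zy - a) < 4 * y / 2.
  rewrite /zy /a -complexr0 normc_verB subr0 gtr0_norm//.
  by clear -z0; lra.
have B1 := disc_slit y40 fd f0 zya.
have fa : normc (f a) <= 2 * h.
  have aa : normc (a - a) < 4 * y by rewrite subrr normc0.
  have [ra rk] := ry a aa erefl.
  have := x0P (c - 4 * y); rewrite -/a => /(_ _) A.
  have {}A : k - h < Re (ext Q a) by apply: A; apply/andP; split; clear -y8 z0; lra.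
  have -> : f a = (k + h - Re (ext Q a))%:C.
    by apply: eq_ReIm; rewrite /f ?ReB ?ImB /= ?(ext_real nQ ra) ?subr0.
  rewrite normcR ger0_norm; clear -A rk h0; lra.
have nK := nev_subR (k + h) nQ.
have B2 := @nev_harnack _ _ zy z y nK z0 (lexx _) (lexx _).
have zzy : normc (z - zy) / y <= M + 4.
  rewrite ler_pdivrMr// mulrDl.
  have -> : z - zy = (Re z - c + 4 * y)%:C.
    by apply: eq_ReIm; rewrite ?ReB ?ImB /= ?subrr//; ring.
  rewrite normcR; apply: le_trans (ler_normD _ _) _.
  by rewrite lerD// ger0_norm// ltW.
have zy0 : Im zy != 0 by rewrite gt_eqF.
have fzy : normc (Q zy - (k + h)%:C) = normc (f zy).
  by rewrite normcB /f extE.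
have : normc (Q z - (k + h)%:C) <= L * (2 * h).
  apply: le_trans B2 _; rewrite fzy /L -mulrA.
  apply: ler_pM; rewrite ?expR_ge0 ?normc_ge0// ?ler_expR//.
  by apply: le_trans B1 _; rewrite ler_wpM2l ?expR_ge0.
move=> B3; apply: le_lt_trans hL.
have -> : Q z - k%:C = h%:C + (Q z - (k + h)%:C) by rewrite rmorphD /=; ring.
apply: le_trans (le_normcD _ _) _.
by rewrite normcR gtr0_norm// lerD2l.
Qed.

(** The limit is the supremum of the values on the left of [c], which [ext_mono] makes a one-sided
    limit. *)
Theorem nt_lim_left Q c s k : nevanlinna Q -> 0 < s ->
  (forall x, c - s < x < c -> rho Q x%:C /\ Re (ext Q x%:C) <= k) ->
  exists2 l, nt_lim Q c l%:C & l <= k /\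
    forall x, c - s < x < c -> Re (ext Q x%:C) <= l.
Proof.
move=> nQ s0 H; pose A := [set Re (ext Q x%:C) | x in [set x | c - s < x < c]].
have A0 : A !=set0.
  exists (Re (ext Q (c - s / 2)%:C)), (c - s / 2) => //=.
  by apply/andP; split; clear -s0; lra.
have Ak : ubound A k by move=> _ [x xc <-]; have [] := H x xc.
have hA : has_sup A by split => //; exists k.
have le x : c - s < x < c -> Re (ext Q x%:C) <= sup A.
  by move=> xc; apply: ub_le_sup; [exact: hA.2|exists x].
exists (sup A); last by split=> //; exact: ge_sup.
apply: (nt_lim_of_left nQ s0) => [x xc|e e0].
  by have [] := H x xc; split=> //; exact: le.
by have [_ [x xc <-] xe] := sup_adherent e0 hA; exists x.
Qed.

End BoundaryBehaviour.

(** * Local form of a rational function at a point *)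

Section RationalFunctions.
Variable R : realType.
Implicit Types (x y t k e m c : R) (p q : {poly R[i]}) (a b z w : R[i]) (r : ratfun R).

Lemma mup_factor p a : p != 0 ->
  exists2 q, ~~ root q a & p = q * ('X - a%:P) ^+ mup a p.
Proof.
move=> p0; have [m [q qa E]] := multiplicity_XsubC p a.
rewrite p0 /= in qa.
exists q => //; rewrite {1}E; congr (_ * _ ^+ _).
by rewrite E mupMr// mup_XsubCX eqxx.
Qed.

Lemma poly_lip p (B : R) : 0 <= B -> exists2 k, 0 <= k & forall z w,
  normc z <= B -> normc w <= B ->
  normc p.[z] <= k /\ normc (p.[z] - p.[w]) <= k * normc (z - w).
Proof.
move=> B0; elim/poly_ind: p => [|p a [k k0 IH]].
  by exists 0 => // z w _ _; rewrite !horner0 subrr normc0 mul0r.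
exists (k * B + normc a + (k + B * k)) => [|z w zB wB].
  by rewrite !addr_ge0 ?mulr_ge0 ?normc_ge0.
have [pz pzw] := IH z w zB wB; rewrite !hornerMXaddC; split.
  apply: le_trans (le_normcD _ _) _; rewrite -[leLHS]addr0; apply: lerD.
    by rewrite normcM lerD2r ler_pM ?normc_ge0.
  by rewrite addr_ge0 ?mulr_ge0.
have -> : p.[z] * z + a - (p.[w] * w + a) = p.[z] * (z - w) + (p.[z] - p.[w]) * w.
  by ring.
apply: le_trans (le_normcD _ _) _; rewrite !normcM.
have A : normc p.[z] * normc (z - w) <= k * normc (z - w).
  by rewrite ler_wpM2r ?normc_ge0.
have C : normc (p.[z] - p.[w]) * normc w <= k * normc (z - w) * B.
  by rewrite ler_pM ?normc_ge0.
have D : 0 <= (k * B + normc a) * normc (z - w).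
  by rewrite mulr_ge0 ?addr_ge0 ?mulr_ge0 ?normc_ge0.
move: A C D; set n := normc _; set n' := normc _; set n'' := _ * normc w.
clear; lra.
Qed.

Lemma cder_poly p z : exists d, cder (horner p) z d.
Proof.
elim/poly_ind: p => [|p a [d pd]].
  exists 0; apply: (@cder_near _ (fun=> 0)); last exact: cder_cst.
  by apply/nbhsCP; exists 1 => // w _; rewrite horner0.
exists ((d * z + p.[z] * 1) + 0).
have <- : (fun w => p.[w] * w + a) = horner (p * 'X + a%:P).
  by apply/funext => w; rewrite hornerMXaddC.
by apply: cderD; [apply: cderM => //; exact: cder_id|exact: cder_cst].
Qed.

Lemma nonroot_near p a e : p != 0 -> 0 < e ->
  exists2 d : R, 0 < d & d <= e /\ forall w, normc (w - a) < d -> w != a -> ~~ root p w.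
Proof.
move=> p0 e0; have [q qa E] := mup_factor a p0.
have [d /cder_cont cq] := cder_poly q a.
have /nbhsCP[k k0 K] := ccont_neq0 cq qa.
exists (Num.min k e); first by rewrite lt_min k0.
split=> [|w]; first by rewrite ge_min lexx orbT.
rewrite lt_min => /andP[wk _] wa; rewrite E rootM negb_or; apply/andP; split.
  by rewrite rootE K.
by rewrite rootE horner_exp expf_eq0 hornerXsubC subr_eq0 negb_and wa orbT.
Qed.

(** [L] is the quotient of the cofactors of the powers of [z - a] in numerator and denominator. It
    is Lipschitz where both keep half of their modulus at [a]. The alternative
    [pole_order r a = 0%N] admits the centre when it is not a pole. *)
Lemma rat_local r a : rnum r != 0 -> exists L : R[i] -> R[i], exists d k,
  [/\ 0 < d, 0 <= k,
      forall z, normc (z - a) < d -> L z != 0,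
      forall z, normc (z - a) < d -> z != a \/ pole_order r a = 0%N ->
        ~~ root (rden r) z /\
        rfun r z = (z - a) ^+ zero_order r a / (z - a) ^+ pole_order r a * L z &
      forall z w, normc (z - a) < d -> normc (w - a) < d ->
        normc (L z - L w) <= k * normc (z - w)].
Proof.
move=> n0; have d0 := rden_neq0 r.
have [N Na NE] := mup_factor a n0; have [D Da DE] := mup_factor a d0.
have [dN /cder_cont/ccontP cN] := cder_poly N a.
have [dD /cder_cont/ccontP cD] := cder_poly D a.
have hN : 0 < normc N.[a] / 2 by rewrite divr_gt0// normc_gt0.
have hD : 0 < normc D.[a] / 2 by rewrite divr_gt0// normc_gt0.
have [e1 e10 H1] := cN _ hN; have [e2 e20 H2] := cD _ hD.
pose d := Num.min 1 (Num.min e1 e2).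
have dpos : 0 < d by rewrite !lt_min ltr01 e10.
have B0 : 0 <= normc a + 1 by rewrite addr_ge0 ?normc_ge0.
have [kN kN0 KN] := poly_lip N B0; have [kD kD0 KD] := poly_lip D B0.
have ball z : normc (z - a) < d -> [/\ normc z <= normc a + 1,
    normc N.[a] / 2 <= normc N.[z] & normc D.[a] / 2 <= normc D.[z]].
  rewrite !lt_min => /andP[z1 /andP[z2 z3]]; split.
  - have := le_normcD (z - a) a; rewrite subrK => /le_trans; apply.
    by rewrite addrC lerD2l ltW.
  - have := ler_normcB N.[a] N.[z]; rewrite normcB; have := H1 _ z2.
    by set u := normc _; set v := normc _; set t := normc _; clear; lra.
  - have := ler_normcB D.[a] D.[z]; rewrite normcB; have := H2 _ z3.
    by set u := normc _; set v := normc _; set t := normc _; clear; lra.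
have Nz z : normc (z - a) < d -> N.[z] != 0.
  by move=> /ball[_ h _]; rewrite -normc_gt0; exact: lt_le_trans h.
have Dz z : normc (z - a) < d -> D.[z] != 0.
  by move=> /ball[_ _ h]; rewrite -normc_gt0; exact: lt_le_trans h.
pose h := normc D.[a] / 2.
exists (fun z => N.[z] / D.[z]), d, ((kN * kD + kN * kD) / (h * h)); split=> //.
- by apply: divr_ge0; [rewrite addr_ge0// mulr_ge0|rewrite mulr_ge0// ltW].
- by move=> z zd; rewrite mulf_neq0 ?invr_eq0 ?Nz ?Dz.
- move=> z zd za; have pz : (z - a) ^+ pole_order r a != 0.
    by case: za => [za|->]; rewrite ?expr0 ?oner_eq0// expf_neq0// subr_eq0.
  split.
    rewrite DE rootE hornerM horner_exp hornerXsubC mulf_neq0//; exact: Dz.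
  rewrite /rfun {1}NE {1}DE !hornerM !horner_exp !hornerXsubC.
  rewrite -/(zero_order r a) -/(pole_order r a).
  have := Dz z zd; move: pz; set u := _ ^+ pole_order _ _; set v := _ ^+ _.
  by clear => u0 D0; field; rewrite u0 D0.
- move=> z w zd wd; have [z1 z2 z3] := ball z zd; have [w1 w2 w3] := ball w wd.
  have [nz nzw] := KN z w z1 w1; have [_ dzw] := KD w z w1 z1.
  have [dw _] := KD w w w1 w1.
  have -> : N.[z] / D.[z] - N.[w] / D.[w] =
      ((N.[z] - N.[w]) * D.[w] + N.[w] * (D.[w] - D.[z])) / (D.[z] * D.[w]).
    by field; rewrite !Dz.
  rewrite normcM normcV normcM mulrAC ler_pM ?normc_ge0 ?invr_ge0 ?mulr_ge0 ?normc_ge0//.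
    apply: le_trans (le_normcD _ _) _; rewrite !normcM mulrDl; apply: lerD.
      by rewrite mulrAC ler_pM ?normc_ge0.
    have [nw _] := KN w w w1 w1.
    by rewrite -mulrA ler_pM ?normc_ge0// normcB.
  have hh : h * h <= normc D.[z] * normc D.[w] by rewrite ler_pM// ltW.
  by rewrite lef_pV2 ?posrE// mulr_gt0// normc_gt0 Dz.
Qed.

Lemma rsph_root r z : ~~ root (rden r) z -> rsph r (Some z) = Some (rfun r z).
Proof. by rewrite /= => /negbTE ->. Qed.

Lemma rsym_rfun r z : rsymmetric r -> ~~ root (rden r) z ->
  ~~ root (rden r) z^* /\ rfun r z^* = (rfun r z)^*.
Proof.
move=> rs dz; have := rs z; rewrite (rsph_root dz) /=.
by case: ifPn => // dz' [<-].
Qed.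

Lemma coprime_orders r a : zero_order r a = 0%N \/ pole_order r a = 0%N.
Proof.
have [n0|n0] := eqVneq (zero_order r a) 0%N; first by left.
right; apply/eqP; rewrite -leqn0 leqNgt; apply/negP => p0.
have rn : root (rnum r) a.
  by apply: contraNT n0 => /mupNroot; rewrite /zero_order => ->.
have rd : root (rden r) a.
  by apply: contraTT p0 => /mupNroot; rewrite /pole_order => ->.
have := coprimep_root (rnum_coprime r) rn; rewrite -rootE => /negP; exact.
Qed.

(** Symmetry of [r] gives [L] conjugate values at conjugate points; the Lipschitz bound between
    these yields [|Im L| <= k |Im z|]. The margin [|l| / 4] keeps [L] close enough to [l] to fix the
    sign of its real part. *)
Lemma rat_local_real r c : rsymmetric r -> rnum r != 0 ->
  exists L : R[i] -> R[i], exists l d k,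
  [/\ 0 < d, 0 <= k, l != 0, L c%:C = l%:C &
  [/\ forall z, normc (z - c%:C) < d -> z != c%:C \/ pole_order r c%:C = 0%N ->
        ~~ root (rden r) z /\ rfun r z =
        (z - c%:C) ^+ zero_order r c%:C / (z - c%:C) ^+ pole_order r c%:C * L z,
      forall z, normc (z - c%:C) < d -> normc (L z - l%:C) <= k * normc (z - c%:C),
      forall z, normc (z - c%:C) < d -> `|Im (L z)| <= k * `|Im z| &
      forall z, normc (z - c%:C) < d -> normc (L z - l%:C) <= `|l| / 4]].
Proof.
move=> rs n0; have [L [d [k [d0 k0 Lnz LE Llip]]]] := rat_local c%:C n0.
have symL z : normc (z - c%:C) < d -> z != c%:C -> L z^* = (L z)^*.
  move=> zd zc; have zj : normc (z^* - c%:C) < d by rewrite normcJR.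
  have zjc : z^* != c%:C.
    by apply: contra_neq zc => h; rewrite -(conjcc z) h conjc_real.
  have [rz Ez] := LE z zd (or_introl zc); have [rzj Ezj] := LE _ zj (or_introl zjc).
  have [_] := rsym_rfun rs rz; rewrite Ez Ezj !(conjcM, rmorphXn, fmorphV) /=.
  rewrite conjcB conjc_real => h; apply: mulfI h.
  by rewrite mulf_neq0 ?invr_eq0 ?expf_neq0// subr_eq0.
have imL z : normc (z - c%:C) < d -> Im z != 0 -> `|Im (L z)| <= k * `|Im z|.
  move=> zd z0; have zc : z != c%:C by apply: contraNneq z0 => ->.
  have zj : normc (z^* - c%:C) < d by rewrite normcJR.
  have := le_trans (normc_Im _) (Llip z z^* zd zj); rewrite (symL z zd zc).
  rewrite ImB ImJ opprK.
  have -> : normc (z - z^*) = 2 * `|Im z|.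
    have -> : z - z^* = 'i * (2 * Im z)%:C.
      by apply: eq_ReIm; rewrite ?ReB ?ImB ?ReJ ?ImJ ?ReM ?ImM /=; ring.
    by rewrite normcM normci mul1r normcR normrM ger0_norm.
  have -> : Im (L z) + Im (L z) = 2 * Im (L z) by ring.
  by rewrite normrM ger0_norm// mulrCA ler_pM2l.
have cL z : normc (z - c%:C) < d -> ccont L z.
  move=> zd; apply/ccontP => e e0; have k1 : 0 < k + 1 by rewrite ltr_wpDl.
  exists (Num.min (e / (k + 1)) (d - normc (z - c%:C))) => [|w].
    by rewrite lt_min divr_gt0// subr_gt0.
  rewrite lt_min ltr_pdivlMr// ltrBrDr => /andP[w1 w2].
  have wd : normc (w - c%:C) < d.
    apply: le_lt_trans w2.
    by have := le_normcD (w - z) (z - c%:C); rewrite addrA subrK.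
  apply: le_lt_trans (Llip w z wd zd) _; apply: le_lt_trans w1.
  by rewrite mulrC ler_wpM2l ?normc_ge0// lerDl.
have imLR x : normc (x%:C - c%:C) < d -> Im (L x%:C) = 0.
  move=> xd; apply: Im0_lim => [|e e0]; first exact: cL.
  have k1 : 0 < k + 1 by rewrite ltr_wpDl.
  have m0 : 0 < Num.min e (Num.min (e / (k + 1)) (d - normc (x%:C - c%:C))).
    by rewrite !lt_min e0 divr_gt0//= subr_gt0.
  have [w + w0] := nonreal_dense x m0.
  rewrite !lt_min ltrBrDr ltr_pdivlMr// => /andP[w1 /andP[w2 w3]].
  exists w => //; apply: le_lt_trans w2.
  have wd : normc (w - c%:C) < d.
    apply: le_lt_trans w3.
    by have := le_normcD (w - x%:C) (x%:C - c%:C); rewrite addrA subrK.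
  apply: le_trans (imL w wd (lt0r_neq0 w0)) _.
  have : `|Im w| <= normc (w - x%:C).
    by apply: le_trans (normc_Im _); rewrite ImB subr0.
  move=> h; apply: (@le_trans _ _ (k * normc (w - x%:C))); first by rewrite ler_wpM2l.
  by rewrite mulrC ler_wpM2l ?normc_ge0// lerDl.
have cc : normc (c%:C - c%:C) < d by rewrite subrr normc0.
pose l := Re (L c%:C).
have lE : L c%:C = l%:C by exact: real_of_Im0 (imLR _ cc).
have l0 : l != 0.
  by have := Lnz _ cc; rewrite lE; apply: contra_neq => ->.
have k1 : 0 < k + 1 by rewrite ltr_wpDl.
have l4 : 0 < `|l| / 4 by rewrite divr_gt0// normr_gt0.
exists L, l, (Num.min d (`|l| / 4 / (k + 1))), k; split=> //.
  by rewrite lt_min d0 divr_gt0.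
have sub z : normc (z - c%:C) < Num.min d (`|l| / 4 / (k + 1)) -> normc (z - c%:C) < d.
  by rewrite lt_min => /andP[].
split=> z zd; have zd' := sub z zd.
- exact: LE.
- by rewrite -lE; exact: Llip.
- have [z0|z0] := eqVneq (Im z) 0; last exact: imL.
  rewrite (real_of_Im0 z0) imLR ?normr0 ?mulr_ge0//.
  by rewrite -(real_of_Im0 z0).
- rewrite -lE; apply: le_trans (Llip z c%:C zd' cc) _.
  move: zd; rewrite lt_min ltr_pdivlMr// => /andP[_ /ltW]; apply: le_trans.
  by rewrite mulrC ler_wpM2l ?normc_ge0// lerDl.
Qed.

End RationalFunctions.

(** * Necessity *)

Section NegativeMultiplier.
Variable R : realType.
Implicit Types (x y t s k e m c : R) (F Q : R[i] -> R[i]) (rr : R[i] -> R[i]).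
Implicit Types (a b z w d u v : R[i]).

(* Where the multiplier is nearly negative, [Im Q >= 0] and [Im (u Q) >= 0] force
   [Q] to be nearly real; Schwarz-Pick then bounds its logarithmic derivative. *)
Lemma log_bound Q u z d k : nevanlinna Q -> 0 < Im z -> cder Q z d ->
  0 <= Im (u * Q z) -> Re u < 0 -> `|Im u| <= k * Im z * - Re u ->
  Im (Q z) <= k * Im z * normc (Q z) /\ normc d <= k * normc (Q z).
Proof.
move=> nQ z0 fd; rewrite ImM => h u0 hk.
have sp := nev_pick nQ z0 fd.
have re := normc_Re (Q z).
have h3 : Im u * Re (Q z) <= `|Im u| * normc (Q z).
  apply: le_trans (ler_norm _) _; rewrite normrM ler_wpM2l//.
have h4 : `|Im u| * normc (Q z) <= k * Im z * - Re u * normc (Q z).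
  by rewrite ler_wpM2r ?normc_ge0.
have A : Im (Q z) <= k * Im z * normc (Q z).
  have u0' : 0 < - Re u by rewrite oppr_gt0.
  rewrite -(ler_pM2r u0'); move: h h3 h4; clear.
  move: (normc _) (`|Im u|) => n i; lra.
split=> //; rewrite -(ler_pM2l z0); apply: le_trans sp _.
by rewrite mulrCA mulrA.
Qed.

(** The upper half-disc is convex, so the bound on the logarithmic derivative integrates along
    segments inside it; being independent of the height, it makes [Q] Lipschitz up to the real
    line. *)
Lemma rho_of_neg Q rr c s k : nevpos Q -> 0 < s -> 0 <= k ->
  (forall z, 0 < Im z -> normc (z - c%:C) < s ->
     [/\ 0 <= Im (rr z * Q z), Re (rr z) < 0 &
         `|Im (rr z)| <= k * Im z * - Re (rr z)]) ->
  exists2 q : R, q != 0 & has_value Q c%:C q%:C.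
Proof.
move=> [nQ Q0] s0 k0 H.
pose B z := 0 < Im z /\ normc (z - c%:C) < s.
have Bseg z w t : B z -> B w -> 0 <= t <= 1 -> B (z + t%:C * (w - z)).
  move=> [z0 zs] [w0 ws] /andP[t0 t1]; split.
    by rewrite Im_path ImB; move: z0 w0; clear -t0 t1; nra.
  have -> : z + t%:C * (w - z) - c%:C = (1 - t)%:C * (z - c%:C) + t%:C * (w - c%:C).
    by rewrite rmorphB /=; ring.
  apply: le_lt_trans (le_normcD _ _) _; rewrite !normcM !normcR.
  rewrite ger0_norm ?subr_ge0// (ger0_norm t0).
  move: zs ws; move: (normc _) (normc _) => n' n; clear -t0 t1 => zs ws.
  have [->|tn] := eqVneq t 0; first by lra.
  have h : t * n' < t * s by rewrite ltr_pM2l// lt_def tn.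
  have h' : (1 - t) * n <= (1 - t) * s by rewrite ler_wpM2l ?subr_ge0// ltW.
  lra.
have Bd z : B z -> exists2 d, cder Q z d &
    Im (Q z) <= k * Im z * normc (Q z) /\ normc d <= k * normc (Q z).
  move=> [z0 zs]; have [d fd] := nev_cder nQ (lt0r_neq0 z0); exists d => //.
  by have [h1 h2 h3] := H z z0 zs; exact: log_bound h1 h2 h3.
have Bdist z w : B z -> B w -> normc (w - z) <= 2 * s.
  move=> [_ zs] [_ ws]; have := le_normcB (w - c%:C) (z - c%:C).
  rewrite (_ : w - c%:C - (z - c%:C) = w - z); last by ring.
  by move: zs ws; move: (normc _) (normc _) (normc _) => n n' n''; clear; lra.
have gr z w : B z -> B w -> normc (Q w) <= expR (k * (2 * s)) * normc (Q z).
  move=> Bz Bw; have [||h _] := @gronwall_exp R Q z (w - z) (k * (2 * s)).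
  - by rewrite mulr_ge0// mulr_ge0// ltW.
  - move=> t t01; have [d fd [_ dk]] := Bd _ (Bseg z w t Bz Bw t01); exists d => //.
    rewrite normcM -mulrA (mulrC (2 * s)) mulrA ler_pM ?normc_ge0//.
    exact: Bdist.
  by move: h; rewrite (addrC z) subrK.
pose w0 := c +i* (s / 2).
have Bw0 : B w0.
  split; first by rewrite /= divr_gt0.
  rewrite /w0 -(complexr0 c) normc_verB subr0 gtr0_norm ?divr_gt0//.
  by rewrite ltr_pdivrMr// ltr_pMr// ltr1n.
pose E := expR (k * (2 * s)); pose A := E * normc (Q w0).
have E0 : 0 < E by exact: expR_gt0.
have A0 : 0 <= A by rewrite mulr_ge0 ?normc_ge0 ?(ltW E0).
have QA z : B z -> normc (Q z) <= A by move=> Bz; exact: gr.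
pose K := 2 * (k * A).
have K0 : 0 <= K by rewrite mulr_ge0// mulr_ge0.
have lip z w : B z -> B w -> normc (Q w - Q z) <= K * normc (w - z).
  move=> Bz Bw; have := @path_lip R Q z (w - z) (k * A * normc (w - z)).
  rewrite (addrC z) subrK mulrA; apply=> t t01.
  have [d fd [_ dk]] := Bd _ (Bseg z w t Bz Bw t01); exists d => //.
  rewrite normcM ler_wpM2r ?normc_ge0//; apply: le_trans dk _.
  by rewrite ler_wpM2l// QA//; exact: Bseg.
have Bpt x (z : R[i]) (d : R) : `|x - c| < s -> 0 < Im z -> normc (z - x%:C) < d ->
    d <= s - `|x - c| -> B z.
  move=> xs z0 zd ds; split=> //.
  have := le_normcD (z - x%:C) (x%:C - c%:C); rewrite addrA subrK.
  move=> /le_lt_trans; apply; rewrite -rmorphB normcR -ltrBrDr.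
  exact: lt_le_trans zd ds.
(* As [Q] is [K]-Lipschitz, [Re (Q (x +i* t)) + K * t] is nondecreasing in [t]; its infimum is
   therefore the limit at [t = 0]. *)
pose U x := [set Re (Q (x +i* t)) + K * t | t in [set t | 0 < t < s - `|x - c|]].
pose q x := inf (U x).
have vx x t : 0 < t -> normc (x +i* t - x%:C) = t.
  by move=> t0; rewrite -(complexr0 x) normc_verB subr0 gtr0_norm.
have BU x t : `|x - c| < s -> 0 < t < s - `|x - c| -> B (x +i* t).
  move=> xs /andP[t0 ts]; apply: (Bpt x _ (s - `|x - c|)) => //.
  by rewrite vx.
have hU x : `|x - c| < s -> has_inf (U x).
  move=> xs; have h : 0 < s - `|x - c| by rewrite subr_gt0.
  split; first by exists (Re (Q (x +i* ((s - `|x - c|) / 2))) + K * ((s - `|x - c|) / 2)),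
    ((s - `|x - c|) / 2) => //=; apply/andP; split; clear -h; lra.
  exists (- A) => _ [t tt <-]; have /andP[t0 ts] := tt.
  have Bt := BU x t xs tt.
  have := le_trans (normc_Re _) (QA _ Bt); rewrite ler_norml => /andP[h1 _].
  by apply: le_trans h1 _; rewrite lerDl mulr_ge0// ltW.
have lim x : `|x - c| < s -> forall e, 0 < e -> exists2 d : R, 0 < d &
    forall z, 0 < Im z -> normc (z - x%:C) < d ->
      B z /\ normc (Q z - (q x)%:C) < e.
  move=> xs e e0; have e2 : 0 < e / 2 by rewrite divr_gt0.
  have [_ [t1 tt1 <-] t1q] := inf_adherent e2 (hU x xs).
  have /andP[t10 t1s] := tt1.
  have K3 : 0 < 3 * K + 1 by rewrite ltr_wpDl// mulr_ge0.
  exists (Num.min t1 (e / 2 / (3 * K + 1))) => [|z z0].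
    by rewrite lt_min t10 divr_gt0.
  rewrite lt_min ltr_pdivlMr// => /andP[zt1 ze].
  have Bz : B z by apply: Bpt zt1 _ => //; exact: ltW.
  split=> //; set t := Im z in z0.
  have tn : t <= normc (z - x%:C).
    by apply: le_trans (normc_Im _); rewrite ImB subr0 ler_norm.
  have tt : 0 < t < s - `|x - c|.
    by rewrite z0; apply: lt_trans t1s; exact: le_lt_trans tn zt1.
  have Bt := BU x t xs tt.
  have q1 : q x <= Re (Q (x +i* t)) + K * t.
    by apply: ge_inf; [exact: (hU x xs).2|exists t].
  have q2 : Re (Q (x +i* t)) + K * t <= Re (Q (x +i* t1)) + K * t1.
    have := lip _ _ (BU x t1 xs tt1) Bt => /(le_trans (normc_Re _)).
    rewrite normc_verB ReB distrC ler_norml => /andP[h _].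
    have tt1' : t <= t1 by apply: le_trans tn (ltW zt1).
    move: h; rewrite ler0_norm ?subr_le0//.
    by move: (Re _) (Re _) => p p'; clear; lra.
  have l1 : normc (Q z - Q (x +i* t)) <= K * normc (z - x%:C).
    apply: le_trans (lip _ _ Bt Bz) _; rewrite ler_wpM2l//.
    have -> : z - (x +i* t) = (Re (z - x%:C))%:C.
      by apply: eq_ReIm; rewrite ?ReB ?ImB /= ?subrr.
    by rewrite normcR normc_Re.
  have im : `|Im (Q z)| <= K * normc (z - x%:C).
    have [d _ [h _]] := Bd z Bz.
    rewrite ger0_norm ?nev_im//; apply: le_trans h _; rewrite mulrAC.
    apply: ler_pM; rewrite ?mulr_ge0 ?normc_ge0 ?(ltW z0)//.
    apply: (@le_trans _ _ (k * A)); first by rewrite ler_wpM2l// QA.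
    by rewrite /K; have := mulr_ge0 k0 A0; clear; lra.
  apply: le_lt_trans (normc_le_ReIm _) _; rewrite ReB ImB /= subr0.
  have := le_trans (normc_Re _) l1; rewrite ReB.
  move: q1 q2 t1q tn im ze; rewrite -/(q x).
  rewrite !ler_norml; set n := normc _; set u1 := Re (Q z); set u2 := Re _; set u3 := Re _.
  set v1 := Im (Q z); move=> q1 q2 t1q tn /andP[i1 i2] ze /andP[r1 r2].
  have iv : `|v1| <= K * n by rewrite ler_norml i1.
  have Kt : K * t <= K * n by rewrite ler_wpM2l.
  have Kt0 : 0 <= K * t by rewrite mulr_ge0 ?(ltW z0).
  have rv : `|u1 - q x| < e / 2 + 2 * (K * n).
    by rewrite ltr_norml; apply/andP; split; clear -q1 q2 t1q r1 r2 Kt Kt0 e0; lra.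
  clear -rv iv ze e0 tn z0; move: ze; rewrite mulrDr mulr1 => ze.
  have : n * (3 * K) = 3 * (K * n) by ring.
  lra.
have hv : has_value Q c%:C (q c)%:C.
  apply: (@rho_reflect R Q c s q) => // x xs e e0.
  by have [d d0 dP] := lim x xs e e0; exists d => // z z0 /(dP z z0)[].
(* A boundary value 0 would make [Q] too small near [c] for the comparison [gr] with the fixed point
   [w0]. *)
exists (q c) => //; apply/negP => /eqP qc.
have cs : `|c - c| < s by rewrite subrr normr0.
have nw : 0 < normc (Q w0) / E.
  by rewrite divr_gt0// normc_gt0 Q0//= gt_eqF// divr_gt0.
have [d d0 dP] := lim c cs _ nw.
have [z zc z0] := nonreal_dense c d0.
have [Bz] := dP z z0 zc; rewrite qc subr0 ltr_pdivlMr// mulrC.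
by rewrite ltNge gr.
Qed.

(* At a zero of [Re Q] the two sign conditions force [Q = 0]; so [Re Q] keeps its
   sign on the segment, and then [Im rr] cannot change sign. *)
Lemma ivt_sign Q rr c y : nevpos Q -> 0 < y ->
  (forall s, `|s| <= 1 / 2 -> 0 <= Im (rr ((c + y * s) +i* y) * Q ((c + y * s) +i* y))) ->
  (forall s, `|s| <= 1 / 2 -> Re (rr ((c + y * s) +i* y)) < 0) ->
  Im (rr ((c + y * (1 / 2)) +i* y)) * Im (rr ((c + y * - (1 / 2)) +i* y)) < 0 -> False.
Proof.
move=> [nQ Q0] y0 H1 H2 H3.
pose p s : R[i] := (c + y * s) +i* y.
pose f s := Re (Q (p s)).
have h1 : `|1 / 2 : R| <= 1 / 2 by rewrite ger0_norm// divr_ge0.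
have h2 : `|- (1 / 2) : R| <= 1 / 2 by rewrite normrN.
have key s : `|s| <= 1 / 2 -> f s = 0 -> False.
  move=> s1 fs; have := H1 s s1; rewrite ImM -/(p s) -/(f s) fs mulr0 addr0.
  have v0 := nev_im nQ (y0 : 0 < Im (p s)).
  rewrite nmulr_rge0 ?H2// => v0'.
  have : Q (p s) != 0 by rewrite Q0//= gt_eqF.
  by rewrite [Q _]ReImE -/(f s) fs (_ : Im _ = 0) ?eqxx//; apply/eqP; rewrite eq_le v0 v0'.
have sgn s : `|s| <= 1 / 2 -> Im (rr (p s)) != 0 -> 0 < Im (rr (p s)) * f s.
  move=> s1 i0; have := H1 s s1; rewrite ImM -/(p s) -/(f s).
  have v0 := nev_im nQ (y0 : 0 < Im (p s)).
  have r0 := H2 s s1; rewrite -/(p s) in r0.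
  have : Re (rr (p s)) * Im (Q (p s)) <= 0 by rewrite nmulr_rle0.
  move=> h h'; have : 0 <= Im (rr (p s)) * f s by clear -h h'; lra.
  rewrite le_eqVlt => /predU1P[/esym/eqP|//].
  by rewrite mulf_eq0 (negbTE i0) => /eqP /(key s s1).
have i1 : Im (rr (p (1 / 2))) != 0.
  by apply: contraTneq H3; rewrite /p => ->; rewrite mul0r ltxx.
have i2 : Im (rr (p (- (1 / 2)))) != 0.
  by apply: contraTneq H3; rewrite /p => ->; rewrite mulr0 ltxx.
have s1 := sgn _ h1 i1; have s2 := sgn _ h2 i2.
have ff : f (1 / 2) * f (- (1 / 2)) < 0.
  move: H3 s1 s2; rewrite -/(p (1 / 2)) -/(p (- (1 / 2))).
  move: (Im _) (Im _) (f _) (f _) => i j u v; clear => H3 s1 s2.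
  have : 0 < (i * j) * (u * v) by rewrite mulrACA mulr_gt0.
  by rewrite nmulr_rgt0 1?(mulrC i)// mulrC.
have cf : {within `[(- (1 / 2)), 1 / 2], continuous f}.
  apply: rcon_within => s _; apply/rcontP => e e0.
  have [d /cder_cont/ccontP cQ] := nev_cder nQ (lt0r_neq0 (y0 : 0 < Im (p s))).
  have [r r0 rP] := cQ e e0.
  exists (r / y) => [|t ts]; first by rewrite divr_gt0.
  rewrite /f -ReB; apply: le_lt_trans (normc_Re _) (rP _ _).
  rewrite normc_horB opprD addrACA subrr add0r -mulrBr normrM gtr0_norm// mulrC.
  by rewrite -ltr_pdivlMr.
have ab : - (1 / 2) <= 1 / 2 :> R by lra.
have [|t] := @IVT R f (- (1 / 2)) (1 / 2) 0 ab cf.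
  have n1 : f (1 / 2) != 0 by apply: contraTneq ff => ->; rewrite mul0r ltxx.
  rewrite ge_min le_max; case: (ltgtP (f (1 / 2)) 0) n1 ff => // h _.
    by rewrite nmulr_rlt0// => h'; rewrite (ltW h') orbT.
  by rewrite pmulr_rlt0// => h'; rewrite (ltW h') orbT.
rewrite in_itv /= => t12; apply: key; first by rewrite ler_norml.
Qed.

(** A horizontal move by at most twice the height costs [expR 2] by [nev_harnack]; [nev_vert] then
    goes up to height 1. *)
Lemma mid_bounds Q c z : nevanlinna Q -> 0 < Im z -> Im z <= 1 ->
  `|Re z - c| <= 2 * Im z ->
  Im z * normc (Q (c +i* 1)) <= expR 2 * normc (Q z) /\
  Im z * normc (Q z) <= expR 2 * normc (Q (c +i* 1)).
Proof.
move=> nQ z0 z1 zs; set y := Im z in z0 z1 zs *.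
pose w := c +i* y.
have zw : normc (z - w) / y <= 2.
  rewrite ler_pdivrMr//; have -> : z - w = (Re z - c)%:C.
    by apply: eq_ReIm; rewrite ?ReB ?ImB /= ?subrr.
  by rewrite normcR.
have h1 : normc (Q w) <= expR 2 * normc (Q z).
  apply: le_trans (@nev_harnack _ _ z w y nQ z0 (lexx _) (lexx _)) _.
  by rewrite ler_wpM2r ?normc_ge0// ler_expR normcB.
have h2 : normc (Q z) <= expR 2 * normc (Q w).
  apply: le_trans (@nev_harnack _ _ w z y nQ z0 (lexx _) (lexx _)) _.
  by rewrite ler_wpM2r ?normc_ge0// ler_expR.
have [v1 v2] := nev_vert c nQ z0 z1; rewrite -/w !mulr1 in v1 v2; split.
  by rewrite mulrC; exact: le_trans h1.
apply: le_trans (ler_wpM2l (ltW z0) h2) _; rewrite mulrCA.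
by rewrite ler_wpM2l ?expR_ge0// mulrC.
Qed.

(** Here [log_bound] holds with the constant [9 / |Re z - c|]. The vertical path up to the edge of
    the angle has length at most [|Re z - c| / 2], so the exponent is at most 9/2. *)
Lemma sector_log Q rr c s : nevanlinna Q ->
  (forall z, 0 < Im z -> normc (z - c%:C) < s -> 2 * Im z <= `|Re z - c| ->
     [/\ 0 <= Im (rr z * Q z), Re (rr z) < 0 &
       `|Im (rr z)| * `|Re z - c| <= 9 * Im z * - Re (rr z)]) ->
  forall z, 0 < Im z -> normc (z - c%:C) < s / 2 -> 2 * Im z <= `|Re z - c| ->
    let z' := Re z +i* (`|Re z - c| / 2) in
    normc (Q z') <= expR 5 * normc (Q z) /\ normc (Q z) <= expR 5 * normc (Q z').
Proof.
move=> nQ H z z0 zs zx z'.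
set x := Re z - c in zx z' *.
have x0 : 0 < `|x| by apply: lt_le_trans zx; rewrite mulr_gt0.
have bz : z' - z = 0 +i* (`|x| / 2 - Im z).
  by apply: eq_ReIm; rewrite ?ReB ?ImB /= ?subrr.
have nb : normc (z' - z) <= `|x| / 2.
  rewrite bz /normc expr0n add0r sqrtr_sqr ger0_norm; clear -z0 zx; lra.
have xs : `|x| < s / 2.
  by apply: le_lt_trans zs; apply: le_trans (normc_Re _); rewrite ReB.
have [||h1 h2] := @gronwall_exp R Q z (z' - z) 5 => //; last first.
  by move: h1 h2; rewrite (addrC z) subrK.
move=> t /andP[t0 t1]; set w := z + _.
have wE : w = Re z +i* (Im z + t * (`|x| / 2 - Im z)).
  by apply: eq_ReIm; rewrite /w bz ?ReD ?ImD ?ReM ?ImM /=; ring.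
have w0 : 0 < Im w by rewrite wE /=; clear -z0 zx t0 t1; nra.
have w2 : 2 * Im w <= `|x| by rewrite wE /=; clear -z0 zx t0 t1; nra.
have ws : normc (w - c%:C) < s.
  apply: le_lt_trans (normc_le_ReIm _) _; rewrite ReB ImB subr0 (gtr0_norm w0).
  by rewrite {1}wE /= -/x; clear -xs w2 x0; lra.
have [d fd] := nev_cder nQ (lt0r_neq0 w0); exists d => //.
have wx : Re w - c = x by rewrite wE.
have := H w w0 ws; rewrite wx => /(_ w2)[h1 h2 h3].
have h3' : `|Im (rr w)| <= 9 / `|x| * Im w * - Re (rr w).
  rewrite (_ : 9 / `|x| * _ * _ = 9 * Im w * - Re (rr w) / `|x|).
    by rewrite ler_pdivlMr.
  by field; rewrite gt_eqF.
have [_ dk] := log_bound nQ w0 fd h1 h2 h3'.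
rewrite normcM; apply: le_trans (ler_pM (normc_ge0 _) (normc_ge0 _) dk nb) _.
rewrite (_ : _ * _ * _ = 9 / 2 * normc (Q w)); last by field; rewrite gt_eqF.
by rewrite ler_wpM2r ?normc_ge0//; clear; lra.
Qed.

(** [A] and [B] are the real and imaginary parts of [(x +i* y) ^+ 2 * (p +i* q)]. With [m = - l],
    one finds [- A >= (5/16) m x^2] and [|B| |x| <= (11/4) m x^2 y], and 11/4 is just below 9 times
    5/16. *)
Lemma square_sector x y p q l k : l < 0 -> 0 < y -> 2 * y <= `|x| ->
  `|p - l| <= - l / 4 -> `|q| <= - l / 4 -> `|q| <= k * y -> k * `|x| <= - l / 4 ->
  let A := (x ^+ 2 - y ^+ 2) * p - 2 * x * y * q in
  let B := (x ^+ 2 - y ^+ 2) * q + 2 * x * y * p in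
  A < 0 /\ `|B| * `|x| <= 9 * y * - A.
Proof.
move=> l0 y0 yx pl ql qk kx A B; set n := `|x| in yx kx *.
have n2 : x ^+ 2 = n ^+ 2 by rewrite real_normK// num_real.
have n0 : 0 < n by apply: lt_le_trans yx; rewrite mulr_gt0.
have xy : `|2 * x * y| = 2 * n * y by rewrite !normrM (gtr0_norm y0) ger0_norm.
have yn : 2 * n * y <= n ^+ 2 by rewrite expr2 mulrAC ler_pM2r.
have y2 : 4 * y ^+ 2 <= n ^+ 2.
  rewrite (_ : 4 * y ^+ 2 = (2 * y) ^+ 2); last by ring.
  by rewrite ler_pXn2r ?nnegrE ?(ltW n0)// mulr_ge0 ?(ltW y0).
have y20 : 0 <= y ^+ 2 by exact: sqr_ge0.
pose m := - l; have m0 : 0 < m by rewrite oppr_gt0.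
have [p1 p2] : - (5 / 4 * m) <= p /\ p <= - (3 / 4 * m).
  by move: pl; rewrite ler_norml => /andP[h1 h2]; split; rewrite /m; clear -h1 h2; lra.
have D1 : 3 / 4 * n ^+ 2 <= x ^+ 2 - y ^+ 2 by rewrite n2; clear -y2; lra.
have D2 : x ^+ 2 - y ^+ 2 <= n ^+ 2 by rewrite n2; clear -y20; lra.
have n20 : 0 < n ^+ 2 by rewrite exprn_gt0.
have T1 : (x ^+ 2 - y ^+ 2) * p <= - (9 / 16 * (m * n ^+ 2)).
  have h : (x ^+ 2 - y ^+ 2) * (3 / 4 * m) <= (x ^+ 2 - y ^+ 2) * - p.
    rewrite ler_wpM2l//; first by apply: le_trans D1; clear -n20; lra.
    by clear -p2; lra.
  have h' : 3 / 4 * n ^+ 2 * (3 / 4 * m) <= (x ^+ 2 - y ^+ 2) * (3 / 4 * m).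
    by rewrite ler_wpM2r//; clear -m0; lra.
  by move: h h'; clear; lra.
have T2 : `|2 * x * y * q| <= m / 4 * n ^+ 2.
  by rewrite normrM xy mulrC; apply: ler_pM => //; rewrite mulr_ge0 ?mulr_ge0 ?(ltW n0) ?(ltW y0).
have A5 : 5 / 16 * (m * n ^+ 2) <= - A.
  by move: T1 T2; rewrite ler_norml /A => T1 /andP[T2 T3]; clear -T1 T2; lra.
have mn : 0 < m * n ^+ 2 by rewrite mulr_gt0.
split; first by clear -A5 mn; lra.
have B1 : `|(x ^+ 2 - y ^+ 2) * q| <= n ^+ 2 * (k * y).
  rewrite normrM; apply: ler_pM => //; rewrite ger0_norm//.
  by apply: le_trans D1; clear -n20; lra.
have B2 : `|2 * x * y * p| <= 2 * n * y * (5 / 4 * m).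
  rewrite normrM xy; apply: ler_wpM2l.
    by rewrite !mulr_ge0 ?(ltW n0) ?(ltW y0).
  by rewrite ler_norml; apply/andP; split; clear -p1 p2 m0; lra.
have B3 : `|B| <= n ^+ 2 * (k * y) + 2 * n * y * (5 / 4 * m).
  by apply: le_trans (ler_normD _ _) _; exact: lerD.
have B4 : `|B| * n <= (n ^+ 2 * (k * y) + 2 * n * y * (5 / 4 * m)) * n.
  by rewrite ler_pM2r.
have B5 : n ^+ 2 * y * (k * n) <= n ^+ 2 * y * (m / 4).
  by rewrite ler_wpM2l// mulr_ge0 ?(ltW n20) ?(ltW y0).
have B6 : y * (5 / 16 * (m * n ^+ 2)) <= y * - A by rewrite ler_pM2l.
have B7 : 0 < y * (m * n ^+ 2) by rewrite mulr_gt0.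
clear -B4 B5 B6 B7; lra.
Qed.

End NegativeMultiplier.

(** * Pairs of Nevanlinna functions [Q] and [F = r Q] *)

Section Multiplier.
Variable R : realType.
Implicit Types (x y t s k m c q : R) (F G Q P L M : R[i] -> R[i]).
Implicit Types (a z w : R[i]) (r : ratfun R).

Lemma rnum_neq0 r : (0 < rdeg r)%N -> rnum r != 0.
Proof.
apply: contraL => /eqP n0; have := rnum_coprime r; rewrite n0 coprime0p.
rewrite -size_poly_eq1 => /eqP s1.
by rewrite /rdeg n0 s1 size_poly0.
Qed.

Fact rinv_coprime r : coprimep (rden r) (rnum r).
Proof. by rewrite coprimep_sym; exact: rnum_coprime. Qed.

Definition rinv r (n0 : rnum r != 0) : ratfun R := RatFun n0 (rinv_coprime r).

Lemma rinv_sym r (n0 : rnum r != 0) : rsymmetric r -> rsymmetric (rinv n0).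
Proof.
move=> rs z; rewrite /rsph /=; have := rs z; rewrite /rsph.
case: ifPn => dj; case: ifPn => dz //=.
  move=> _; have nz := coprimep_root (rinv_coprime r) dz.
  have nj := coprimep_root (rinv_coprime r) dj.
  by rewrite !rootE (negbTE nz) (negbTE nj) (rootP dz) (rootP dj) !mul0r /=; congr Some; apply: eq_ReIm; rewrite /= ?oppr0.
move=> [E].
have nE : root (rnum r) z^* = root (rnum r) z.
  rewrite !rootE; apply/idP/idP => /eqP h.
    move: E; rewrite h mul0r => /esym/eqP; rewrite conjc_eq0 mulf_eq0 invr_eq0.
    by rewrite -!rootE (negbTE dz) orbF.
  move: E; rewrite h mul0r conjc0 => /eqP; rewrite mulf_eq0 invr_eq0.
  by rewrite -!rootE (negbTE dj) orbF.
rewrite nE; case: ifP => //= nz; congr Some.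
by rewrite -[LHS]invf_div E -fmorphV invf_div.
Qed.

(** Clearing the denominator makes the relation meaningful at every nonreal point, poles of [r]
    included, and makes the exchange of [Q] and [F], or the passage to [-1/Q] and [-1/F], purely
    algebraic. *)
Definition multiplier r Q F :=
  [/\ nevpos Q, nevpos F, rsymmetric r, rnum r != 0 &
      forall z, Im z != 0 -> F z * (rden r).[z] = (rnum r).[z] * Q z].

Lemma multiplier_inv r Q F (n0 : rnum r != 0) :
  multiplier r Q F -> multiplier (rinv n0) F Q.
Proof.
move=> [nQ nF rs _ E]; split=> //; [exact: rinv_sym|exact: rden_neq0|].
by move=> z z0; rewrite /= mulrC -(E z z0) mulrC.
Qed.

Lemma multiplier_neg r Q F (n0 : rnum r != 0) : multiplier r Q F ->
  multiplier (rinv n0) (fun z => - (Q z)^-1) (fun z => - (F z)^-1).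
Proof.
move=> [nQ nF rs _ E]; split; [exact: nev_inv|exact: nev_inv| | |].
- exact: rinv_sym.
- exact: rden_neq0.
- move=> z z0; rewrite /= mulNr mulrN; congr (- _).
  have Q0 := nQ.2 z z0; have F0 := nF.2 z z0.
  by apply: (mulfI F0); apply: (mulIf Q0); rewrite mulrA divff// mul1r -E//; field.
Qed.

Lemma multiplierE r Q F z : multiplier r Q F -> Im z != 0 -> ~~ root (rden r) z ->
  F z = rfun r z * Q z.
Proof.
move=> [_ _ _ _ E] z0 dz; rewrite /rfun mulrAC -E// mulfK//.
Qed.

(** [N00] does not compare [F] with [r Q] at the poles of [r]; these are isolated, so continuity
    restores the relation there. *)
Lemma multiplier_N00 r Q F : nevpos Q -> rsymmetric r -> rnum r != 0 -> nevanlinna F ->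
  (forall z, nonreal z -> ~~ root (rden r) z -> F z = rfun r z * Q z) ->
  multiplier r Q F.
Proof.
move=> nQ rs n0 nF H; split=> //.
  apply: nev_neq0 => //.
  have nd : rnum r * rden r != 0 by rewrite mulf_neq0// rden_neq0.
  have [d d0 [d1 dP]] := nonroot_near ((0 +i* 1) : R[i]) nd (ltr01 : 0 < (1 : R)).
  pose w : R[i] := 0 +i* (1 + d / 2).
  have wi : normc (w - (0 +i* 1)) = d / 2.
    by rewrite normc_verB addrC addKr gtr0_norm ?divr_gt0.
  have w0 : Im w != 0 by apply: lt0r_neq0; rewrite addr_gt0// divr_gt0.
  have := dP w; rewrite wi ltr_pdivrMr// ltr_pMr// ltr1n => /(_ isT).
  have wn : w != (0 +i* 1).
    by rewrite -subr_eq0 -normc_eq0 wi gt_eqF// divr_gt0.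
  move=> /(_ wn); rewrite rootM negb_or => /andP[nw dw].
  exists w => //; rewrite H//; apply/eqP; rewrite /rfun.
  by rewrite !mulf_neq0 ?invr_eq0 ?nQ.2.
move=> a a0; apply/eqP; rewrite -subr_eq0; apply/eqP.
apply: (@ccont_eq0 R (fun z => F z * (rden r).[z] - (rnum r).[z] * Q z)).
  have [d1 /cder_cont c1] := nev_cder nF a0; have [d2 /cder_cont c2] := nev_cder nQ.1 a0.
  have [d3 /cder_cont c3] := cder_poly (rden r) a; have [d4 /cder_cont c4] := cder_poly (rnum r) a.
  have c5 := ccontM c1 c3; have c6 := ccontM c4 c2.
  exact: (ccontB c5 c6).
move=> e e0; have m0 : 0 < Num.min e `|Im a| by rewrite lt_min e0 normr_gt0.
have [d d0 [de dP]] := nonroot_near a (rden_neq0 r) m0.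
pose w := a + (d / 2)%:C.
have wa : normc (w - a) = d / 2 by rewrite addrC addKr normcR gtr0_norm ?divr_gt0.
have wd : d / 2 < d by rewrite ltr_pdivrMr// ltr_pMr// ltr1n.
have wn : w != a by rewrite -subr_eq0 -normc_eq0 wa gt_eqF// divr_gt0.
have w0 : Im w != 0 by rewrite ImD addr0.
exists w; first by rewrite wa; apply: lt_le_trans wd _; move: de; rewrite le_min => /andP[].
have dw : ~~ root (rden r) w by apply: dP => //; rewrite wa.
by rewrite H// /rfun mulrAC divfK// subrr.
Qed.

Lemma multiplier_root r Q F a : multiplier r Q F ->
  root (rnum r) a \/ root (rden r) a -> Im a = 0.
Proof.
move=> [nQ nF _ _ E] h; apply/eqP; apply/negPn/negP => a0; have := E a a0.
case: h => h; rewrite (rootP h).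
  have := coprimep_root (rnum_coprime r) h => dn.
  by rewrite mul0r => /eqP; rewrite mulf_eq0 (negbTE (nF.2 a a0)) (negbTE dn).
have := coprimep_root (rinv_coprime r) h => dn.
by rewrite mulr0 => /esym/eqP; rewrite mulf_eq0 (negbTE (nQ.2 a a0)) (negbTE dn).
Qed.

Lemma rfun_real r x : rsymmetric r -> ~~ root (rden r) x%:C -> Im (rfun r x%:C) = 0.
Proof.
move=> rs dx; have [_] := rsym_rfun rs dx; rewrite conjc_real => h.
have := congr1 (fun z : R[i] => Im z) h; rewrite ImJ => e; clear -e; lra.
Qed.

Lemma multiplier_rho r Q F x : multiplier r Q F -> ~~ root (rden r) x%:C ->
  Re (rfun r x%:C) < 0 -> exists2 q, q != 0 & has_value Q x%:C q%:C.
Proof.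
move=> mQ dx rx; have [nQ nF rs n0 E] := mQ.
have [L [l [d [k [d0 k0 l0 Ll [LE Lk Li L4]]]]]] := rat_local_real x rs n0.
have nx : ~~ root (rnum r) x%:C.
  by apply: contraTN rx => h; rewrite /rfun (rootP h) mul0r ltxx.
have p0 : pole_order r x%:C = 0%N by apply: mupNroot.
have z0 : zero_order r x%:C = 0%N by apply: mupNroot.
have LE' z : normc (z - x%:C) < d -> ~~ root (rden r) z /\ rfun r z = L z.
  move=> zd; have [h1 ->] := LE z zd (or_intror p0).
  by rewrite p0 z0 !expr0 divr1 mul1r.
have lneg : l < 0.
  have [|_ h] := LE' x%:C; first by rewrite subrr normc0.
  by rewrite h Ll in rx.
pose m := - l; have m0 : 0 < m by rewrite oppr_gt0.
(* [Re (L z)] is at most [- m / 2], so [k * Im z] is at most [2 * k / m * Im z * - Re (L z)]. *)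
apply: (@rho_of_neg R Q (rfun r) x d (2 * k / m)) => //.
  by rewrite divr_ge0 ?mulr_ge0 ?(ltW m0).
move=> z zp zd; have [dz h] := LE' z zd.
have := Li z zd; rewrite (gtr0_norm zp) h => hi.
have : `|Re (L z) - l| <= m / 4.
  by have := le_trans (normc_Re _) (L4 z zd); rewrite ReB /= (ltr0_norm lneg).
rewrite ler_norml => /andP[h1 h2].
have hr : m / 2 <= - Re (L z) by rewrite /m; move: h2 m0; rewrite /m; clear; lra.
split; first by rewrite -h -(multiplierE mQ (lt0r_neq0 zp) dz); exact: nev_im nF.1 zp.
  by move: hr m0; clear; lra.
apply: le_trans hi _.
have -> : k * Im z = 2 * k / m * Im z * (m / 2) by field; rewrite gt_eqF.
by apply: ler_wpM2l hr; rewrite !mulr_ge0 ?invr_ge0 ?(ltW m0) ?(ltW zp).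
Qed.

Lemma multiplier_value r Q F z w : multiplier r Q F -> ~~ root (rden r) z ->
  has_value Q z w -> has_value F z (rfun r z * w).
Proof.
move=> mQ dz [g [/holo_extP[e e0 eP] gz]]; exists (fun z => rfun r z * g z).
split; last by rewrite gz.
have [d d0 [_ dP]] := nonroot_near z (rden_neq0 r) e0.
apply/holo_extP; exists (Num.min d e); first by rewrite lt_min d0.
move=> v; rewrite lt_min => /andP[vd ve].
have dv : ~~ root (rden r) v by have [->|vz] := eqVneq v z => //; exact: dP.
have [[k gk] gQ] := eP v ve; split.
  have [n' nn] := cder_poly (rnum r) v; have [d' dd] := cder_poly (rden r) v.
  eexists; apply: cderM; last exact: gk.
  by apply: cderM; [exact: nn|apply: cderV; [exact: dv|exact: dd]].
by move=> v0; rewrite gQ// (multiplierE mQ).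
Qed.

End Multiplier.

(** * Order of zeros, and size of [Q] near a double zero *)

Section ZeroOrder.
Variable R : realType.
Implicit Types (x y t s k m c q : R) (F G Q P L M : R[i] -> R[i]).
Implicit Types (a z w : R[i]) (r : ratfun R).

Lemma multiplier_local r Q F c : multiplier r Q F -> (0 < zero_order r c%:C)%N ->
  exists L : R[i] -> R[i], exists l d k,
  [/\ 0 < d, 0 <= k, l != 0 &
  [/\ forall z, normc (z - c%:C) < d -> z != c%:C ->
        ~~ root (rden r) z /\ rfun r z = (z - c%:C) ^+ zero_order r c%:C * L z,
      forall z, normc (z - c%:C) < d -> Im z != 0 ->
        F z = (z - c%:C) ^+ zero_order r c%:C * L z * Q z,
      forall z, normc (z - c%:C) < d -> normc (L z - l%:C) <= k * normc (z - c%:C),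
      forall z, normc (z - c%:C) < d -> `|Im (L z)| <= k * `|Im z| &
      forall z, normc (z - c%:C) < d -> normc (L z - l%:C) <= `|l| / 4]].
Proof.
move=> mQ z0; have [_ _ rs n0 _] := mQ.
have p0 : pole_order r c%:C = 0%N.
  by case: (coprime_orders r c%:C) => // h; rewrite h in z0.
have [L [l [d [k [d0 k0 l0 _ [LE Lk Li L4]]]]]] := rat_local_real c rs n0.
have LE' z : normc (z - c%:C) < d -> z != c%:C ->
    ~~ root (rden r) z /\ rfun r z = (z - c%:C) ^+ zero_order r c%:C * L z.
  by move=> zd zc; have := LE z zd (or_introl zc); rewrite p0 expr0 divr1.
exists L, l, d, k; split=> //; split=> // z zd zi.
have zc : z != c%:C by apply: contraNneq zi => ->.
by have [dz <-] := LE' z zd zc; exact: multiplierE.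
Qed.

Lemma zero_order_le2 r Q F c : multiplier r Q F -> (zero_order r c%:C <= 2)%N.
Proof.
move=> mQ; rewrite leqNgt; apply/negP => o3.
have [nQ nF _ _ _] := mQ.
have [L [l [d [k [d0 k0 l0 [_ FE _ _ L4]]]]]] := multiplier_local mQ (ltn_trans (isT : (0 < 2)%N) o3).
set n := zero_order _ _ in o3 FE.
pose B := normc (F (c +i* 1)); pose A := 5 / 4 * `|l| * normc (Q (c +i* 1)).
have A0 : 0 <= A by rewrite !mulr_ge0 ?normc_ge0.
have B0 : 0 < B by rewrite normc_gt0 nF.2//= oner_eq0.
(* Order at least 3 will lead to [B <= y * A], which this [y] is small enough to violate. *)
pose y := Num.min (d / 2) (Num.min 1 (B / 2 / (A + 1))).
have A1 : 0 < A + 1 by rewrite ltr_wpDl.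
have y0 : 0 < y by rewrite !lt_min ltr01 (divr_gt0 d0)// (divr_gt0 (divr_gt0 B0 _) A1).
have [yd [y1 yB]] : y <= d / 2 /\ y <= 1 /\ y * (A + 1) <= B / 2.
  by rewrite -ler_pdivlMr// /y !ge_min !lexx !orbT.
pose w : R[i] := c +i* y.
have wy : normc (w - c%:C) = y.
  by rewrite /w -(complexr0 c) normc_verB subr0 gtr0_norm.
have wd : normc (w - c%:C) < d by rewrite wy; clear -yd d0; lra.
have [v1 _] := nev_vert c nF.1 y0 y1; have [_ v2] := nev_vert c nQ.1 y0 y1.
rewrite !mulr1 -/w in v1 v2; move: v1; rewrite (FE w wd) /= ?lt0r_neq0//.
rewrite !normcM normcX wy.
have Lw : normc (L w) <= 5 / 4 * `|l|.
  have := le_trans (ler_normcB _ _) (L4 w wd); rewrite normcR; clear; lra.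
have yn : y ^+ n <= y * y ^+ 2.
  by rewrite -exprS; apply: ler_wiXn2l => //; rewrite ltW.
have h : y ^+ n * normc (L w) * normc (Q w) <= y * (y * A).
  have h1 : y ^+ n * normc (L w) <= y * y ^+ 2 * (5 / 4 * `|l|).
    by rewrite ler_pM ?exprn_ge0 ?normc_ge0 ?(ltW y0).
  apply: le_trans (ler_wpM2r (normc_ge0 _) h1) _.
  rewrite (_ : y * (y * A) = y * y * (5 / 4 * `|l|) * normc (Q (c +i* 1))); last by rewrite /A; ring.
  rewrite (_ : y * y ^+ 2 * (5 / 4 * `|l|) * normc (Q w) =
    y * y * (5 / 4 * `|l|) * (normc (Q w) * y)); last by ring.
  by rewrite ler_wpM2l// !mulr_ge0 ?(ltW y0).
move=> h'; have := le_trans h' h; rewrite mulrC ler_pM2l// => h2.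
have : B <= y * A by [].
clear -B0 yB y0; lra.
Qed.

(** If [l > 0], then on the segment at height [y] with [|Re z - c| <= y / 2] the multiplier
    [(z - c)^2 L] has negative real part, like [(s + i)^2], while its imaginary part has opposite
    signs at the two ends; [ivt_sign] forbids this. *)
Lemma double_zero_sign r Q F c L l (d : R) : multiplier r Q F -> 0 < d -> l != 0 ->
  (forall z, normc (z - c%:C) < d -> Im z != 0 -> F z = (z - c%:C) ^+ 2 * L z * Q z) ->
  (forall z, normc (z - c%:C) < d -> normc (L z - l%:C) <= `|l| / 4) -> l < 0.
Proof.
move=> mQ d0 l0 FE L4; have [nQ nF _ _ _] := mQ.
rewrite ltNge; apply/negP => lp; have {lp l0} lp : 0 < l by rewrite lt_def l0.
pose y := d / 4; have y0 : 0 < y by rewrite divr_gt0.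
pose w s : R[i] := (c + y * s) +i* y.
have wE s : w s - c%:C = (y * s) +i* y.
  by apply: eq_ReIm; rewrite ?ReB ?ImB /=; ring.
have wd s : `|s| <= 1 / 2 -> normc (w s - c%:C) < d.
  move=> s1; apply: le_lt_trans (normc_le_ReIm _) _; rewrite wE /= normrM gtr0_norm//.
  have : y * `|s| <= y * (1 / 2) by rewrite ler_pM2l.
  rewrite /y; clear -d0; lra.
pose rr z := (z - c%:C) ^+ 2 * L z.
have wr s : Re (rr (w s)) = y ^+ 2 * ((s ^+ 2 - 1) * Re (L (w s)) - 2 * s * Im (L (w s)))
   /\ Im (rr (w s)) = y ^+ 2 * ((s ^+ 2 - 1) * Im (L (w s)) + 2 * s * Re (L (w s))).
  by rewrite /rr wE expr2 ReM ImM ReM ImM /=; split; ring.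
have Lw s : `|s| <= 1 / 2 -> 3 / 4 * l <= Re (L (w s)) /\ `|Im (L (w s))| <= l / 4.
  move=> s1; have h := L4 _ (wd s s1); rewrite (gtr0_norm lp) in h; split.
    have := le_trans (normc_Re _) h; rewrite ReB /= ler_norml => /andP[h1 _]; clear -h1; lra.
  by have := le_trans (normc_Im _) h; rewrite ImB subr0.
have y20 : 0 < y ^+ 2 by rewrite exprn_gt0.
apply: (@ivt_sign R Q rr c y nQ y0) => [s s1|s s1|].
- by rewrite -/(w s) /rr -FE ?wd//= ?lt0r_neq0//; exact: nev_im nF.1 _.
- have [-> _] := wr s; rewrite pmulr_rlt0//.
  have [] := Lw s s1; move: (Re _) (Im _) => p p'; rewrite ler_norml => h1 /andP[h2 h3].
  move: s1; rewrite ler_norml => /andP[s1 s2].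
  have : (1 - s ^+ 2) * (3 / 4 * l) <= (1 - s ^+ 2) * p.
    rewrite ler_wpM2l// subr_ge0; clear -s1 s2; nra.
  have : s ^+ 2 <= 1 / 4 by clear -s1 s2; nra.
  have : `|2 * s * p'| <= 1 * (l / 4).
    rewrite normrM ler_pM// ?normrM; last by rewrite ler_norml h2.
    by rewrite ger0_norm// -ler_pdivlMl// mulrC ler_norml; apply/andP; split; clear -s1 s2; lra.
  rewrite ler_norml => /andP[g1 g2] g3 g4; clear -g1 g2 g3 g4 lp.
  have : (1 - s ^+ 2) * (3 / 4 * l) >= 3 / 4 * (3 / 4 * l).
    by rewrite ler_wpM2r//; [|clear -g3]; lra.
  lra.
have hp : `|1 / 2 : R| <= 1 / 2 by rewrite ger0_norm// divr_ge0.
have hn : `|- (1 / 2) : R| <= 1 / 2 by rewrite normrN.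
rewrite -/(w (1 / 2)) -/(w (- (1 / 2))); have [_ ->] := wr (1 / 2); have [_ ->] := wr (- (1 / 2)).
have [] := Lw _ hp; have [] := Lw _ hn; move: (Re _) (Im _) (Re _) (Im _) => p q p' q'.
rewrite !ler_norml => h1 /andP[h2 h3] h4 /andP[h5 h6].
rewrite mulrACA pmulr_rlt0 ?mulr_gt0// pmulr_rlt0.
  by clear -h1 h2 h3 lp; lra.
by clear -h4 h5 h6 lp; lra.
Qed.

(** In the angle [|Re z - c| <= 2 Im z] the bound follows from the lower bound for [F], which is of
    order [Im z]. Beside it, [sector_log] moves the point up to the edge of the angle at the cost of
    [expR 5]. *)
Lemma double_zero_bound r Q F c L l d k : multiplier r Q F -> 0 < d -> 0 <= k -> l < 0 ->
  (forall z, normc (z - c%:C) < d -> Im z != 0 -> F z = (z - c%:C) ^+ 2 * L z * Q z) ->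
  (forall z, normc (z - c%:C) < d -> `|Im (L z)| <= k * `|Im z|) ->
  (forall z, normc (z - c%:C) < d -> normc (L z - l%:C) <= `|l| / 4) ->
  exists C e : R, [/\ 0 < C, 0 < e &
    forall z, 0 < Im z -> normc (z - c%:C) < e -> C <= normc (z - c%:C) * normc (Q z)].
Proof.
move=> mQ d0 k0 ln FE Li L4; have [nQ nF _ _ _] := mQ.
pose m := - l; have mp : 0 < m by rewrite oppr_gt0.
have lm : `|l| = m by rewrite ltr0_norm.
pose B := normc (F (c +i* 1)).
have B0 : 0 < B by rewrite normc_gt0 nF.2//= oner_eq0.
(* [expR 2] comes from [mid_bounds], 3 from [|z - c| <= 3 Im z] in the angle, and [5 / 4 * m] bounds
   [|L|]. *)
have K0 : 0 < expR 2 * (3 * (5 / 4 * m)) :> R by rewrite !mulr_gt0 ?expR_gt0 ?divr_gt0.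
pose C1 := B / (expR 2 * (3 * (5 / 4 * m))).
have C10 : 0 < C1 by rewrite divr_gt0.
have mid z : 0 < Im z -> Im z <= 1 -> normc (z - c%:C) < d -> `|Re z - c| <= 2 * Im z ->
    C1 <= normc (z - c%:C) * normc (Q z).
  move=> z0 z1 zd zs; have [h _] := mid_bounds nF.1 z0 z1 zs.
  have wy : normc (z - c%:C) <= 3 * Im z.
    apply: le_trans (normc_le_ReIm _) _; rewrite ReB ImB subr0 (gtr0_norm z0).
    by clear -zs; lra.
  rewrite ler_pdivrMr//; rewrite (FE z zd) ?lt0r_neq0// 2!normcM normcX -/B in h.
  have Lz : normc (L z) <= 5 / 4 * m.
    have := le_trans (ler_normcB _ _) (L4 z zd); rewrite normcR lm; clear; lra.
  rewrite -(ler_pM2l z0); apply: le_trans h _.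
  rewrite (_ : Im z * _ = expR 2 * (normc (z - c%:C) * normc (Q z) *
    (3 * Im z * (5 / 4 * m)))); last by ring.
  rewrite (_ : normc _ ^+ 2 * _ * _ = normc (z - c%:C) * normc (Q z) *
    (normc (z - c%:C) * normc (L z))); last by ring.
  rewrite ler_wpM2l ?expR_ge0// ler_wpM2l ?mulr_ge0 ?normc_ge0//.
  by rewrite ler_pM ?normc_ge0.
pose s := Num.min d (Num.min 1 (m / 4 / (k + 1))).
have k1 : 0 < k + 1 by rewrite ltr_wpDl.
have s0 : 0 < s by rewrite !lt_min d0 ltr01 (divr_gt0 (divr_gt0 mp _) k1).
have [sd [s1 sk]] : s <= d /\ s <= 1 /\ s * (k + 1) <= m / 4.
  by rewrite -ler_pdivlMr// /s !ge_min !lexx !orbT.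
have side z : 0 < Im z -> normc (z - c%:C) < s / 2 -> 2 * Im z <= `|Re z - c| ->
    normc (Q (Re z +i* (`|Re z - c| / 2))) <= expR 5 * normc (Q z).
  move=> z0 zs zx.
  have [] // := @sector_log R Q (fun z => (z - c%:C) ^+ 2 * L z) c s nQ.1 _ z z0 zs zx.
  move=> {z0 zs zx}z z0 zs zx; have zd := lt_le_trans zs sd.
  have [||||A1 A2] := @square_sector R (Re z - c) (Im z) (Re (L z)) (Im (L z)) l k ln z0 zx.
  - by have := le_trans (normc_Re _) (L4 z zd); rewrite ReB lm.
  - by have := le_trans (normc_Im _) (L4 z zd); rewrite ImB lm subr0.
  - by have := Li z zd; rewrite (gtr0_norm z0).
  - have := normc_Re (z - c%:C); rewrite ReB; move: zs sk k0 s0.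
    move: (normc _) `|_| => n n'; rewrite /m; clear => h1 h2 h3 h4 h5.
    have : k * n' <= k * s by rewrite ler_wpM2l//; lra.
    lra.
  split; first by rewrite -(FE z zd (lt0r_neq0 z0)); exact: nev_im nF.1 z0.
    move: A1; rewrite expr2 !ReM ImM !ReB !ImB /= subr0.
    by congr (is_true (_ < _)); ring.
  move: A2; rewrite expr2 !ReM !ImM !ReM !ReB !ImB /= subr0.
  by congr (is_true (`|_| * _ <= _ * - _)); ring.
exists (C1 / (2 * expR 5)), (s / 2); split; rewrite ?divr_gt0 ?mulr_gt0 ?expR_gt0//.
move=> z z0 zs; rewrite ler_pdivrMr ?mulr_gt0 ?expR_gt0//.
have zs' : normc (z - c%:C) < s by clear -zs s0; lra.
have zy : Im z <= normc (z - c%:C).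
  by have := normc_Im (z - c%:C); rewrite ImB subr0 gtr0_norm.
have zx' : `|Re z - c| <= normc (z - c%:C).
  by have := normc_Re (z - c%:C); rewrite ReB.
have e5 : 1 <= expR 5 :> R by rewrite -expR0 ler_expR.
have [zx|zx] := leP `|Re z - c| (2 * Im z).
  apply: le_trans (mid z z0 _ _ zx) _.
  + by clear -zs' zy s1; lra.
  + by clear -zs' sd; lra.
  by rewrite ler_peMr ?mulr_ge0 ?normc_ge0//; clear -e5; lra.
have h := side z z0 zs (ltW zx).
set z' := Re z +i* _ in h.
have x0 : 0 < `|Re z - c| by clear -zx z0; lra.
have z'd : normc (z' - c%:C) <= 2 * normc (z - c%:C).
  apply: le_trans (normc_le_ReIm _) _; rewrite ReB ImB /= subr0.
  rewrite (@gtr0_norm _ (_ / 2)) ?divr_gt0//; clear -zx'; have := normr_ge0 (Re z - c); lra.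
apply: le_trans (mid z' _ _ _ _) _.
- by rewrite /= divr_gt0.
- rewrite /=; clear -zx' zs' s1 x0; lra.
- by clear -z'd zs sd; lra.
- by rewrite /= mulrC divfK.
apply: le_trans (ler_pM (normc_ge0 _) (normc_ge0 _) z'd h) _.
by rewrite mulrACA mulrC.
Qed.

End ZeroOrder.

(** * Behaviour of [Q] at double zeros and on one side of simple zeros *)

Section ZeroBehaviour.
Variable R : realType.
Implicit Types (x y t s k m c q l : R) (F G Q P f : R[i] -> R[i]).
Implicit Types (a z w : R[i]) (r : ratfun R).

Lemma nt_limV f c l : l != 0 -> nt_lim f c l%:C -> nt_lim (fun z => (f z)^-1) c l^-1%:C.
Proof.
move=> l0 /nt_limP H; apply/nt_limP => M e M0 e0.
have n0 : 0 < `|l| by rewrite normr_gt0.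
have m0 : 0 < Num.min (`|l| / 2) (e * (`|l| * (`|l| / 2))).
  by rewrite lt_min !mulr_gt0.
have [d d0 dP] := H M _ M0 m0; exists d => // z zs /(dP z zs).
rewrite lt_min => /andP[h1 h2].
have f2 : `|l| / 2 < normc (f z).
  have := le_normcB (f z) (f z - l%:C).
  rewrite opprB addrC subrK normcR => h; move: h1 h; clear; lra.
have fz : f z != 0 by rewrite -normc_gt0; apply: lt_trans f2; rewrite divr_gt0.
have lz : l%:C != 0 :> R[i] by apply: contra_neq l0 => /(congr1 (@complex.Re R)).
have -> : (f z)^-1 - l^-1%:C = - (f z - l%:C) / (f z * l%:C).
  by rewrite RCV; field; rewrite fz lz.
rewrite normcM normcN normcV normcM normcR ltr_pdivrMr.
  by apply: lt_le_trans h2 _; rewrite ler_pM2l// mulrC ler_pM2r// ltW.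
by rewrite mulr_gt0// normc_gt0.
Qed.

Lemma nt_lim_ooV f c : nt_lim_oo f c -> nt_lim (fun z => (f z)^-1) c 0.
Proof.
move=> /nt_lim_ooP H; apply/nt_limP => M e M0 e0.
have [d d0 dP] := H M e^-1 M0; exists d => // z zs /(dP z zs) h.
rewrite subr0 normcV invf_plt ?posrE//.
by apply: lt_trans h; rewrite invr_gt0.
Qed.

Lemma nt_lim_oo_inv f c : (forall z, 0 < Im z -> f z != 0) -> nt_lim f c 0 ->
  nt_lim_oo (fun z => (f z)^-1) c.
Proof.
move=> f0 /nt_limP H; apply/nt_lim_ooP => M k M0.
have k1 : 0 < `|k| + 1 by rewrite ltr_wpDl.
have ki : 0 < (`|k| + 1)^-1 by rewrite invr_gt0.
have [d d0 dP] := H M _ M0 ki; exists d => // z zs /(dP z zs).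
have fz : 0 < normc (f z) by rewrite normc_gt0 f0//; exact: zs.1.
rewrite subr0 -[normc _]invrK ltf_pV2 ?posrE ?invr_gt0// normcV.
apply: le_lt_trans; apply: le_trans (ler_norm k) _; by rewrite lerDl.
Qed.

Lemma nt_lim_oo_sg f c l : l != 0 -> nt_lim_oo f c ->
  nt_lim_oo (fun z => (Num.sg l)%:C * f z) c.
Proof.
move=> l0 /nt_lim_ooP H; apply/nt_lim_ooP => M k M0.
have [d d0 dP] := H M k M0; exists d => // z zs /(dP z zs).
by rewrite normcM normcR normr_sg l0 mul1r.
Qed.

Lemma nev_rho Q z : nevanlinna Q -> Im z != 0 -> rho Q z.
Proof.
move=> nQ z0; exists Q; apply/holo_extP; exists `|Im z|; first by rewrite normr_gt0.
move=> w wz; split=> //; apply: nev_cder => //; apply: contraTneq wz => w0.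
rewrite -leNgt; apply: le_trans (normc_Im _); by rewrite ImB w0 sub0r normrN.
Qed.

Lemma ext_lower Q c C e : nevanlinna Q ->
  (forall z, 0 < Im z -> normc (z - c%:C) < e -> C <= normc (z - c%:C) * normc (Q z)) ->
  forall z, normc (z - c%:C) < e -> rho Q z -> C <= normc (z - c%:C) * normc (ext Q z).
Proof.
move=> nQ H z ze rz; have [z0|z0] := eqVneq (Im z) 0; last first.
  rewrite extE//; case: (Im_conj_gt0 z0) => zp; first exact: H.
  have := H _ zp; rewrite (nev_sym nQ)// normcJ normcJR; exact.
rewrite leNgt; apply/negP => h.
have [d /cder_cont cg] := ext_cder rz.
have cc : ccont (fun w => (w - c%:C) * ext Q w) z.
  exact: (ccontM (cder_cont (cder_subc _ _)) cg).
move: h; rewrite -normcM => h.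
have h0 : 0 < C - normc ((z - c%:C) * ext Q z) by rewrite subr_gt0.
have /ccontP/(_ _ h0)[d1 d10 d1P] := cc.
have m0 : 0 < Num.min d1 (e - normc (z - c%:C)) by rewrite lt_min d10 subr_gt0.
have [w + w0] := nonreal_dense (Re z) m0.
rewrite -(real_of_Im0 z0) lt_min ltrBrDr => /andP[w1 w2].
have we : normc (w - c%:C) < e.
  by apply: le_lt_trans w2; have := le_normcD (w - z) (z - c%:C); rewrite addrA subrK.
have := d1P w w1; rewrite extE ?lt0r_neq0//.
have := ler_normcB ((w - c%:C) * Q w) ((z - c%:C) * ext Q z).
have := H w w0 we; rewrite -normcM.
by move: (normc _) (normc _) (normc _) => n1 n2 n3; clear; lra.
Qed.

Lemma double_zero r Q F c : multiplier r Q F -> zero_order r c%:C = 2%N ->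
  exists l : R, exists C e : R, [/\ l < 0, 0 < C, 0 < e,
    nt_lim (fun z => rfun r z / (z - c%:C) ^+ 2) c l%:C &
    forall z, normc (z - c%:C) < e -> z != c%:C ->
      rho Q z /\ C <= normc (z - c%:C) * normc (ext Q z)].
Proof.
move=> mQ o2; have [nQ nF rs _ _] := mQ.
have [|L [l [d [k [d0 k0 l0 [LE FE Lk Li L4]]]]]] := @multiplier_local _ _ _ _ c mQ.
  by rewrite o2.
rewrite o2 in LE FE.
have ln := double_zero_sign mQ d0 l0 FE L4.
have [C [e [C0 e0 CP]]] := double_zero_bound mQ d0 k0 ln FE Li L4.
exists l, C, (Num.min d e); split=> //; first by rewrite lt_min d0.
  apply/nt_limP => M e1 M0 e10; have k1 : 0 < k + 1 by rewrite ltr_wpDl.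
  exists (Num.min d (e1 / (k + 1))); first by rewrite lt_min d0 divr_gt0.
  move=> z [z0 _]; rewrite lt_min ltr_pdivlMr// => /andP[zd ze].
  have zc : z != c%:C by apply: contraTneq z0 => ->; rewrite ltxx.
  have [_ ->] := LE z zd zc.
  rewrite mulrAC divff ?mul1r ?expf_neq0 ?subr_eq0//.
  apply: le_lt_trans (Lk z zd) _; apply: le_lt_trans ze.
  by rewrite mulrC ler_wpM2l ?normc_ge0// lerDl.
move=> z; rewrite lt_min => /andP[zd ze] zc.
(* At real points near [c] the multiplier is a positive square times a number close to [l < 0], so
   it is negative and [multiplier_rho] applies. *)
have rz : rho Q z.
  have [z0|z0] := eqVneq (Im z) 0; last exact: nev_rho nQ.1 z0.
  move: zd zc; rewrite (real_of_Im0 z0); set x := Re z => xd xc.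
  have [dx rx] := LE _ xd xc.
  have [|q _ /has_value_ext[]//] := @multiplier_rho R r Q F x mQ dx.
  rewrite rx -rmorphB -rmorphXn ReRM pmulr_rlt0.
    have := le_trans (normc_Re _) (L4 _ xd); rewrite ReB /= (ltr0_norm ln).
    by move=> h; have := le_trans (ler_norm _) h; move: (Re _) => p; clear -ln; lra.
  rewrite exprn_even_gt0//= subr_eq0.
  by apply: contra_neq xc => ->.
split=> //; exact: (ext_lower nQ.1 CP).
Qed.

Lemma double_zero_pole Q c C e : 0 < C -> 0 < e ->
  (forall z, normc (z - c%:C) < e -> z != c%:C ->
      rho Q z /\ C <= normc (z - c%:C) * normc (ext Q z)) ->
  isolated_pole Q c%:C.
Proof.
move=> C0 e0 H; exists (ext Q); split.
- apply/nbhsCP; exists e => // z ze zc.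
  by apply/holo_atP; apply: ext_cder; have [] := H z ze zc.
- by apply/nbhsCP; exists e => // z ze zc z0; rewrite extE.
move=> A [k [_ kA]]; apply/nbhsCP.
have k1 : 0 < `|k| + 1 by rewrite ltr_wpDl.
exists (Num.min e (C / (`|k| + 1))); first by rewrite lt_min e0 divr_gt0.
move=> z; rewrite lt_min ltr_pdivlMr// => /andP[ze zk] zc; apply: kA => /=.
have [_ h] := H z ze zc.
have n0 : 0 < normc (z - c%:C) by rewrite normc_gt0 subr_eq0.
have h2 : k < normc (ext Q z).
  apply: le_lt_trans (ler_norm k) _; apply: (@lt_le_trans _ _ (`|k| + 1)).
    by rewrite ltrDl.
  by rewrite -(ler_pM2l n0); apply: le_trans (ltW zk) h.
exact: h2.
Qed.

Lemma inv_invN Q : (fun z => - (- (Q z)^-1)^-1) = Q.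
Proof. by apply/funext => z; rewrite invrN opprK invrK. Qed.

(** The lower bound for [-1/Q] reads [|Q| <= |z - c| / C]. So [Q] tends to 0 at [c], and with the
    real values around [c] all boundary values needed for reflection are at hand. *)
Lemma double_pole_zero Q c C e : nevpos Q -> 0 < C -> 0 < e ->
  (forall z, normc (z - c%:C) < e -> z != c%:C -> rho (fun z => - (Q z)^-1) z /\
     C <= normc (z - c%:C) * normc (ext (fun z => - (Q z)^-1) z)) ->
  isolated_zero Q c%:C.
Proof.
move=> nQ C0 e0 H; set K := fun z => _ in H.
pose q x := if x == c then 0 else Re (ext Q x%:C).
have hq x : `|x - c| < e -> x != c -> rho Q x%:C.
  move=> xe xc; have xc' : x%:C != c%:C by apply: contra_neq xc => /(congr1 (@complex.Re R)).
  have [|rx bx] := H x%:C _ xc'; first by rewrite -rmorphB normcR.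
  have kx : ext K x%:C != 0.
    by apply: contraTneq bx => ->; rewrite normc0 mulr0 -ltNge.
  have := has_value_inv (rho_has_value rx) kx; rewrite inv_invN.
  by case/has_value_ext.
have := @rho_reflect R Q c e q nQ.1 e0; rewrite {2}/q eqxx; apply=> x xe e1 e10.
rewrite /q; case: eqVneq => [->|xc].
  exists (Num.min e (e1 * C)); first by rewrite lt_min e0 mulr_gt0.
  move=> z z0; rewrite lt_min => /andP[ze z1].
  have zc : z != c%:C by apply: contraTneq z0 => ->; rewrite ltxx.
  have [_] := H z ze zc; rewrite extE ?lt0r_neq0// /K normcN normcV.
  rewrite subr0 ler_pdivlMr ?normc_gt0 ?nQ.2 ?lt0r_neq0// => h.
  by rewrite -(ltr_pM2r C0) mulrC; apply: le_lt_trans h z1.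
have rx := hq x xe xc; have [d /cder_cont/ccontP/(_ _ e10)[d1 d10 dP]] := ext_cder rx.
exists d1 => // z z0 /dP; rewrite extE ?lt0r_neq0//.
by rewrite [ext Q x%:C]real_of_Im0//; exact: ext_real nQ.1 rx.
Qed.

Lemma rfun_rinv r (n0 : rnum r != 0) z : rfun (rinv n0) z = (rfun r z)^-1.
Proof. by rewrite /rfun invf_div. Qed.

(* [Q] and [F = rr Q] both increase and [rr] tends to 0 at [c], so [Q] cannot be
   negative near [c]; then [-1/Q] is bounded above there and Lindelof applies. *)
Lemma simple_zero_left Q F c s (rr : R -> R) k : nevpos Q -> nevanlinna F -> 0 < s ->
  (forall x, c - s < x < c ->
     [/\ rho Q x%:C, rho F x%:C, Re (ext F x%:C) = rr x * Re (ext Q x%:C) &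
         [/\ Re (ext Q x%:C) != 0, rr x < 0 & - rr x <= k * (c - x)]]) ->
  (exists2 q, nt_lim Q c q%:C & 0 < q) \/ nt_lim_oo Q c.
Proof.
move=> nQ nF s0 H.
have mono G y x : nevanlinna G -> (forall t, c - s < t < c -> rho G t%:C) ->
    c - s < y -> y <= x -> x < c -> Re (ext G y%:C) <= Re (ext G x%:C).
  move=> nG rG y1 yx xc; apply: ext_mono => // t /andP[t1 t2]; apply: rG.
  by rewrite (lt_le_trans y1 t1) (le_lt_trans t2 xc).
have rQ t : c - s < t < c -> rho Q t%:C by move=> /H[].
have rF t : c - s < t < c -> rho F t%:C by move=> /H[].
have [x0 x0c u0] : exists2 x0, c - s < x0 < c & 0 < Re (ext Q x0%:C).
  pose x1 := c - s / 2; have x1c : c - s < x1 < c.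
    by rewrite /x1; apply/andP; split; clear -s0; lra.
  have /andP[x1l x1r] := x1c.
  apply: contrapT => nex.
  have un x : x1 <= x -> x < c -> Re (ext Q x%:C) < 0.
    move=> xl xr; have xc : c - s < x < c by rewrite (lt_le_trans x1l).
    have [_ _ _ [u0 _ _]] := H x xc; rewrite lt_neqAle u0 leNgt; apply/negP => up.
    by apply: nex; exists x.
  have [_ _ E1 [_ r1 k1]] := H x1 x1c.
  have u1 := un x1 (lexx _) x1r.
  pose A := Re (ext F x1%:C); have A0 : 0 < A by rewrite /A E1 nmulr_rgt0.
  pose B := - Re (ext Q x1%:C); have B0 : 0 < B by rewrite oppr_gt0.
  have bound x : x1 <= x -> x < c -> A <= k * (c - x) * B.
    move=> xl xr; have xc : c - s < x < c by rewrite (lt_le_trans x1l).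
    have [_ _ E [_ rx kx]] := H x xc.
    have h1 : A <= Re (ext F x%:C) by exact: mono.
    have h2 : Re (ext Q x1%:C) <= Re (ext Q x%:C) by apply: mono => //; exact: nQ.1.
    apply: le_trans h1 _; rewrite E -mulrNN; apply: ler_pM => //.
    - by rewrite oppr_ge0 ltW.
    - by rewrite oppr_ge0 ltW// un.
    - by rewrite lerN2.
  have kB : 0 < k.
    have := bound x1 (lexx _) x1r; rewrite ltNge => h; apply/negP => k0.
    have : k * (c - x1) * B <= 0.
      by rewrite mulr_le0_ge0 ?(ltW B0)// mulr_le0_ge0// subr_ge0 ltW.
    by move=> /(le_trans h); rewrite leNgt A0.
  (* At distance [t] from [c] the upper bound for [A] is at most [A / 2]. *)
  pose t := Num.min (c - x1) (A / (2 * (k * B))).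
  have kB0 : 0 < 2 * (k * B) by rewrite !mulr_gt0.
  have t0 : 0 < t by rewrite lt_min subr_gt0 x1r divr_gt0.
  have [t1 t2] : t <= c - x1 /\ t * (2 * (k * B)) <= A.
    by rewrite -ler_pdivlMr// /t !ge_min !lexx orbT.
  have := bound (c - t); rewrite lerBrDr -lerBrDl t1 ltrBlDr ltrDl t0.
  rewrite (_ : c - (c - t) = t); last by ring.
  move=> /(_ isT isT); clear -A0 t2; lra.
pose K z := - (Q z)^-1; have nK : nevpos K by exact: nev_inv.
have /andP[x0l x0r] := x0c.
have s1 : 0 < c - x0 by rewrite subr_gt0.
have [|l Kl [l0 lx]] := @nt_lim_left R K c (c - x0) 0 nK.1 s1.
  move=> x; rewrite (_ : c - (c - x0) = x0); last by ring.
  move=> /andP[x1 x2]; have xc : c - s < x < c by rewrite (lt_trans x0l).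
  have ux : Re (ext Q x0%:C) <= Re (ext Q x%:C) by apply: mono => //; [exact: nQ.1|exact: ltW].
  have up := lt_le_trans u0 ux.
  have rx := rQ x xc; have im := ext_real nQ.1 rx.
  have e0 : ext Q x%:C != 0.
    by rewrite (real_of_Im0 im); apply: contraTneq up => /(congr1 (@complex.Re R)) /= ->; rewrite ltxx.
  have := has_value_inv (rho_has_value rx) e0 => /has_value_ext[rK ->]; split=> //.
  by rewrite ReN ReV oppr_le0 divr_ge0 ?sqr_ge0// ltW.
have QK : Q = (fun z => (- K z)^-1) by apply/funext => z; rewrite opprK invrK.
have Kl' : nt_lim (fun z => - K z) c (- l)%:C.
  have := @nt_limZ R K c l%:C (- 1) Kl; rewrite -rmorphM mulN1r.
  by under eq_fun do rewrite rmorphN mulN1r.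
(* A limit 0 of [-1/Q] is the case of an infinite limit of [Q]. *)
have [l00|ln] := eqVneq l 0; last first.
  left; exists (- l)^-1; last by rewrite invr_gt0 oppr_gt0 lt_neqAle ln.
  by rewrite QK; apply: nt_limV => //; rewrite oppr_eq0.
right; rewrite QK; apply: nt_lim_oo_inv => [z z0|].
  by rewrite oppr_eq0 nK.2// lt0r_neq0.
by move: Kl'; rewrite l00 oppr0.
Qed.

End ZeroBehaviour.

(** * Simple zeros, and necessity of condition (ii) *)

Section Necessity.
Variable R : realType.
Implicit Types (x y t s k m c q l : R) (F G Q P f : R[i] -> R[i]).
Implicit Types (a z w : R[i]) (r : ratfun R).

Lemma nt_lim_eq f G c a : f =1 G -> nt_lim f c a -> nt_lim G c a.
Proof. by move=> /funext ->. Qed.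

Lemma nt_limZR f c k q : nt_lim f c q%:C -> nt_lim (fun z => k%:C * f z) c (k * q)%:C.
Proof. rewrite RCM; exact: nt_limZ. Qed.

Lemma nevpos_mirror Q : nevpos Q -> nevpos (fun z => - Q (- z)).
Proof.
move=> [nQ Q0]; split; first exact: nev_mirror.
by move=> z z0; rewrite oppr_eq0 Q0// ImN oppr_eq0.
Qed.

Lemma ext_mirror Q x : rho Q x%:C -> rho (fun z => - Q (- z)) (- x)%:C /\
  ext (fun z => - Q (- z)) (- x)%:C = - ext Q x%:C.
Proof. by move=> /rho_has_value/has_value_mirror/has_value_ext; rewrite -rmorphN. Qed.

(** The reflection in the imaginary axis preserves the upper half-plane, unlike [z |-> - z]; for a
    symmetric [Q] the two differ only by a conjugation of the values. *)
Lemma stolz_mirror c M z : stolz c M z -> stolz (- c) M (- z^*).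
Proof.
move=> [z0 zM]; split; first by rewrite ImN ImJ opprK.
by rewrite ReN ReJ ImN ImJ !opprK addrC distrC.
Qed.

Lemma mirror_pt c z : - z^* - (- c)%:C = - (z - c%:C)^*.
Proof. by rewrite conjcB conjc_real rmorphN opprB opprK addrC. Qed.

Lemma nt_lim_mirror Q c l : nevanlinna Q ->
  nt_lim (fun z => - Q (- z)) (- c) l%:C -> nt_lim Q c (- l)%:C.
Proof.
move=> nQ /nt_limP H; apply/nt_limP => M e M0 e0; have [d d0 dP] := H M e M0 e0.
exists d => // z zs zd; have := dP _ (stolz_mirror zs).
rewrite mirror_pt normcN normcJ opprK (nev_sym nQ) ?lt0r_neq0//; last exact: zs.1.
move=> /(_ zd); have -> : - (Q z)^* - l%:C = - (Q z - (- l)%:C)^*.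
  by rewrite conjcB conjc_real rmorphN opprK opprD.
by rewrite normcN normcJ.
Qed.

Lemma nt_lim_oo_mirror Q c : nevanlinna Q ->
  nt_lim_oo (fun z => - Q (- z)) (- c) -> nt_lim_oo Q c.
Proof.
move=> nQ /nt_lim_ooP H; apply/nt_lim_ooP => M e M0; have [d d0 dP] := H M e M0.
exists d => // z zs zd; have := dP _ (stolz_mirror zs).
rewrite mirror_pt normcN normcJ opprK (nev_sym nQ) ?lt0r_neq0//; last exact: zs.1.
by move=> /(_ zd); rewrite normcN normcJ.
Qed.

Lemma simple_zero_right Q F c s (rr : R -> R) k : nevpos Q -> nevanlinna F -> 0 < s ->
  (forall x, c < x < c + s ->
     [/\ rho Q x%:C, rho F x%:C, Re (ext F x%:C) = rr x * Re (ext Q x%:C) &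
         [/\ Re (ext Q x%:C) != 0, rr x < 0 & - rr x <= k * (x - c)]]) ->
  (exists2 q, nt_lim Q c q%:C & q < 0) \/ nt_lim_oo Q c.
Proof.
move=> nQ nF s0 H.
have [|[q ql q0]|ql] := @simple_zero_left R (fun z => - Q (- z)) (fun z => - F (- z))
  (- c) s (fun x => rr (- x)) k (nevpos_mirror nQ) (nev_mirror nF) s0.
- move=> x /andP[x1 x2]; have xc : c < - x < c + s.
    by apply/andP; split; [clear -x2|clear -x1]; lra.
  have [rQ rF E [u0 r0 k0]] := H _ xc.
  have [rQ' eQ] := ext_mirror rQ; have [rF' eF] := ext_mirror rF.
  rewrite opprK in rQ' eQ rF' eF; rewrite eQ eF !ReN E mulrN oppr_eq0; split=> //.
  by split=> //; rewrite [- c - x]addrC.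
- by left; exists (- q); [exact: nt_lim_mirror nQ.1 ql|rewrite oppr_lt0].
- by right; exact: nt_lim_oo_mirror nQ.1 ql.
Qed.

(** Near [c], [r] is negative on the left if [l > 0] and on the right if [l < 0]. On that side [Q]
    and [F] extend to the real line, and [|r|] is at most [5/4 |l|] times the distance to [c]. *)
Lemma simple_zero r Q F c : multiplier r Q F -> zero_order r c%:C = 1%N ->
  exists l, [/\ l != 0, nt_lim (fun z => rfun r z / (z - c%:C)) c l%:C &
    (exists2 q, nt_lim Q c q%:C & 0 < Num.sg l * q) \/ nt_lim_oo Q c].
Proof.
move=> mQ o1; have [nQ nF rs _ _] := mQ.
have [|L [l [d [k [d0 k0 l0 [LE FE Lk Li L4]]]]]] := @multiplier_local _ _ _ _ c mQ.
  by rewrite o1.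
rewrite o1 in LE FE; exists l; split=> //.
  apply/nt_limP => M e1 M0 e10; have k1 : 0 < k + 1 by rewrite ltr_wpDl.
  exists (Num.min d (e1 / (k + 1))); first by rewrite lt_min d0 divr_gt0.
  move=> z [z0 _]; rewrite lt_min ltr_pdivlMr// => /andP[zd ze].
  have zc : z != c%:C by apply: contraTneq z0 => ->; rewrite ltxx.
  have [_ ->] := LE z zd zc.
  rewrite expr1 mulrAC divff ?mul1r ?subr_eq0//.
  apply: le_lt_trans (Lk z zd) _; apply: le_lt_trans ze.
  by rewrite mulrC ler_wpM2l ?normc_ge0// lerDl.
have pt x : `|x - c| < d -> x != c -> ~~ root (rden r) x%:C /\
    exists p, [/\ Re (rfun r x%:C) = (x - c) * p, `|p - l| <= `|l| / 4 & p != 0].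
  move=> xd xc; have xd' : normc (x%:C - c%:C) < d by rewrite -rmorphB normcR.
  have xc' : x%:C != c%:C by apply: contra_neq xc => /(congr1 (@complex.Re R)).
  have [dx rx] := LE _ xd' xc'; split=> //; exists (Re (L x%:C)).
  rewrite rx expr1 -rmorphB ReRM.
  have h : `|Re (L x%:C) - l| <= `|l| / 4.
    by have := le_trans (normc_Re _) (L4 _ xd'); rewrite ReB.
  split=> //; apply: contraTneq h => ->; rewrite sub0r normrN -ltNge.
  by rewrite ltr_pdivrMr// ltr_pMr ?normr_gt0// ltr1n.
have val x : `|x - c| < d -> x != c -> Re (rfun r x%:C) < 0 ->
    [/\ rho Q x%:C, rho F x%:C, Re (ext F x%:C) = Re (rfun r x%:C) * Re (ext Q x%:C) &
        Re (ext Q x%:C) != 0].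
  move=> xd xc rx; have [dx _] := pt x xd xc.
  have [q q0 hq] := multiplier_rho mQ dx rx.
  have [rQ ->] := has_value_ext hq.
  have [rF ->] := has_value_ext (multiplier_value mQ dx hq).
  by split=> //; rewrite mulrC ReRM /= mulrC.
have [lp|ln] := ltP 0 l.
  rewrite gtr0_sg//.
  have [|[q ql q0]|h] := @simple_zero_left R Q F c d (fun x => Re (rfun r x%:C)) (5 / 4 * l)
      nQ nF.1 d0; [|by left; exists q; rewrite ?mul1r|by right].
  move=> x /andP[x1 x2]; have xd : `|x - c| < d.
    by rewrite ltr_norml; apply/andP; split; [clear -x1|clear -x2 d0]; lra.
  have xc : x != c by rewrite lt_eqF.
  have [_ [p [Ep]]] := pt x xd xc; rewrite (gtr0_norm lp) ler_norml => /andP[p1 p2] p0.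
  have pp : 0 < p by clear -p1 lp; lra.
  have rx : Re (rfun r x%:C) < 0 by rewrite Ep nmulr_rlt0// subr_lt0.
  have [h1 h2 h3 h4] := val x xd xc rx; split=> //; split=> //.
  rewrite Ep -mulNr opprB mulrC; apply: ler_wpM2r; first by rewrite subr_ge0 ltW.
  by clear -p2; lra.
have {ln} ln : l < 0 by rewrite lt_neqAle l0.
rewrite ltr0_sg//.
have [|[q ql q0]|h] := @simple_zero_right Q F c d (fun x => Re (rfun r x%:C)) (- (5 / 4 * l))
    nQ nF.1 d0; [|left; exists q; [exact: ql|]; rewrite mulN1r oppr_gt0; exact: q0|right; exact: h].
move=> x /andP[x1 x2]; have xd : `|x - c| < d.
  by rewrite ltr_norml; apply/andP; split; [clear -x1 d0|clear -x2]; lra.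
have xc : x != c by rewrite gt_eqF.
have [_ [p [Ep]]] := pt x xd xc; rewrite (ltr0_norm ln) ler_norml => /andP[p1 p2] p0.
have pn : p < 0 by clear -p2 ln; lra.
have rx : Re (rfun r x%:C) < 0 by rewrite Ep pmulr_rlt0// subr_gt0.
have [h1 h2 h3 h4] := val x xd xc rx; split=> //; split=> //.
rewrite Ep -mulrN mulrC; apply: ler_wpM2r; first by rewrite subr_ge0 ltW.
by clear -p1; lra.
Qed.

Lemma necessity_order r Q F : multiplier r Q F -> cond_ii_order r.
Proof.
move=> mQ z; have [_ _ _ n0 _] := mQ; split=> o.
  have z0 : Im z = 0.
    by apply: (multiplier_root mQ); left; apply: contraLR o => /mupNroot; rewrite /zero_order => ->.
  by split=> //; rewrite (real_of_Im0 z0); exact: zero_order_le2 mQ.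
have z0 : Im z = 0.
  by apply: (multiplier_root mQ); right; apply: contraLR o => /mupNroot; rewrite /pole_order => ->.
split=> //; rewrite (real_of_Im0 z0).
exact: zero_order_le2 (multiplier_inv n0 mQ).
Qed.

(** A pole of [r] is a zero of [rinv]. The pair [-1/Q], [-1/F] is used rather than [F], [Q], as the
    conclusion has to concern [Q]. *)
Lemma necessity_a r Q F : multiplier r Q F -> cond_ii_a r Q.
Proof.
move=> mQ c; have [nQ _ _ n0 _] := mQ; split=> o.
  have [l [C [e [l0 C0 e0 ll h]]]] := double_zero mQ o.
  by split; [exact: double_zero_pole h|exists l].
have [l [C [e [l0 C0 e0 ll h]]]] := double_zero (multiplier_neg n0 mQ) (o : zero_order (rinv n0) _ = _).
split; first exact: double_pole_zero h.
exists l^-1; last by rewrite invr_lt0.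
apply: nt_lim_eq (nt_limV (ltr0_neq0 l0) ll) => z.
by rewrite rfun_rinv invf_div invrK.
Qed.

Lemma necessity_b r Q F : multiplier r Q F -> cond_ii_b r Q.
Proof.
move=> mQ c; have [nQ _ _ n0 _] := mQ; split=> o.
  have [l [l0 ll [[q ql q0]|qo]]] := simple_zero mQ o; exists l => //.
    by left; exists (Num.sg l * q); [exact: nt_limZR|exact: q0].
  by right; exact: nt_lim_oo_sg.
have [l [l0 ll h]] := simple_zero (multiplier_neg n0 mQ) (o : zero_order (rinv n0) _ = _).
exists l^-1.
  apply: nt_lim_eq (nt_limV l0 ll) => z; by rewrite rfun_rinv invf_div invrK.
rewrite sgrV; case: h => [[q ql q0]|qo].
  have q1 : q != 0 by apply: contraTneq q0 => ->; rewrite mulr0 ltxx.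
  exists (Num.sg l * - q^-1).
    rewrite mulrN -mulNr.
    have h := @nt_limZR _ _ (- Num.sg l) _ (nt_limV q1 ql).
    apply: nt_lim_eq h => z.
    by rewrite invrN invrK rmorphN mulrNN.
  rewrite (_ : _ * _ = - (Num.sg l * q / q ^+ 2)); last by field.
  by rewrite oppr_le0 divr_ge0 ?sqr_ge0// ltW.
exists (- Num.sg l * 0); last by rewrite mulr0.
have h := @nt_limZR _ _ (- Num.sg l) 0 (nt_lim_ooV qo).
apply: nt_lim_eq h => z.
by rewrite invrN invrK rmorphN mulrNN.
Qed.

End Necessity.

(** * Behaviour at oo, and necessity of condition (i) *)

Section NecessityI.
Variable R : realType.
Implicit Types (x y t k m c q l : R) (F Q : R[i] -> R[i]).
Implicit Types (a z w : R[i]) (r : ratfun R) (p : {poly R[i]}).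

Definition revp n p : {poly R[i]} := \poly_(i < n.+1) p`_(n - i).

Lemma revpE n p z : (size p <= n.+1)%N -> z != 0 ->
  p.[z] = z ^+ n * (revp n p).[z^-1].
Proof.
move=> pn z0; rewrite (horner_coef_wide z pn) horner_poly big_distrr /=.
rewrite (reindex_inj rev_ord_inj) /=; apply: eq_bigr => i _.
have -> : z ^+ n = z ^+ (n - i) * z ^+ i by rewrite -exprD subnK// leq_ord.
rewrite subSS mulrCA; congr (_ * _).
by rewrite -mulrA exprVn divff ?expf_neq0// mulr1.
Qed.

Lemma revp0 n p : (revp n p).[0] = p`_n.
Proof. by rewrite horner_coef0 coef_poly subn0. Qed.

(** In the coordinate [1 / z], where [revp] puts both polynomials, [r] is differentiable at 0; this
    is the rate [O(1 / |z|)]. *)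
Lemma rat_at_oo r : (size (rnum r) <= size (rden r))%N ->
  exists k d : R, [/\ 0 < k, 0 < d & forall z, d < normc z -> ~~ root (rden r) z /\
    normc (rfun r z - (rnum r)`_(size (rden r)).-1 / lead_coef (rden r)) <= k / normc z].
Proof.
move=> nd; set v := _ / _; set n := (size (rden r)).-1.
have sd : size (rden r) = n.+1 by rewrite prednK// size_poly_gt0 rden_neq0.
have [d1 c1] := cder_poly (revp n (rnum r)) 0; have [d2 c2] := cder_poly (revp n (rden r)) 0.
have l0 : (revp n (rden r)).[0] != 0 by rewrite revp0 -lead_coefE lead_coef_eq0 rden_neq0.
have cV := cderV l0 c2; have := cderM c1 cV.
set d := _ + _ => /cderP/(_ 1 ltr01)[e1 e10 e1P].
have [|e2 e20 [_ e2P]] := @nonroot_near R (revp n (rden r)) 0 1 _ ltr01.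
  by apply: contraNneq l0 => ->; rewrite horner0.
have k0 : 0 < normc d + 1 by rewrite ltr_wpDl ?normc_ge0.
pose e := Num.min e1 e2; have e0 : 0 < e by rewrite lt_min e10.
have ei : 0 < e^-1 by rewrite invr_gt0.
exists (normc d + 1), e^-1; split=> // z ez.
have n0 : 0 < normc z by apply: lt_trans ez.
have z0 : z != 0 by rewrite -normc_gt0.
have we : normc z^-1 < e by rewrite normcV invf_plt ?posrE.
have w0 : z^-1 != 0 by rewrite invr_eq0.
have zn : z ^+ n != 0 by rewrite expf_neq0.
have dE : (rden r).[z] = z ^+ n * (revp n (rden r)).[z^-1] by apply: revpE; rewrite // sd.
have nE : (rnum r).[z] = z ^+ n * (revp n (rnum r)).[z^-1] by apply: revpE; rewrite // -sd.
have [we1 we2] : normc (z^-1 - 0) < e1 /\ normc (z^-1 - 0) < e2.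
  by move: we; rewrite subr0 lt_min => /andP[].
have dn0 : (revp n (rden r)).[z^-1] != 0 by exact: e2P.
split; first by rewrite rootE dE mulf_neq0.
have := e1P _ we1; rewrite mul1r subr0 !revp0 -lead_coefE -/v.
rewrite /rfun dE nE -mulf_div divff// mul1r.
set X := _ / _ - v => h.
have -> : (normc d + 1) / normc z = normc (d * z^-1) + normc z^-1.
  by rewrite normcM normcV; ring.
rewrite -(subrK (d * z^-1) X); apply: le_trans (le_normcD _ _) _.
by rewrite addrC lerD2l.
Qed.

(** At [iy] the kernel has the nonnegative imaginary part [y / (t^2 + y^2)], so the integral can
    only increase the linear term. *)
Lemma linear_coeff_im Q b y : linear_coeff Q b -> 0 < y -> b * y <= Im (Q (0 +i* y)).
Proof.
move=> [alpha [sigma [b0 _ H]]] y0.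
rewrite H; last exact: lt0r_neq0.
rewrite 2!ImD ImRM /= add0r lerDl; apply: Rintegral_ge0 => t _.
by rewrite subr0 sub0r mulNr opprK divr_ge0 ?addr_ge0 ?sqr_ge0// ltW.
Qed.

(* [Im Q(iy) >= b y], whereas [Q(iy) = O(y)] and [r(iy) - r(oo) = O(1/y)]: a negative
   value [r(oo)] would make [Im (r Q)] negative at [iy] for large [y]. *)
Lemma necessity_oo r Q F b : multiplier r Q F -> 0 < b -> linear_coeff Q b ->
  ge0_sph (rsph r None).
Proof.
move=> mQ b0 bQ; have [nQ nF rs _ _] := mQ; rewrite /rsph.
case: ltnP => // nd; rewrite /ge0_sph.
have [k [d [k0 d0 H]]] := rat_at_oo nd; set v := _ / _ in H *.
have pt y : d < y -> [/\ 0 < y, ~~ root (rden r) (0 +i* y),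
    normc (rfun r (0 +i* y) - v) <= k / y & rfun r (0 +i* y)^* = (rfun r (0 +i* y))^*].
  move=> dy; have y0 := lt_trans d0 dy.
  have ny : normc (0 +i* y) = y by rewrite /normc expr0n add0r sqrtr_sqr gtr0_norm.
  have := H (0 +i* y); rewrite ny => /(_ dy)[h1 h2]; split=> //.
  by have [] := rsym_rfun rs h1.
(* [r] takes conjugate values at [iy] and [-iy], and both tend to [v]. *)
have vi : Im v = 0.
  apply/eqP; rewrite -normr_eq0 -[_ == _]orbF; apply: contraTT isT; rewrite orbF => vn.
  have v0 : 0 < `|Im v| by rewrite lt_def vn normr_ge0.
  pose y := Num.max (d + 1) (k / `|Im v| + 1).
  have dy : d < y by rewrite lt_max ltrDl ltr01.
  have ky : k < y * `|Im v| by rewrite -ltr_pdivrMr// lt_max ltrDl ltr01 orbT.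
  have [y0 h1 h2 h3] := pt y dy.
  have yj : d < normc ((0 +i* y)^*).
    by rewrite normcJ /normc expr0n add0r sqrtr_sqr gtr0_norm.
  have [_] := H _ yj; rewrite h3 normcJ.
  have -> : normc (0 +i* y) = y by rewrite /normc expr0n add0r sqrtr_sqr gtr0_norm.
  move=> /(le_trans (normc_Im _)); have := le_trans (normc_Im _) h2.
  rewrite !ImB ImJ !ler_pdivlMr//.
  move: (Im (rfun _ _)) (Im v) ky => p q ky; rewrite -{2}(gtr0_norm y0) -{1}(gtr0_norm y0).
  rewrite -!normrM !ler_norml => /andP[g1 g2] /andP[g3 g4].
  move: ky; rewrite -{1}(gtr0_norm y0) -normrM ltNge ler_norml; case/negP.
  by apply/andP; split; clear -g1 g2 g3 g4; lra.
rewrite lecE /= vi eqxx /= leNgt; apply/negP => vn.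
pose u := - Re v; have u0 : 0 < u by rewrite oppr_gt0.
pose B := normc (Q (0 +i* 1)).
have B0 : 0 <= B by exact: normc_ge0.
(* The bound [2 * k / u] makes [Re r] at most [- u / 2]; the last entry makes the negative term, of
   size [u * b * y / 2], exceed the error [k * B]. *)
pose y := Num.max (d + 1) (Num.max 1 (Num.max (2 * k / u) (2 * k * B / (u * b) + 1))).
have [dy [y1 [y2 y3]]] : d + 1 <= y /\ 1 <= y /\ 2 * k / u <= y /\ 2 * k * B / (u * b) + 1 <= y.
  by rewrite /y !le_max !lexx !orbT.
have [|y0 h1 h2 _] := pt y; first by apply: lt_le_trans dy; rewrite ltrDl.
have n0 : Im (0 +i* y : R[i]) != 0 by exact: lt0r_neq0.
have := nev_im nF.1 (y0 : 0 < Im (0 +i* y)); rewrite (multiplierE mQ n0 h1) ImM.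
have [_] := nev_vert 0 nQ.1 ltr01 y1; have [+ _] := nev_vert 0 nQ.1 ltr01 y1.
rewrite !mulr1 -/B => v1 _.
have im := linear_coeff_im bQ y0.
have r1 : Re (rfun r (0 +i* y)) <= - (u / 2).
  have ku : k / y <= u / 2.
    by rewrite ler_pdivrMr//; move: y2; rewrite ler_pdivrMr//; clear; lra.
  have := le_trans (normc_Re _) (le_trans h2 ku); rewrite ReB ler_norml => /andP[_].
  rewrite /u; clear; lra.
have r2 : `|Im (rfun r (0 +i* y))| <= k / y.
  by have := le_trans (normc_Im _) h2; rewrite ImB vi subr0.
have t1 : Re (rfun r (0 +i* y)) * Im (Q (0 +i* y)) <= - (u / 2) * (b * y).
  rewrite mulNr lerNr -mulNr; apply: ler_pM => //.
  - by rewrite divr_ge0 ?(ltW u0).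
  - by rewrite mulr_ge0 ?(ltW b0) ?(ltW y0).
  - by rewrite lerNr.
have t2 : Im (rfun r (0 +i* y)) * Re (Q (0 +i* y)) <= k * B.
  apply: le_trans (ler_norm _) _; rewrite normrM.
  have -> : k * B = k / y * (B * y) by field; rewrite gt_eqF.
  by apply: ler_pM => //; exact: le_trans (normc_Re _) v1.
have t3 : 2 * k * B + u * b <= y * (u * b).
  have ub : 0 < u * b by rewrite mulr_gt0.
  have := ler_wpM2r (ltW ub) y3; rewrite mulrDl mul1r divfK//; exact: lt0r_neq0.
have ub : 0 < u * b by rewrite mulr_gt0.
move: t1 t2 t3 ub; clear; lra.
Qed.

Lemma necessity_i r Q F : multiplier r Q F -> cond_i r Q.
Proof.
move=> mQ; have [nQ _ rs _ _] := mQ.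
have neg x : lt0_sph (rsph r (Some x%:C)) ->
    exists2 q, q != 0 & has_value Q x%:C q%:C.
  case: (boolP (root (rden r) x%:C)) => dx; first by rewrite /rsph dx.
  rewrite rsph_root// /lt0_sph ltcE => /andP[_ rx].
  exact: multiplier_rho mQ dx rx.
split=> [[x|]|x lx]; last 2 first.
- by move=> [b b0 hb]; exact: necessity_oo mQ b0 hb.
- move=> h0; have [q q0 hq] := neg x lx.
  have [_ e1] := has_value_ext h0; have [_] := has_value_ext hq.
  by rewrite e1 => /(congr1 (@complex.Re R)) /= e2; rewrite -e2 eqxx in q0.
move=> nr /=; case: (boolP (root (rden r) x%:C)) => dx; first by [].
rewrite /ge0_sph -/(rfun r x%:C) lecE /= rfun_real// eqxx /= leNgt.
apply/negP => rx; apply: nr; have [|q _ /has_value_ext[]//] := neg x.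
by rewrite rsph_root// /lt0_sph ltcE /= rfun_real// eqxx.
Qed.

End NecessityI.

(** * Arguments of holomorphic functions *)

Section Argument.
Variable R : realType.
Implicit Types (x y t s k e : R) (f g Q : R[i] -> R[i]) (h : R[i] -> R).
Implicit Types (a z w : R[i]).

(** On the closed upper half-plane without 0 this is the argument in [0, pi]; below the axis it is
    that of the conjugate, so the function is continuous on the whole plane off 0. *)
Definition arg z : R := acos (Re z / normc z).

Lemma Re_normc_bound z : -1 <= Re z / normc z <= 1.
Proof.
have [->|z0] := eqVneq z 0; first by rewrite normc0 invr0 mulr0 lerN10 ler01.
rewrite -ler_norml normrM normfV (ger0_norm (normc_ge0 z)).
by rewrite ler_pdivrMr ?normc_gt0// mul1r normc_Re.
Qed.

Lemma arg_ge0 z : 0 <= arg z.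
Proof. exact: acos_ge0 (Re_normc_bound z). Qed.

Lemma arg_lepi z : arg z <= pi.
Proof. exact: acos_lepi (Re_normc_bound z). Qed.

Lemma cos_arg z : z != 0 -> normc z * cos (arg z) = Re z.
Proof.
move=> z0; rewrite acosK ?in_itv ?Re_normc_bound//.
by rewrite mulrC divfK// gt_eqF ?normc_gt0.
Qed.

Lemma arg_circ z : 0 <= Im z -> z != 0 -> z = circ (normc z) (arg z).
Proof.
move=> z0 zn; have n0 : 0 < normc z by rewrite normc_gt0.
apply: eq_ReIm; rewrite /= ?cos_arg//.
rewrite sin_acos ?Re_normc_bound// -[X in X * _](gtr0_norm n0) -sqrtr_sqr -sqrtrM ?sqr_ge0//.
rewrite mulrBr mulr1 -exprMn mulrC divfK ?gt_eqF// normc_sqr addrAC subrr add0r.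
by rewrite sqrtr_sqr ger0_norm.
Qed.

Lemma arg_pos x : 0 < x -> arg x%:C = 0.
Proof. by move=> x0; rewrite /arg normcR /= gtr0_norm// divff ?gt_eqF// acos1. Qed.

Lemma arg_neg x : x < 0 -> arg x%:C = pi.
Proof. by move=> x0; rewrite /arg normcR /= ltr0_norm// invrN mulrN divff ?lt_eqF// acosN1. Qed.

Lemma argZ t z : 0 < t -> arg (t%:C * z) = arg z.
Proof.
move=> t0; rewrite /arg ReRM normcM normcR gtr0_norm// invfM.
by rewrite mulrACA divff ?gt_eqF// mul1r.
Qed.

Lemma arg_itv z : 0 < Im z -> 0 < arg z < pi.
Proof.
move=> z0; have zn : z != 0 by apply: nonreal_neq0; exact: lt0r_neq0.
have := congr1 (fun w : R[i] => Im w) (arg_circ (ltW z0) zn) => /= E.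
rewrite !lt_def arg_ge0 arg_lepi !andbT; apply/andP; split.
  by apply: contraTneq z0 => h; rewrite E h sin0 mulr0 ltxx.
by apply: contraTneq z0 => h; rewrite E -h sinpi mulr0 ltxx.
Qed.

(** The end points, where the derivative blows up, are included because they correspond to real
    numbers; monotonicity of [cos] is used instead. *)
Lemma acos_cont x e : -1 <= x <= 1 -> 0 < e -> exists2 d : R, 0 < d &
  forall y, -1 <= y <= 1 -> `|y - x| < d -> `|acos y - acos x| < e.
Proof.
move=> x1 e0; set u := acos x.
have u0 : 0 <= u by exact: acos_ge0.
have up : u <= pi by exact: acos_lepi.
have ux : cos u = x by rewrite acosK ?in_itv.
have [d1 d10 H1] : exists2 d1 : R, 0 < d1 & forall y, -1 <= y <= 1 ->
    `|y - x| < d1 -> acos y < u + e.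
  have [h|h] := leP (u + e) pi; last first.
    by exists 1 => // y y1 _; apply: le_lt_trans (acos_lepi y1) h.
  have iu : u \in `[0, pi] by rewrite in_itv /= u0.
  have iue : u + e \in `[0, pi] by rewrite in_itv /= h andbT addr_ge0// ltW.
  exists (x - cos (u + e)); first by rewrite subr_gt0 -ux ltr_cos// ltrDl.
  move=> y y1; rewrite distrC ltr_norml => /andP[_]; rewrite ltrD2l ltrN2 => hy.
  have iy : acos y \in `[0, pi] by rewrite in_itv /= acos_ge0// acos_lepi.
  by rewrite -ltr_cos// acosK// in_itv.
have [d2 d20 H2] : exists2 d2 : R, 0 < d2 & forall y, -1 <= y <= 1 ->
    `|y - x| < d2 -> u - e < acos y.
  have [h|h] := leP 0 (u - e); last first.
    by exists 1 => // y y1 _; apply: lt_le_trans h (acos_ge0 y1).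
  have iu : u \in `[0, pi] by rewrite in_itv /= u0.
  have iue : u - e \in `[0, pi].
    by rewrite in_itv /= h; apply: le_trans up; rewrite gerBl ltW.
  exists (cos (u - e) - x); first by rewrite subr_gt0 -ux ltr_cos// gtrBl.
  move=> y y1; rewrite ltr_norml => /andP[_]; rewrite ltrD2r => hy.
  have iy : acos y \in `[0, pi] by rewrite in_itv /= acos_ge0// acos_lepi.
  by rewrite -ltr_cos// acosK// in_itv.
exists (Num.min d1 d2); first by rewrite lt_min d10.
move=> y y1; rewrite lt_min => /andP[h1 h2].
by rewrite ltr_distl H2//= H1.
Qed.

Lemma arg_cont a e : a != 0 -> 0 < e -> exists2 d : R, 0 < d &
  forall z, normc (z - a) < d -> `|arg z - arg a| < e.
Proof.
move=> an e0; have [d d0 dP] := acos_cont (Re_normc_bound a) e0.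
have n0 : 0 < normc a by rewrite normc_gt0.
exists (Num.min (normc a) (d * normc a / 2)); first by rewrite lt_min n0 divr_gt0// mulr_gt0.
move=> z; rewrite lt_min => /andP[za zd]; apply: dP (Re_normc_bound z) _.
have zn : 0 < normc z.
  by have := ler_normcB a z; rewrite normcB; move: za; move: (normc _) (normc _) (normc _) => p q r; clear; lra.
have -> : Re z / normc z - Re a / normc a =
    Re (z - a) / normc a + Re z / normc z * ((normc a - normc z) / normc a).
  by rewrite ReB; field; rewrite !gt_eqF.
apply: le_lt_trans (ler_normD _ _) _.
rewrite normrM (normrM (_ / _)) normfV (gtr0_norm n0).
have := Re_normc_bound z; rewrite -ler_norml => r1.
have h2 : `|(normc a - normc z) / normc a| <= normc (z - a) / normc a.
  rewrite normrM normfV (gtr0_norm n0) ler_pM2r ?invr_gt0// ler_norml.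
  have := ler_normcB a z; have := ler_normcB z a; rewrite (normcB a z).
  by move: (normc _) (normc _) (normc _) => p q r; clear => h1 h2; apply/andP; split; lra.
have h1 : `|Re (z - a)| / normc a <= normc (z - a) / normc a.
  by rewrite ler_pM2r ?invr_gt0// normc_Re.
have h3 := ler_pM (normr_ge0 _) (normr_ge0 _) r1 h2; rewrite mul1r in h3.
apply: le_lt_trans (lerD h1 h3) _; rewrite -mulrDl ltr_pdivrMr//.
by move: zd; clear; move: (normc _) (normc _) => p q; lra.
Qed.

(* [h] is a continuous argument of the holomorphic function [f] on the upper half-plane. *)
Definition argfun f h := forall z, 0 < Im z ->
  [/\ f z != 0, exists d, cder f z d, f z = circ (normc (f z)) (h z) &
      forall e, 0 < e -> exists2 d : R, 0 < d &
        forall w, normc (w - z) < d -> `|h w - h z| < e].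

Lemma argfunM f g h h' : argfun f h -> argfun g h' ->
  argfun (fun z => f z * g z) (fun z => h z + h' z).
Proof.
move=> F G z z0; have [f0 [d fd] fE fc] := F z z0; have [g0 [d' gd] gE gc] := G z z0; split.
- by rewrite mulf_neq0.
- by eexists; apply: cderM; [exact: fd|exact: gd].
- by rewrite normcM {1}fE {1}gE circM.
move=> e e0; have e2 : 0 < e / 2 by rewrite divr_gt0.
have [d1 d10 P1] := fc _ e2; have [d2 d20 P2] := gc _ e2.
exists (Num.min d1 d2); first by rewrite lt_min d10.
move=> w; rewrite lt_min => /andP[/P1 h1 /P2 h2].
rewrite opprD addrACA; apply: le_lt_trans (ler_normD _ _) _; clear -h1 h2; lra.
Qed.

Lemma circV s t : (circ s t)^-1 = circ s^-1 (- t).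
Proof.
have [->|s0] := eqVneq s 0.
  have z t' : circ 0 t' = 0 :> R[i] by rewrite /circ !mul0r.
  by rewrite invr0 !z invr0.
have h : circ s t * circ s^-1 (- t) = 1.
  by rewrite circM divff// subrr /circ cos0 sin0 mulr0 mulr1.
have c0 : circ s t != 0 by apply: contra_eq_neq h => ->; rewrite mul0r eq_sym oner_neq0.
by apply: (mulfI c0); rewrite h divff.
Qed.

Lemma argfunV f h : argfun f h -> argfun (fun z => (f z)^-1) (fun z => - h z).
Proof.
move=> F z z0; have [f0 [d fd] fE fc] := F z z0; split.
- by rewrite invr_eq0.
- by eexists; exact: cderV f0 fd.
- by rewrite normcV {1}fE circV.
move=> e e0; have [d1 d10 P1] := fc _ e0; exists d1 => // w /P1.
by rewrite -opprD normrN.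
Qed.

Lemma argfun_cst t : argfun (fun=> circ 1 t) (fun=> t).
Proof.
move=> z z0; have n1 : normc (circ 1 t) = 1 by exact: normc_circ.
split; first by rewrite -normc_eq0 n1 oner_neq0.
- by exists 0; exact: cder_cst.
- by rewrite n1.
- by move=> e e0; exists 1 => // w _; rewrite subrr normr0.
Qed.

Lemma argfun_comp_arg f : (forall z, 0 < Im z -> f z != 0 /\ exists d, cder f z d) ->
  (forall z, 0 < Im z -> 0 <= Im (f z)) -> argfun f (fun z => arg (f z)).
Proof.
move=> fP f0 z z0; have [fn [d fd]] := fP z z0; split=> //; first by exists d.
  by apply: arg_circ => //; exact: f0.
move=> e e0; have [d1 d10 P1] := arg_cont fn e0.
have /ccontP/(_ _ d10)[d2 d20 P2] := cder_cont fd.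
by exists d2 => // w /P2 /P1.
Qed.

Lemma argfun_nev Q : nevpos Q -> argfun Q (fun z => arg (Q z)).
Proof.
move=> [nQ Q0]; apply: argfun_comp_arg => z z0; last exact: nev_im.
by split; [apply: Q0; exact: lt0r_neq0|apply: nev_cder => //; exact: lt0r_neq0].
Qed.

Lemma argfun_sub x : argfun (fun z => z - x%:C) (fun z => arg (z - x%:C)).
Proof.
apply: argfun_comp_arg => z z0; last by rewrite ImB subr0 ltW.
split; last by exists 1; exact: cder_subc.
by apply: nonreal_neq0; rewrite ImB subr0 lt0r_neq0.
Qed.

Lemma argfunX f h n : argfun f h -> argfun (fun z => f z ^+ n) (fun z => n%:R * h z).
Proof.
move=> F; elim: n => [|n IH].
  have := argfun_cst 0; have -> : circ 1 0 = 1 :> R[i] by rewrite /circ cos0 sin0 mulr0 mulr1.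
  have -> : (fun=> 0) = (fun z => 0%:R * h z) by apply/funext => z; rewrite mul0r.
  by have -> : (fun=> 1) = (fun z => f z ^+ 0).
have := argfunM F IH.
have -> : (fun z => h z + n%:R * h z) = (fun z => n.+1%:R * h z).
  by apply/funext => z; rewrite -add1n natrD mulrDl mul1r.
by have -> : (fun z => f z * f z ^+ n) = (fun z => f z ^+ n.+1) by apply/funext => z; rewrite exprS.
Qed.

(** Rotated by [- h a] and negated, [f] has nonnegative imaginary part near [a], since its argument
    there exceeded that at [a] by a number in ]-1, 0]. The imaginary part vanishes at [a], and
    [cder_cst0] makes the rotated function constant. *)
Lemma argfun_max f h a : argfun f h -> 0 < Im a ->
  (forall z, 0 < Im z -> h z <= h a) ->
  exists2 d : R, 0 < d & forall z, normc (z - a) < d -> h z = h a.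
Proof.
move=> F a0 hm; have [f0 _ fE fc] := F a a0.
have [d d0 dP] := fc 1 ltr01.
pose g z := - (f z * circ 1 (- h a)).
pose r := Num.min d (Im a); have r0 : 0 < r by rewrite lt_min d0.
have up z : normc (z - a) < r -> 0 < Im z.
  rewrite lt_min => /andP[_ h1]; have := le_lt_trans (normc_Im _) h1.
  by rewrite ImB ltr_norml => /andP[h2 _]; clear -h2; lra.
have gE z : 0 < Im z -> g z = - circ (normc (f z)) (h z - h a).
  by move=> z0; have [_ _ E _] := F z z0; rewrite /g {1}E circM mulr1.
have hz z : normc (z - a) < r -> -1 < h z - h a <= 0.
  move=> zr; rewrite subr_le0 hm ?up// andbT.
  move: zr; rewrite lt_min => /andP[/dP + _]; by rewrite ltr_norml => /andP[].
have p3 : 1 < pi :> R by have := pi_ge2 R; clear; lra.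
have r2 : 0 < r / 2 by rewrite divr_gt0.
have rr : r / 2 < r by rewrite ltr_pdivrMr// ltr_pMr// ltr1n.
have G0 : Im (g a) = 0 by rewrite gE// ImN /= subrr sin0 mulr0 oppr0.
have Gd z : normc (z - a) < r -> exists d, cder g z d.
  move=> zr; have [_ [d' fd] _ _] := F z (up z zr).
  by eexists; apply: cderN; apply: cderM; [exact: fd|exact: cder_cst].
have Gi z : normc (z - a) < r -> 0 <= Im (g z).
  move=> zr; rewrite gE ?up// ImN /= -mulrN mulr_ge0 ?normc_ge0//.
  have /andP[h1 h2] := hz z zr; rewrite -sinN; apply: sin_ge0_pi.
  by apply/andP; split; clear -h1 h2 p3; lra.
exists (r / 2) => // z zr; have zr' := lt_trans zr rr.
have := cder_cst0 r0 G0 Gd Gi zr; rewrite (gE z) ?up// (gE a)// => /oppr_inj.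
move=> /(congr1 (fun w : R[i] => Im w)) /=; rewrite subrr sin0 mulr0.
have [fz _ _ _] := F z (up z zr').
have /andP[h1 h2] := hz z zr'.
move=> /eqP; rewrite mulf_eq0 normc_eq0 (negbTE fz) /= => s0.
apply/eqP; rewrite eq_le hm ?up//= -subr_ge0 leNgt; apply/negP => h3.
have : 0 < sin (- (h z - h a)).
  by apply: sin_gt0_pi; apply/andP; split; clear -h1 h3 p3; lra.
by rewrite sinN (eqP s0) oppr0 ltxx.
Qed.

End Argument.

(** * A Phragmen-Lindelof principle for arguments *)

Section PhragmenLindelof.
Variable R : realType.
Implicit Types (x y t k e m B c : R) (f g : R[i] -> R[i]) (h b : R[i] -> R).
Implicit Types (a z w : R[i]) (G : seq R).

(* The angle under which the segment [c - e, c + e] is seen from z. *)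
Definition seen c e z : R := arg (z - (c + e)%:C) - arg (z - (c - e)%:C).

Lemma argfun_seen c e :
  argfun (fun z => (z - (c + e)%:C) * (z - (c - e)%:C)^-1) (seen c e).
Proof. exact: argfunM (argfun_sub _) (argfunV (argfun_sub _)). Qed.

(** Both identities read off the product of [z - (c + e)] with the conjugate of [z - (c - e)], whose
    argument is [seen c e z]. The sign of the cosine is Thales' theorem, on which [seen_near] and
    [seen_far] rest. *)
Lemma seen_circ c e z : 0 < Im z -> exists2 n, 0 < n &
  n * cos (seen c e z) = normc (z - c%:C) ^+ 2 - e ^+ 2 /\ n * sin (seen c e z) = 2 * e * Im z.
Proof.
move=> z0; have [f0 _ E _] := argfun_seen c e z0.
set N := normc _ in E.
have d0 : z - (c - e)%:C != 0.
  by apply: nonreal_neq0; rewrite ImB subr0 lt0r_neq0.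
set D := normc (z - (c - e)%:C).
have D0 : 0 < D by rewrite normc_gt0.
exists (N * D ^+ 2); first by rewrite mulr_gt0 ?exprn_gt0// normc_gt0.
have key : (z - (c + e)%:C) * (z - (c - e)%:C)^* = circ (N * D ^+ 2) (seen c e z).
  have := congr1 (fun v => v * (D ^+ 2)%:C) E.
  have -> : (D ^+ 2)%:C = (z - (c - e)%:C) * (z - (c - e)%:C)^*.
    apply: eq_ReIm; rewrite ?ReM ?ImM ReJ ImJ /=; last by ring.
    by rewrite /D normc_sqr; ring.
  rewrite -mulrA mulKf// => ->.
  have -> : (z - (c - e)%:C) * (z - (c - e)%:C)^* = circ (D ^+ 2) 0.
    apply: eq_ReIm; rewrite ?ReM ?ImM ReJ ImJ /= ?sin0 ?cos0; last by ring.
    by rewrite /D normc_sqr; ring.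
  by rewrite circM addr0.
have := congr1 (fun v : R[i] => Re v) key; have := congr1 (fun v : R[i] => Im v) key.
rewrite /= => <- <-; rewrite ReM ImM ReJ ImJ !ReB !ImB normc_sqr ReB ImB /=.
by split; ring.
Qed.

Lemma seen_itv c e z : 0 < e -> 0 < Im z -> 0 < seen c e z < pi.
Proof.
move=> e0 z0; have [n n0 [_ hs]] := seen_circ c e z0.
have s0 : 0 < sin (seen c e z).
  by rewrite -(pmulr_rgt0 _ n0) hs !mulr_gt0.
have i1 : 0 < Im (z - (c + e)%:C) by rewrite ImB subr0.
have i2 : 0 < Im (z - (c - e)%:C) by rewrite ImB subr0.
have /andP[a1 a2] := arg_itv i1; have /andP[b1 b2] := arg_itv i2.
apply/andP; split; last by rewrite /seen; clear -a2 b1; lra.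
rewrite ltNge; apply/negP => u0.
have : 0 <= sin (- seen c e z).
  apply: sin_ge0_pi; rewrite oppr_ge0 u0 /= /seen; clear -a1 b2; lra.
by rewrite sinN oppr_ge0 leNgt s0.
Qed.

Lemma seen_near c e z : 0 < e -> 0 < Im z -> normc (z - c%:C) <= e -> pi / 2 <= seen c e z.
Proof.
move=> e0 z0 ze; have /andP[u0 up] := seen_itv c e0 z0.
have [n n0 [hc _]] := seen_circ c e z0.
rewrite leNgt; apply/negP => h.
have : 0 < cos (seen c e z).
  apply: cos_gt0_pihalf; rewrite h andbT; apply: lt_trans u0; rewrite oppr_lt0 divr_gt0 ?pi_gt0//.
rewrite -(pmulr_rgt0 _ n0) hc subr_gt0 ltNge => /negP; apply.
by rewrite ler_pXn2r ?nnegrE ?normc_ge0// ltW.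
Qed.

Lemma seen_far c e z : 0 < e -> 0 < Im z -> e <= normc (z - c%:C) -> seen c e z <= pi / 2.
Proof.
move=> e0 z0 ze; have /andP[u0 up] := seen_itv c e0 z0.
have [n n0 [hc _]] := seen_circ c e z0.
rewrite leNgt; apply/negP => h.
have : cos (seen c e z) < 0.
  have iu : seen c e z \in `[0, pi] by rewrite in_itv /= !ltW.
  have ip : (pi / 2 : R) \in `[0, pi].
    by rewrite in_itv /= divr_ge0 ?pi_ge0//= ler_pdivrMr// ler_peMr ?pi_ge0// ler1n.
  by rewrite -cos_pihalf ltr_cos.
rewrite -(pmulr_rlt0 _ n0) hc subr_lt0 ltNge => /negP; apply.
by rewrite ler_pXn2r ?nnegrE ?normc_ge0// ltW.
Qed.

Lemma seen_small c w e : 0 < Im w -> 0 < e -> exists2 d : R, 0 < d & seen c d w <= e.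
Proof.
move=> w0 e0; have e2 : 0 < e / 2 by rewrite divr_gt0.
have wn : w - c%:C != 0 by apply: nonreal_neq0; rewrite ImB subr0 lt0r_neq0.
have [d d0 dP] := arg_cont wn e2; have d2 : 0 < d / 2 by rewrite divr_gt0.
exists (d / 2) => //.
have := dP (w - (c + d / 2)%:C); have := dP (w - (c - d / 2)%:C).
have -> : w - (c - d / 2)%:C - (w - c%:C) = (d / 2)%:C.
  by rewrite rmorphB; ring.
have -> : w - (c + d / 2)%:C - (w - c%:C) = - (d / 2)%:C.
  by rewrite rmorphD; ring.
rewrite normcN normcR gtr0_norm// ltr_pdivrMr// ltr_pMr// ltr1n.
move=> /(_ isT); rewrite ltr_norml => /andP[h1 h2] /(_ isT); rewrite ltr_norml => /andP[h3 h4].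
rewrite /seen; clear -h1 h2 h3 h4; lra.
Qed.

Lemma seen_large w e : 0 < Im w -> 0 < e -> exists2 d : R, 0 < d & pi - e <= seen 0 d w.
Proof.
move=> w0 e0; have e2 : 0 < e / 2 by rewrite divr_gt0.
have n1 : (1%:C : R[i]) != 0 by exact: oner_neq0.
have nm1 : ((- 1)%:C : R[i]) != 0 by rewrite rmorphN oppr_eq0.
have [d d0 dP] := arg_cont n1 e2; have [d' d'0 d'P] := arg_cont nm1 e2.
rewrite arg_pos// in dP; rewrite arg_neg ?ltrN10// in d'P.
have wn : 0 < normc w by rewrite normc_gt0 nonreal_neq0// lt0r_neq0.
pose m := Num.min d d' / 2; have m0 : 0 < m by rewrite divr_gt0// lt_min d0.
have [md md'] : m < d /\ m < d'.
  have h : m < Num.min d d' by rewrite ltr_pdivrMr// ltr_pMr ?ltr1n// lt_min d0.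
  by move: h; rewrite lt_min => /andP[].
pose k := normc w / m; have k0 : 0 < k by rewrite divr_gt0.
have kn : k%:C != 0 :> R[i] by apply: contra_neq (lt0r_neq0 k0) => /(congr1 (@complex.Re R)).
have nk : normc (w / k%:C) = m.
  by rewrite normcM normcV normcR gtr0_norm// /k invf_div mulrC divfK ?gt_eqF.
exists k => //; rewrite /seen add0r sub0r.
have -> : w - k%:C = k%:C * (w / k%:C + (- 1)%:C).
  by rewrite rmorphN; field.
have -> : w - (- k)%:C = k%:C * (w / k%:C + 1%:C).
  by rewrite rmorphN; field.
rewrite !argZ//; have := dP (w / k%:C + 1%:C); have := d'P (w / k%:C + (- 1)%:C).
rewrite !addrK nk => /(_ md') + /(_ md).
rewrite !ltr_norml => /andP[h1 h2] /andP[h3 h4]; clear -h1 h4; lra.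
Qed.

(** Near [c] the function [n * seen c s] is at least [n * (pi / 2) >= B], and it is small at [w] for
    small [s]; [n * (pi - seen 0 k)] does the same at oo. Being an argument itself, the barrier can
    be subtracted from [h] without leaving the scope of [argfun_max]. *)
Lemma barrier G w e B : 0 < Im w -> 0 < e ->
  exists g, exists b, exists k d : R,
  [/\ argfun g b, b w <= e, 0 < d,
      forall z, 0 < Im z -> 0 <= b z &
      forall z, 0 < Im z -> k < normc z \/ (exists2 c, c \in G & normc (z - c%:C) < d) ->
        B <= b z].
Proof.
move=> w0; pose n := (Num.bound `|B|).+1.
have n0 : 0 < n%:R :> R by rewrite ltr0n.
have nB : B <= n%:R * (pi / 2).
  apply: le_trans (ler_norm B) _; apply: (@le_trans _ _ n%:R).
    by apply/ltW/(lt_trans (archi_boundP (normr_ge0 B))); rewrite /n -natr1 ltrDl.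
  by rewrite ler_peMr ?ler0n// ler_pdivlMr// mul1r; exact: pi_ge2.
elim: G e => [|c G IH] e e0.
  have en : 0 < e / n%:R by rewrite divr_gt0.
  have [k k0 hk] := seen_large w0 en.
  exists (fun z => (circ 1 pi * ((z - (0 + k)%:C) * (z - (0 - k)%:C)^-1)^-1) ^+ n),
    (fun z => n%:R * (pi - seen 0 k z)), k, 1; split=> //.
  - exact: argfunX (argfunM (argfun_cst _) (argfunV (argfun_seen _ _))).
  - by rewrite -ler_pdivlMl// mulrC; clear -hk; lra.
  - by move=> z z0; rewrite mulr_ge0 ?ler0n// subr_ge0 ltW//; have /andP[] := seen_itv 0 k0 z0.
  move=> z z0 [kz|[]//]; apply: le_trans nB _; rewrite ler_pM2l//.
  have := seen_far k0 z0 (_ : k <= normc (z - 0%:C)); rewrite subr0 => /(_ (ltW kz)).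
  clear; lra.
have e2 : 0 < e / 2 by rewrite divr_gt0.
have [g [b [k [d [gb bw d0 b0 bB]]]]] := IH _ e2.
have en : 0 < e / 2 / n%:R by rewrite divr_gt0.
have [s s0 hs] := seen_small c w0 en.
exists (fun z => g z * ((z - (c + s)%:C) * (z - (c - s)%:C)^-1) ^+ n),
  (fun z => b z + n%:R * seen c s z), k, (Num.min d s); split=> //.
- exact: argfunM gb (argfunX _ (argfun_seen _ _)).
- by move: hs; rewrite ler_pdivlMr// mulrC => hs; clear -hs bw; lra.
- by rewrite lt_min d0.
- move=> z z0; rewrite addr_ge0 ?b0// mulr_ge0 ?ler0n// ltW//.
  by have /andP[] := seen_itv c s0 z0.
move=> z z0; have /andP[u0 _] := seen_itv c s0 z0.
have u0' : 0 <= n%:R * seen c s z by rewrite mulr_ge0 ?ler0n ?ltW.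
move=> [kz|[c']].
  by apply: le_trans (bB z z0 (or_introl kz)) _; rewrite lerDl.
rewrite inE lt_min => /orP[/eqP->|cG] /andP[zd zs].
  apply: le_trans nB _; apply: (@le_trans _ _ (n%:R * seen c s z)).
    by rewrite ler_pM2l//; apply: seen_near => //; exact: ltW.
  by rewrite lerDr b0.
apply: (@le_trans _ _ (b z)); last by rewrite lerDl.
by apply: bB => //; right; exists c'.
Qed.

(** Values above [m] occur only in a bounded region away from the real line. If the supremum were
    not attained, then [h] would stay below it by a fixed amount on a rectangle, which is shown by
    compactness in one coordinate after the other. *)
Lemma attains_sup h m k a B : 0 < Im a -> m < h a ->
  (forall z, 0 < Im z -> h z <= B) ->
  (forall z, 0 < Im z -> forall e, 0 < e -> exists2 d : R, 0 < d &
     forall w, normc (w - z) < d -> `|h w - h z| < e) ->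
  (forall z, 0 < Im z -> k < normc z -> h z <= m) ->
  (forall x, exists2 d : R, 0 < d & forall z, 0 < Im z -> normc (z - x%:C) < d -> h z <= m) ->
  exists2 z0, 0 < Im z0 & forall z, 0 < Im z -> h z <= h z0.
Proof.
move=> a0 ma hB hc hk hx.
pose A := [set h z | z in [set z | 0 < Im z]].
have hA : has_sup A by split; [exists (h a), a|exists B => _ [z z0 <-]; exact: hB].
pose M := sup A.
have hM z : 0 < Im z -> h z <= M by move=> z0; apply: ub_le_sup; [exact: hA.2|exists z].
have mM : m < M := lt_le_trans ma (hM a a0).
apply: contrapT => nex.
have lt z : 0 < Im z -> h z < M.
  move=> z0; rewrite lt_neqAle hM// andbT; apply/eqP => E; apply: nex; exists z => // w w0.
  by rewrite E hM.
(* A strip of uniform height along the relevant part of the real line is discarded. *)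
have [d1 d10 d1P] : exists2 d : R, 0 < d & forall x, - k <= x <= k ->
    forall z, 0 < Im z -> normc (z - x%:C) < d -> h z <= m.
  apply: segment_uniform => [x d d' dP d'0 dd z z0 zd|x xk].
    by apply: dP => //; exact: lt_le_trans dd.
  have [d d0 dP] := hx x; exists (d / 2) => [|s sx _ z z0 zs]; first by rewrite divr_gt0.
  apply: dP => //; have := le_normcD (z - s%:C) (s%:C - x%:C); rewrite addrA subrK -rmorphB normcR.
  by move=> /le_lt_trans; apply; clear -sx zs; lra.
have loc x y : 0 < y -> exists2 d : R, 0 < d & forall x' y', `|x' - x| < d -> `|y' - y| < d ->
    h (x' +i* y') <= M - d.
  move=> y0; have z0 : 0 < Im (x +i* y) by [].
  have e0 : 0 < (M - h (x +i* y)) / 2 by rewrite divr_gt0// subr_gt0 lt.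
  have [d d0 dP] := hc _ z0 _ e0.
  exists (Num.min (d / 2) ((M - h (x +i* y)) / 2)); first by rewrite lt_min divr_gt0.
  move=> x' y'; rewrite !lt_min => /andP[x1 _] /andP[y1 _].
  have wz : normc ((x' +i* y') - (x +i* y)) < d.
    by apply: le_lt_trans (normc_le_ReIm _) _; rewrite ReB ImB /=; clear -x1 y1; lra.
  have := dP _ wz; rewrite ltr_norml => /andP[_ h1].
  apply: (@le_trans _ _ (M - (M - h (x +i* y)) / 2)); first by clear -h1; lra.
  by rewrite lerD2l lerN2 ge_min lexx orbT.
have [d2 d20 d2P] : exists2 d : R, 0 < d & forall x, - k <= x <= k ->
    forall y, d1 / 2 <= y <= k -> forall x', `|x' - x| < d -> h (x' +i* y) <= M - d.
  apply: segment_uniform => [x d d' dP d'0 dd y yk x' xx|x xk].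
    apply: (@le_trans _ _ (M - d)); last by rewrite lerD2l lerN2.
    by apply: dP => //; exact: lt_le_trans dd.
  have [d d0 dP] : exists2 d : R, 0 < d & forall y, d1 / 2 <= y <= k ->
      forall x' y', `|x' - x| < d -> `|y' - y| < d -> h (x' +i* y') <= M - d.
    apply: segment_uniform => [y d d' dP d'0 dd x' y' xx yy|y /andP[y1 _]].
      apply: (@le_trans _ _ (M - d)); last by rewrite lerD2l lerN2.
      by apply: dP; exact: lt_le_trans dd.
    have y0 : 0 < y by apply: lt_le_trans y1; rewrite divr_gt0.
    have [d d0 dP] := loc x y y0; exists (d / 2) => [|s sy _ x' y' xx yy].
      by rewrite divr_gt0.
    apply: (@le_trans _ _ (M - d)); last by clear -d0; lra.
    apply: dP; first by clear -xx d0; lra.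
    have := ler_normD (y' - s) (s - y); rewrite addrA subrK => /le_lt_trans; apply.
    by clear -sy yy; lra.
  exists (d / 2) => [|s sx _ y yk x' xs]; first by rewrite divr_gt0.
  apply: (@le_trans _ _ (M - d)); last by clear -d0; lra.
  apply: (dP y) => //; last by rewrite subrr normr0.
  have := ler_normD (x' - s) (s - x); rewrite addrA subrK => /le_lt_trans; apply.
  by clear -sx xs; lra.
pose M' := Num.max m (M - d2).
have MM : M' < M by rewrite gt_max mM gtrBl.
have : M <= M'.
  apply: ge_sup; first by exists (h a), a.
  move=> _ [z z0 <-]; rewrite le_max; have [kz|zk] := ltP k (normc z).
    by rewrite hk.
  have xk : - k <= Re z <= k by rewrite -ler_norml; exact: le_trans (normc_Re _) zk.
  have [zd|zd] := ltP (Im z) d1.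
    rewrite (d1P _ xk)//.
    have -> : z - (Re z)%:C = 0 +i* Im z by apply: eq_ReIm; rewrite ?ReB ?ImB /= ?subrr ?subr0.
    by rewrite /normc expr0n add0r sqrtr_sqr gtr0_norm.
  apply/orP; right; rewrite [z]ReImE; apply: (d2P (Re z)) => //.
    apply/andP; split; first by clear -zd d10; lra.
    exact: le_trans (le_trans (ler_norm _) (normc_Im _)) zk.
  by rewrite subrr normr0.
by rewrite leNgt MM.
Qed.

(* Minus a barrier that is small at [w], a function [h] with [h w > 0] would attain a
   positive maximum; it would then be constant around every maximum point, including
   the lowest one on a vertical line. *)
Theorem argfun_le0 f h B G : argfun f h -> (forall z, 0 < Im z -> h z <= B) ->
  (forall x, x \notin G -> forall e, 0 < e -> exists2 d : R, 0 < d &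
     forall z, 0 < Im z -> normc (z - x%:C) < d -> h z <= e) ->
  forall w, 0 < Im w -> h w <= 0.
Proof.
move=> fh hB hx w w0; rewrite leNgt; apply/negP => hw.
have m0 : 0 < h w / 2 by rewrite divr_gt0.
have [g [b [k [d [gb bw d0 b0 bB]]]]] := barrier G B w0 m0.
pose H z := h z - b z.
have FH : argfun (fun z => f z * (g z)^-1) H by exact: argfunM fh (argfunV gb).
have H0 z : 0 < Im z -> h z <= b z -> H z <= 0 by move=> _; rewrite subr_le0.
have Hh z : 0 < Im z -> H z <= h z by move=> z0; rewrite gerBl b0.
pose m := h w / 4; have mp : 0 < m by rewrite divr_gt0.
have mw : m < H w by rewrite /m /H; clear -bw hw; lra.
have Hr x : exists2 d : R, 0 < d & forall z, 0 < Im z -> normc (z - x%:C) < d -> H z <= m.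
  case: (boolP (x \in G)) => xG.
    exists d => // z z0 zd; apply: le_trans (ltW mp); apply: H0 => //.
    by apply: le_trans (hB z z0) (bB z z0 _); right; exists x.
  have [d' d'0 d'P] := hx x xG m mp; exists d' => // z z0 zd.
  exact: le_trans (Hh z z0) (d'P z z0 zd).
have [z0 z00 z0P] : exists2 z0, 0 < Im z0 & forall z, 0 < Im z -> H z <= H z0.
  apply: (@attains_sup H m k w B w0 mw) => [z zp|z zp|z zp zk|//].
  - exact: le_trans (Hh z zp) (hB z zp).
  - by have [] := FH z zp.
  - apply: le_trans (ltW mp); apply: H0 => //.
    by apply: le_trans (hB z zp) (bB z zp _); left.
pose M := H z0; have mM : m < M by apply: lt_le_trans mw _; exact: z0P.
pose E := [set t | 0 < t /\ H (Re z0 +i* t) = M].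
have [r r0 rP] := Hr (Re z0).
have vn t : normc ((Re z0 +i* t) - (Re z0)%:C) = `|t|.
  by rewrite -(complexr0 (Re z0)) normc_verB subr0.
have Er t : E t -> r <= t.
  move=> [t0 tM]; rewrite leNgt; apply/negP => tr.
  have := rP (Re z0 +i* t) t0; rewrite vn gtr0_norm// => /(_ tr).
  by rewrite tM leNgt mM.
have hE : has_inf E.
  split; last by exists r => t; exact: Er.
  by exists (Im z0); split=> //; rewrite -ReImE.
pose t := inf E.
have rt : r <= t by apply: lb_le_inf; [exact: hE.1|exact: Er].
have t0 : 0 < t by exact: lt_le_trans rt.
have tz : 0 < Im (Re z0 +i* t) by [].
have ver s : normc ((Re z0 +i* s) - (Re z0 +i* t)) = `|s - t| by rewrite normc_verB.
have tM : H (Re z0 +i* t) = M.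
  apply/eqP; rewrite eq_le z0P//= leNgt; apply/negP => h1.
  have h2 : 0 < M - H (Re z0 +i* t) by rewrite subr_gt0.
  have [_ _ _ /(_ _ h2)[s s0 sP]] := FH _ tz.
  have [u uE ut] := inf_adherent s0 hE; have [u0 uM] := uE.
  have tu : t <= u by apply: ge_inf => //; exact: hE.2.
  have := sP (Re z0 +i* u); rewrite ver uM ger0_norm ?subr_ge0// ltrBlDl.
  by move=> /(_ ut); rewrite gtr0_norm// ltxx.
have [|s s0 sP] := argfun_max FH tz.
  by move=> z zp; rewrite tM; exact: z0P.
pose u := t - Num.min s t / 2.
have mn : 0 < Num.min s t by rewrite lt_min s0.
have [ms mt] : Num.min s t <= s /\ Num.min s t <= t by rewrite !ge_min !lexx orbT.
have uE : E u.
  split; first by rewrite /u; clear -mn mt t0; lra.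
  rewrite sP ?tM// ver /u addrAC subrr add0r normrN gtr0_norm ?divr_gt0//.
  by clear -ms mn; lra.
have : t <= u by apply: ge_inf => //; exact: hE.2.
by rewrite /u; clear -mn; lra.
Qed.

End PhragmenLindelof.

(** * Sufficiency *)

Section RationalArgument.
Variable R : realType.
Implicit Types (x y t s k e c : R) (a z w : R[i]) (r : ratfun R).
Implicit Types (p : {poly R[i]}) (u : seq R).

Lemma poly_real_roots p : p != 0 -> (forall z, root p z -> Im z = 0) ->
  exists2 u, p = lead_coef p *: \prod_(c <- u) ('X - c%:C%:P) &
    forall c, mup c%:C p = count_mem c u.
Proof.
move=> p0 pr; have [v vE] := closed_field_poly_normal p.
have l0 : lead_coef p != 0 by rewrite lead_coef_eq0.
have vr z : z \in v -> Im z = 0.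
  by move=> zv; apply: pr; rewrite vE rootZ// root_prod_XsubC.
have vv : v = [seq c%:C | c <- [seq Re z | z <- v]].
  rewrite -map_comp -[LHS]map_id; apply/eq_in_map => z /vr z0 /=.
  exact: real_of_Im0.
exists [seq Re z | z <- v].
  by rewrite {1}vE; congr (_ *: _); rewrite [in LHS]vv big_map.
move=> c; rewrite vE -mul_polyC mupMr ?lead_coefC//.
  rewrite mu_prod_XsubC {1}vv count_map; apply: eq_count => x /=.
  by apply/eqP/eqP => [[]|->].
by rewrite rootC.
Qed.

Definition argsum u z : R := \sum_(c <- u) arg (z - c%:C).

Lemma argsum_cons c u z : argsum (c :: u) z = arg (z - c%:C) + argsum u z.
Proof. by rewrite /argsum big_cons. Qed.

Lemma argsum_circ u z : 0 <= Im z -> (forall c, c \in u -> z != c%:C) ->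
  \prod_(c <- u) (z - c%:C) = circ (normc (\prod_(c <- u) (z - c%:C))) (argsum u z).
Proof.
move=> z0; elim: u => [|c u IH] zu.
  by rewrite /argsum !big_nil normc1 /circ cos0 sin0 mulr1 mulr0.
rewrite argsum_cons big_cons normcM -circM -IH => [|d du]; last first.
  by apply: zu; rewrite inE du orbT.
rewrite -arg_circ//; first by rewrite ImB subr0.
by rewrite subr_eq0 zu// mem_head.
Qed.

Lemma argsum_cont u z e : (forall c, c \in u -> z != c%:C) -> 0 < e ->
  exists2 d : R, 0 < d & forall w, normc (w - z) < d -> `|argsum u w - argsum u z| < e.
Proof.
elim: u e => [|c u IH] e zu e0.
  by exists 1 => // w _; rewrite /argsum !big_nil subrr normr0.
have e2 : 0 < e / 2 by rewrite divr_gt0.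
have [|d d0 dP] := IH _ _ e2; first by move=> x xu; apply: zu; rewrite inE xu orbT.
have zc : z - c%:C != 0 by rewrite subr_eq0 zu// mem_head.
have [d' d'0 d'P] := arg_cont zc e2.
exists (Num.min d d') => [|w]; first by rewrite lt_min d0.
rewrite lt_min => /andP[/dP h1 wd]; rewrite !argsum_cons.
have := d'P (w - c%:C); rewrite opprB addrA subrK => /(_ wd) h2.
rewrite opprD addrACA; apply: le_lt_trans (ler_normD _ _) _; clear -h1 h2; lra.
Qed.

Lemma argsum_bound u z : 0 <= argsum u z <= (size u)%:R * pi.
Proof.
elim: u => [|c u IH]; first by rewrite /argsum big_nil mul0r lexx.
rewrite argsum_cons -natr1 mulrDl mul1r; move: IH => /andP[h1 h2].
have := arg_ge0 (z - c%:C); have := arg_lepi (z - c%:C).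
by clear -h1 h2 => h3 h4; apply/andP; split; lra.
Qed.

(** On the real line [arg (x - d)] is [pi] to the left of [d] and 0 to the right, so near [c] only
    the terms with [d = c] change. *)
Lemma argsum_jump u c : exists s t, 0 < s /\ forall x, `|x - c| < s ->
  x != c \/ c \notin u ->
  argsum u x%:C = t + (if x < c then pi * (count_mem c u)%:R else 0).
Proof.
elim: u => [|d u [s [t [s0 H]]]].
  by exists 1, 0; split=> // x _ _; rewrite /argsum big_nil /= mulr0 if_same addr0.
have [->|dc] := eqVneq d c.
  exists s, t; split=> // x xs; rewrite mem_head => xc.
  have {}xc : x != c by case: xc.
  rewrite argsum_cons H//; last by left.
  rewrite -rmorphB /= eqxx; have [xl|xl] := ltP x c.
    by rewrite arg_neg ?subr_lt0// add1n -natr1; ring.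
  by rewrite arg_pos ?add0r// subr_gt0 lt_neqAle eq_sym xc.
exists (Num.min s `|d - c|), (t + (if c < d then pi else 0)); split.
  by rewrite lt_min s0 normr_gt0 subr_eq0.
move=> x; rewrite lt_min => /andP[xs xd] xu.
rewrite argsum_cons H//=; last by case: xu => [|h]; [left|right; move: h; rewrite inE negb_or => /andP[]].
rewrite (negbTE dc) add0n -rmorphB /=.
suff -> : arg (x - d)%:C = if c < d then pi else 0 by ring.
have [cd|cd] := ltP c d.
  rewrite arg_neg// subr_lt0; move: xd; rewrite (gtr0_norm (x := d - c)) ?subr_gt0//.
  by rewrite ltr_norml => /andP[_ h]; clear -h; lra.
have {}cd : d < c by rewrite lt_neqAle dc.
rewrite arg_pos// subr_gt0; move: xd; rewrite (ltr0_norm (x := d - c)) ?subr_lt0//.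
by rewrite ltr_norml => /andP[h _]; clear -h; lra.
Qed.

Lemma circ_ex z : z != 0 -> exists t, z = circ (normc z) t.
Proof.
move=> zn; have [z0|z0] := leP 0 (Im z); first by exists (arg z); exact: arg_circ.
exists (arg (- z) + pi); have : - z = circ (normc (- z)) (arg (- z)).
  by apply: arg_circ; rewrite ?oppr_eq0// ImN oppr_ge0 ltW.
rewrite normcN; move: (arg _) => t h; rewrite -[LHS]opprK h.
by apply: eq_ReIm; rewrite ?ReN ?ImN /= ?cosDpi ?sinDpi mulrN.
Qed.

Lemma rat_arg r : cond_ii_order r -> rnum r != 0 ->
  exists th : R[i] -> R, exists B : R, exists G : seq R,
  [/\ forall x, x \notin G -> ~~ root (rnum r) x%:C /\ ~~ root (rden r) x%:C,
      forall z, `|th z| <= B,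
      forall z, 0 <= Im z -> ~~ root (rnum r) z -> ~~ root (rden r) z ->
        rfun r z = circ (normc (rfun r z)) (th z),
      forall z e, ~~ root (rnum r) z -> ~~ root (rden r) z -> 0 < e ->
        exists2 d : R, 0 < d & forall w, normc (w - z) < d -> `|th w - th z| < e &
      forall c, exists s t, 0 < s /\ forall x, `|x - c| < s ->
        x != c \/ zero_order r c%:C = 0%N /\ pole_order r c%:C = 0%N ->
        th x%:C = t + (if x < c then
          pi * ((zero_order r c%:C)%:R - (pole_order r c%:C)%:R) else 0)].
Proof.
move=> ho n0; have d0 := rden_neq0 r.
have [u uE uc] : exists2 u, rnum r = lead_coef (rnum r) *: \prod_(c <- u) ('X - c%:C%:P) &
    forall c, zero_order r c%:C = count_mem c u.
  apply: poly_real_roots => // z rz; have [[]//] := ho z.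
  by rewrite /zero_order -XsubC_dvd// dvdp_XsubCl.
have [v vE vc] : exists2 v, rden r = lead_coef (rden r) *: \prod_(c <- v) ('X - c%:C%:P) &
    forall c, pole_order r c%:C = count_mem c v.
  apply: poly_real_roots => // z rz; have [_ []//] := ho z.
  by rewrite /pole_order -XsubC_dvd// dvdp_XsubCl.
have l0 : lead_coef (rnum r) != 0 by rewrite lead_coef_eq0.
have m0 : lead_coef (rden r) != 0 by rewrite lead_coef_eq0.
have hu z : (rnum r).[z] = lead_coef (rnum r) * \prod_(c <- u) (z - c%:C).
  rewrite {1}uE hornerZ horner_prod; congr (_ * _); apply: eq_bigr => c _.
  by rewrite hornerXsubC.
have hv z : (rden r).[z] = lead_coef (rden r) * \prod_(c <- v) (z - c%:C).
  rewrite {1}vE hornerZ horner_prod; congr (_ * _); apply: eq_bigr => c _.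
  by rewrite hornerXsubC.
have ru z : ~~ root (rnum r) z = all (fun c => z != c%:C) u.
  rewrite rootE hu mulf_eq0 (negbTE l0) /= prodf_seq_eq0 -all_predC.
  by apply: eq_all => c /=; rewrite subr_eq0.
have rv z : ~~ root (rden r) z = all (fun c => z != c%:C) v.
  rewrite rootE hv mulf_eq0 (negbTE m0) /= prodf_seq_eq0 -all_predC.
  by apply: eq_all => c /=; rewrite subr_eq0.
have [A AE] : exists A, lead_coef (rnum r) / lead_coef (rden r) =
    circ (normc (lead_coef (rnum r) / lead_coef (rden r))) A.
  by apply: circ_ex; rewrite mulf_neq0 ?invr_eq0.
(* Each linear factor contributes its argument in [0, pi], which gives the bound, and [A] is an
   argument of the quotient of the leading coefficients. *)
exists (fun z => A + (argsum u z - argsum v z)), (`|A| + (size u + size v)%:R * pi), (u ++ v).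
have neqR (x c : R) : (x%:C != c%:C :> R[i]) = (x != c) by rewrite (inj_eq (@complexI R)).
split.
- move=> x; rewrite mem_cat negb_or ru rv => /andP[xu xv]; split; apply/allP => c cu.
    by rewrite neqR; apply: contraNneq xu => ->.
  by rewrite neqR; apply: contraNneq xv => ->.
- move=> z; apply: le_trans (ler_normD _ _) _; rewrite lerD2l natrD mulrDl.
  have /andP[h1 h2] := argsum_bound u z; have /andP[h3 h4] := argsum_bound v z.
  rewrite ler_norml; apply/andP; split; clear -h1 h2 h3 h4; lra.
- move=> z z0; rewrite ru rv => /allP zu /allP zv.
  have E : rfun r z = lead_coef (rnum r) / lead_coef (rden r) *
      (\prod_(c <- u) (z - c%:C) * (\prod_(c <- v) (z - c%:C))^-1).
    by rewrite /rfun hu hv invfM mulrACA.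
  move: AE E; move: (_ / _) => k AE E.
  rewrite E (normcM k) normcM -!circM -AE; congr (_ * (_ * _)); first exact: argsum_circ.
  by rewrite {1}(argsum_circ z0 zv) circV normcV.
- move=> z e; rewrite ru rv => /allP zu /allP zv e0.
  have e2 : 0 < e / 2 by rewrite divr_gt0.
  have [d1 d10 P1] := argsum_cont zu e2; have [d2 d20 P2] := argsum_cont zv e2.
  exists (Num.min d1 d2) => [|w]; first by rewrite lt_min d10.
  rewrite lt_min => /andP[/P1 + /P2].
  rewrite !ltr_norml => /andP[h1 h2] /andP[h3 h4].
  by apply/andP; split; clear -h1 h2 h3 h4; lra.
move=> c; have [s [t [s0 H]]] := argsum_jump u c; have [s' [t' [s'0 H']]] := argsum_jump v c.
exists (Num.min s s'), (A + (t - t')); split; first by rewrite lt_min s0.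
move=> x; rewrite lt_min uc vc => /andP[xs xs'] xc.
have c0 q : count_mem c q = 0%N -> c \notin q.
  by move=> h; rewrite -has_pred1 has_count h.
rewrite H//; last by case: xc => [|[/c0 h _]]; [left|right].
rewrite H'//; last by case: xc => [|[_ /c0 h]]; [left|right].
by case: ifP => _; ring.
Qed.

End RationalArgument.

(** * Sign of [Q] on either side of a zero or pole of [r] *)

Section Sufficiency.
Variable R : realType.
Implicit Types (x y t s k e c q l v : R) (Q : R[i] -> R[i]).
Implicit Types (a z w : R[i]) (r : ratfun R).

Definition regular Q x := rho Q x%:C /\ Re (ext Q x%:C) != 0.

(** [Q] increases on the left of [c], so one positive value is enough. Without any, [nt_lim_left]
    would produce a limit at most 0, against the prescribed one. *)
Lemma left_pos Q c s : nevpos Q -> 0 < s ->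
  (forall x, c - s < x < c -> regular Q x) ->
  (exists2 q, nt_lim Q c q%:C & 0 < q) \/ nt_lim_oo Q c ->
  exists2 s', 0 < s' & forall x, c - s' < x < c -> 0 < Re (ext Q x%:C).
Proof.
move=> nQ s0 H hq.
have [[x0 /andP[xl xr] u0]|nex] := pselect (exists2 x0, c - s < x0 < c & 0 < Re (ext Q x0%:C)).
  exists (c - x0) => [|x]; first by rewrite subr_gt0.
  rewrite opprB addrC subrK => /andP[h1 h2]; apply: lt_le_trans u0 _.
  apply: ext_mono; [exact: nQ.1|exact: ltW|].
  move=> t /andP[t1 t2]; have [] // := H t.
  by rewrite (lt_le_trans xl t1) (le_lt_trans t2 h2).
have neg x : c - s < x < c -> rho Q x%:C /\ Re (ext Q x%:C) <= 0.
  move=> xc; have [rx _] := H x xc; split=> //.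
  by rewrite leNgt; apply/negP => h; apply: nex; exists x.
have [l Ql [l0 _]] := nt_lim_left nQ.1 s0 neg.
case: hq => [[q qQ q0]|oo]; last by have := nt_lim_not_oo Ql oo.
have /(congr1 (@complex.Re R)) /= E := nt_lim_uniq qQ Ql.
by move: q0; rewrite E ltNge l0.
Qed.

Lemma regular_inv Q x : nevpos Q -> regular Q x ->
  regular (fun z => - (Q z)^-1) x /\
  Re (ext (fun z => - (Q z)^-1) x%:C) = - (Re (ext Q x%:C))^-1.
Proof.
move=> nQ [rx u0]; have im := ext_real nQ.1 rx.
have e0 : ext Q x%:C != 0 by apply: contra_neq u0 => ->.
have [rK E] := has_value_ext (has_value_inv (rho_has_value rx) e0).
have E' : Re (ext (fun z => - (Q z)^-1) x%:C) = - (Re (ext Q x%:C))^-1.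
  by rewrite E [ext Q _]real_of_Im0// -RCV -rmorphN.
by split=> //; split=> //; rewrite E' oppr_eq0 invr_eq0.
Qed.

(** Passing to [-1/Q] reduces this to [left_pos]; the limit 0, allowed here, becomes the infinite
    limit allowed there. *)
Lemma left_neg Q c s q : nevpos Q -> 0 < s ->
  (forall x, c - s < x < c -> regular Q x) -> nt_lim Q c q%:C -> q <= 0 ->
  exists2 s', 0 < s' & forall x, c - s' < x < c -> Re (ext Q x%:C) < 0.
Proof.
move=> nQ s0 H Qq q0; have nK := nev_inv nQ.
have [||s' s'0 s'P] := @left_pos (fun z => - (Q z)^-1) c s nK s0.
- by move=> x /H rx; have [] := regular_inv nQ rx.
- have [E|qn] := eqVneq q 0.
    right; have h : nt_lim_oo (fun z => (Q z)^-1) c.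
      apply: nt_lim_oo_inv => [z z0|]; first by apply: nQ.2; exact: lt0r_neq0.
      by move: Qq; rewrite E.
    apply/nt_lim_ooP => M k M0; have [d d0 dP] := (nt_lim_ooP _ _).1 h M k M0.
    by exists d => // z zs zd; rewrite normcN; exact: dP.
  left; exists (- q^-1); last by rewrite oppr_gt0 invr_lt0 lt_neqAle qn.
  rewrite -mulN1r; apply: nt_lim_eq (nt_limZR (k := - 1) (nt_limV qn Qq)) => z.
  by rewrite rmorphN mulN1r.
exists (Num.min s s') => [|x xc]; first by rewrite lt_min s0.
have [mx1 mx2] : Num.min s s' <= s /\ Num.min s s' <= s' by rewrite !ge_min !lexx orbT.
have /andP[h1 h2] := xc.
have := s'P x; rewrite h2 andbT (_ : c - s' < x); last by clear -h1 mx2; lra.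
have [|_ ->] := regular_inv nQ (H x _); first by rewrite h2 andbT; clear -h1 mx1; lra.
by move=> /(_ isT); rewrite oppr_gt0 invr_lt0.
Qed.

Lemma mirrorK Q : (fun z => - - Q (- - z)) = Q.
Proof. by apply/funext => z; rewrite !opprK. Qed.

Lemma nt_lim_mirrorV Q c q : nevanlinna Q -> nt_lim Q c q%:C ->
  nt_lim (fun z => - Q (- z)) (- c) (- q)%:C.
Proof.
move=> nQ h; apply: (@nt_lim_mirror R (fun z => - Q (- z)) (- c) q (nev_mirror nQ)).
rewrite opprK; exact: (eq_ind_r (fun f => nt_lim f c q%:C) h (mirrorK Q)).
Qed.

Lemma nt_lim_oo_mirrorV Q c : nevanlinna Q -> nt_lim_oo Q c ->
  nt_lim_oo (fun z => - Q (- z)) (- c).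
Proof.
move=> nQ h; apply: (@nt_lim_oo_mirror R (fun z => - Q (- z)) (- c) (nev_mirror nQ)).
rewrite opprK; exact: (eq_ind_r (fun f => nt_lim_oo f c) h (mirrorK Q)).
Qed.

Lemma regular_mirror Q x : regular Q x -> regular (fun z => - Q (- z)) (- x) /\
  Re (ext (fun z => - Q (- z)) (- x)%:C) = - Re (ext Q x%:C).
Proof.
move=> [rx u0]; have [rM E] := ext_mirror rx.
by rewrite /regular E ReN oppr_eq0.
Qed.

Lemma right_of_left Q c s (P : R -> Prop) : 0 < s ->
  (forall x, c < x < c + s -> regular Q x) ->
  (exists2 s', 0 < s' & forall x, - c - s' < x < - c ->
     P (- Re (ext (fun z => - Q (- z)) x%:C))) ->
  exists2 s', 0 < s' & forall x, c < x < c + s' -> P (Re (ext Q x%:C)).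
Proof.
move=> s0 H [s' s'0 s'P]; exists (Num.min s s') => [|x /andP[h1 h2]]; first by rewrite lt_min s0.
have [mx1 mx2] : Num.min s s' <= s /\ Num.min s s' <= s' by rewrite !ge_min !lexx orbT.
have [|_ E] := regular_mirror (H x _); first by rewrite h1 /=; clear -h2 mx1; lra.
have := s'P (- x); rewrite E opprK; apply.
by apply/andP; split; [clear -h2 mx2|clear -h1]; lra.
Qed.

Lemma mirror_regular Q c s : (forall x, c < x < c + s -> regular Q x) ->
  forall x, - c - s < x < - c -> regular (fun z => - Q (- z)) x.
Proof.
move=> H x /andP[h1 h2]; have [|h _] := @regular_mirror Q (- x).
  by apply: H; apply/andP; split; [clear -h2|clear -h1]; lra.
by rewrite opprK in h.
Qed.

Lemma right_neg Q c s : nevpos Q -> 0 < s ->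
  (forall x, c < x < c + s -> regular Q x) ->
  (exists2 q, nt_lim Q c q%:C & q < 0) \/ nt_lim_oo Q c ->
  exists2 s', 0 < s' & forall x, c < x < c + s' -> Re (ext Q x%:C) < 0.
Proof.
move=> nQ s0 H hq; apply: (right_of_left (P := fun u => u < 0) s0 H).
have [||s' s'0 s'P] := @left_pos (fun z => - Q (- z)) (- c) s (nevpos_mirror nQ) s0.
- exact: mirror_regular.
- case: hq => [[q hq q0]|oo]; last by right; exact: nt_lim_oo_mirrorV nQ.1 oo.
  by left; exists (- q); [exact: nt_lim_mirrorV nQ.1 hq|rewrite oppr_gt0].
by exists s' => // x /s'P; rewrite oppr_lt0.
Qed.

Lemma right_pos Q c s q : nevpos Q -> 0 < s ->
  (forall x, c < x < c + s -> regular Q x) -> nt_lim Q c q%:C -> 0 <= q ->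
  exists2 s', 0 < s' & forall x, c < x < c + s' -> 0 < Re (ext Q x%:C).
Proof.
move=> nQ s0 H hq q0; apply: (right_of_left (P := fun u => 0 < u) s0 H).
have [|||s' s'0 s'P] := @left_neg (fun z => - Q (- z)) (- c) s (- q) (nevpos_mirror nQ) s0.
- exact: mirror_regular.
- exact: nt_lim_mirrorV nQ.1 hq.
- by rewrite oppr_le0.
by exists s' => // x /s'P; rewrite oppr_gt0.
Qed.

(** Close to [c] the modulus exceeds those at [xl] and [xr]. As [Q] increases, a nonpositive value
    between [xl] and [c] would have modulus at most that at [xl]; likewise on the right. *)
Lemma isolated_pole_signs Q c s : nevanlinna Q -> 0 < s ->
  (forall x, `|x - c| < s -> x != c -> rho Q x%:C) -> isolated_pole Q c%:C ->
  exists2 s', 0 < s' & forall x, `|x - c| < s' ->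
    (x < c -> 0 < Re (ext Q x%:C)) /\ (c < x -> Re (ext Q x%:C) < 0).
Proof.
move=> nQ s0 H [g [g1 g2 g3]].
have /nbhsCP[d1 d10 d1P] := g1; have /nbhsCP[d2 d20 d2P] := g2.
have gQ x : `|x - c| < Num.min d1 d2 -> x != c -> ext Q x%:C = g x%:C.
  move=> xd xc; apply: ext_val; apply/holo_extP.
  have xc' : x%:C - c%:C != 0 :> R[i].
    by rewrite subr_eq0; apply: contra_neq xc => /(congr1 (@complex.Re R)).
  exists (Num.min (normc (x%:C - c%:C)) (Num.min d1 d2 - `|x - c|)).
    by rewrite lt_min normc_gt0 xc' subr_gt0.
  move=> w; rewrite lt_min => /andP[w1 w2].
  have wc : w != c%:C.
    by apply: contraTneq w1 => ->; rewrite normcB ltxx.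
  have wd : normc (w - c%:C) < Num.min d1 d2.
    have := le_normcD (w - x%:C) (x%:C - c%:C); rewrite addrA subrK -rmorphB normcR.
    by move=> /le_lt_trans; apply; rewrite -ltrBrDr.
  move: wd; rewrite lt_min => /andP[h1 h2]; split.
    by apply/holo_atP; exact: d1P.
  by move=> w0; exact: d2P.
have big k : exists2 d : R, 0 < d & forall x, `|x - c| < d -> x != c -> k < `|Re (ext Q x%:C)|.
  have [|d d0 dP] := (nbhsCP _ _).1 (g3 [set u | k < u] _).
    by exists k; split; rewrite ?num_real.
  exists (Num.min s (Num.min d (Num.min d1 d2))); first by rewrite !lt_min s0 d0 d10.
  move=> x; rewrite lt_min => /andP[xs]; rewrite lt_min => /andP[xd xd12] xc.
  have xc' : x%:C != c%:C :> R[i] by apply: contra_neq xc => /(congr1 (@complex.Re R)).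
  have h : k < normc (g x%:C).
    by apply: (dP x%:C) => //; rewrite -rmorphB normcR.
  have im := ext_real nQ (H x xs xc).
  by move: h; rewrite -gQ// [ext Q _]real_of_Im0// normcR.
have [xl xlc] : exists2 xl, c - s < xl & xl < c by exists (c - s / 2); clear -s0; lra.
have [xr xrs] : exists2 xr, c < xr & xr < c + s by exists (c + s / 2); clear -s0; lra.
move=> hxr hxl.
have [d d0 dP] := big (Num.max `|Re (ext Q xl%:C)| `|Re (ext Q xr%:C)|).
exists (Num.min d (Num.min (c - xl) (xr - c))).
  by rewrite !lt_min d0 !subr_gt0 hxl.
move=> x; rewrite !lt_min => /andP[xd /andP[h1 h2]]; split=> xc.
  have := dP x xd; rewrite lt_eqF// gt_max => /(_ isT)/andP[h3 _].
  have xlx : xl <= x by move: h1; rewrite ltr0_norm ?subr_lt0//; clear; lra.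
  have mo : Re (ext Q xl%:C) <= Re (ext Q x%:C).
    apply: ext_mono => // t /andP[t1 t2]; apply: H; last by rewrite lt_eqF// (le_lt_trans t2).
    by rewrite ltr_norml; apply/andP; split; [clear -t1 xlc|clear -t2 xc s0]; lra.
  rewrite ltNge; apply/negP => h4; move: h3; rewrite ltNge => /negP; apply.
  by rewrite (ler0_norm h4) (ler0_norm (le_trans mo h4)) lerN2.
have := dP x xd; rewrite gt_eqF// gt_max => /(_ isT)/andP[_ h3].
have xlx : x <= xr by move: h2; rewrite gtr0_norm ?subr_gt0//; clear; lra.
have mo : Re (ext Q x%:C) <= Re (ext Q xr%:C).
  apply: ext_mono => // t /andP[t1 t2]; apply: H; last by rewrite gt_eqF// (lt_le_trans xc).
  by rewrite ltr_norml; apply/andP; split; [clear -t1 xc s0|clear -t2 hxr]; lra.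
rewrite ltNge; apply/negP => h4; move: h3; rewrite ltNge => /negP; apply.
by rewrite (ger0_norm h4) (ger0_norm (le_trans h4 mo)).
Qed.

Lemma zero_signs Q c s : nevanlinna Q -> has_value Q c%:C 0 ->
  (forall x, `|x - c| < s -> x != c -> regular Q x) -> 0 < s ->
  exists2 s', 0 < s' & forall x, `|x - c| < s' ->
    (x < c -> Re (ext Q x%:C) < 0) /\ (c < x -> 0 < Re (ext Q x%:C)).
Proof.
move=> nQ h0 H s0; have [rc Ec] := has_value_ext h0.
have E0 : Re (ext Q c%:C) = 0 by rewrite Ec.
have rQ t : `|t - c| < s -> rho Q t%:C.
  by have [->//|tc] := eqVneq t c => ts; have [] := H t ts tc.
exists s => // x xs; split=> xc.
  have [_ un] : regular Q x by apply: H => //; rewrite lt_eqF.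
  rewrite lt_neqAle un /= -E0; apply: (ext_mono nQ (ltW xc)) => t /andP[t1 t2]; apply: rQ.
  by move: xs; rewrite !ltr_norml => /andP[h1 h2]; apply/andP; split; [clear -t1 h1|clear -t2 s0]; lra.
have [_ un] : regular Q x by apply: H => //; rewrite gt_eqF.
rewrite lt_neqAle eq_sym un /= -E0; apply: (ext_mono nQ (ltW xc)) => t /andP[t1 t2]; apply: rQ.
by move: xs; rewrite !ltr_norml => /andP[h1 h2]; apply/andP; split; [clear -t1 s0|clear -t2 h2]; lra.
Qed.

(** At exceptional points [D] is uncontrolled, so it is replaced by [V], its constant value around
    each point. [V] is locally constant everywhere, hence has derivative 0. *)
Lemma punctured_const (D : R -> R) (P : R -> Prop) :
  (forall c, exists s v, 0 < s /\
     forall x, `|x - c| < s -> x != c \/ P c -> D x = v) ->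
  exists v, forall x, P x -> D x = v.
Proof.
move=> H.
pose W c := [set v | exists2 s, 0 < s & forall x, `|x - c| < s -> x != c \/ P c -> D x = v].
pose V c := xget 0 (W c).
have VP c : W c (V c).
  have [s [v [s0 sP]]] := H c.
  by rewrite /V; case: xgetP => [v' _ //|/(_ v) []]; exists s.
have Vd c : is_derive c 1 (V : R^o -> R^o) 0.
  have [s s0 sP] := VP c.
  apply: (near_eq_is_derive (f := cst (V c))).
  apply/nbhs_ballP; exists s => //= y; rewrite /ball /= distrC => ys.
  have [s' s'0 s'P] := VP y.
  have k0 : 0 < (if y == c then 1 else `|y - c|).
    by case: eqVneq => // yc; rewrite normr_gt0 subr_eq0.
  set k := (if _ then _ else _) in k0.
  (* The point [y + m] lies in the neighbourhoods of both [y] and [c] and differs from both, so it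
     links [V y] with [V c]. *)
  pose m := Num.min s' (Num.min (s - `|y - c|) k) / 2.
  have mn : 0 < Num.min s' (Num.min (s - `|y - c|) k) by rewrite !lt_min s'0 subr_gt0 ys.
  have m0 : 0 < m by rewrite divr_gt0.
  have : m < Num.min s' (Num.min (s - `|y - c|) k) by rewrite ltr_pdivrMr// ltr_pMr ?ltr1n.
  rewrite !lt_min => /andP[ms /andP[m1 m2]].
  have ym : y + m != y by rewrite -subr_eq0 addrAC subrr add0r gt_eqF.
  have yc : y + m != c.
    move: m2; rewrite /k; case: (eqVneq y c) => [<- _//|yc h].
    apply: contraTneq h => <-; rewrite opprD addrA subrr add0r normrN (gtr0_norm m0) ltxx//.
  change (V c = V y); rewrite -(s'P (y + m))//; last by left.
    rewrite -(sP (y + m))//; last by left.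
    have := ler_normD m (y - c); rewrite (gtr0_norm m0) addrCA addrA => /le_lt_trans; apply.
    by rewrite -ltrBrDr.
  by rewrite addrAC subrr add0r gtr0_norm.
exists (V 0) => x Px; rewrite -(is_derive_0_is_cst x 0 Vd).
have [s s0 sP] := VP x; apply: sP; last by right.
by rewrite subrr normr0.
Qed.

End Sufficiency.

(** * Jumps of the argument prescribed by conditions (i) and (ii) *)

Section Branches.
Variable R : realType.
Implicit Types (x y t s k e c q l v p : R) (Q : R[i] -> R[i]).
Implicit Types (a z w : R[i]) (r : ratfun R).

Lemma rat_local_sign r c : rsymmetric r -> rnum r != 0 ->
  exists l d : R, [/\ l != 0, 0 < d,
    nt_lim (fun z => rfun r z * (z - c%:C) ^+ pole_order r c%:C /
                     (z - c%:C) ^+ zero_order r c%:C) c l%:C &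
    forall x, `|x - c| < d -> x != c \/ pole_order r c%:C = 0%N ->
      ~~ root (rden r) x%:C /\ exists2 p, Re (rfun r x%:C) =
        (x - c) ^+ zero_order r c%:C / (x - c) ^+ pole_order r c%:C * p & 0 < l * p].
Proof.
move=> rs n0; have [L [l [d [k [d0 k0 l0 Ll [LE Lk Li L4]]]]]] := rat_local_real c rs n0.
exists l, d; split=> //.
  apply/nt_limP => M e1 M0 e10; have k1 : 0 < k + 1 by rewrite ltr_wpDl.
  exists (Num.min d (e1 / (k + 1))); first by rewrite lt_min d0 divr_gt0.
  move=> z [z0 _]; rewrite lt_min ltr_pdivlMr// => /andP[zd ze].
  have zc : z != c%:C by apply: contraTneq z0 => ->; rewrite ltxx.
  have [_ ->] := LE z zd (or_introl zc).
  have w0 n : (z - c%:C) ^+ n != 0 by rewrite expf_neq0// subr_eq0.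
  set w1 := _ ^+ zero_order _ _; set w2 := _ ^+ pole_order _ _.
  have -> : w1 / w2 * L z * w2 / w1 = L z by field; rewrite !w0.
  apply: le_lt_trans (Lk z zd) _; apply: le_lt_trans ze.
  by rewrite mulrC ler_wpM2l ?normc_ge0// lerDl.
move=> x xd xc; have xd' : normc (x%:C - c%:C) < d by rewrite -rmorphB normcR.
have [|dx ->] := LE _ xd'.
  by case: xc => h; [left; apply: contra_neq h => /(congr1 (@complex.Re R))|right].
split=> //; exists (Re (L x%:C)).
  by rewrite -rmorphB -!rmorphXn -fmorphV -rmorphM ReRM.
have := le_trans (normc_Re _) (L4 _ xd'); rewrite ReB /=; move: (Re _) => p.
have [lp|ln|E] := ltgtP 0 l; last by rewrite -E eqxx in l0.
  by rewrite (gtr0_norm lp) ler_norml pmulr_rgt0// => /andP[h _]; clear -h lp; lra.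
by rewrite (ltr0_norm ln) ler_norml nmulr_rgt0// => /andP[_ h]; clear -h ln; lra.
Qed.

Definition admissible r Q :=
  [/\ nevpos Q, rsymmetric r, rnum r != 0, cond_i r Q &
      [/\ cond_ii_order r, cond_ii_a r Q & cond_ii_b r Q]].

(** The first half of (i) places [x] in [rho Q], the second excludes the value 0. *)
Lemma neg_regular r Q x : admissible r Q -> ~~ root (rden r) x%:C ->
  Re (rfun r x%:C) < 0 -> regular Q x.
Proof.
move=> [nQ rs n0 [c1 c2] _] dx rx.
have rQ : rho Q x%:C.
  apply: contrapT => nr; have := c1 (Some x) nr; rewrite [omap _ _]/= (rsph_root dx) /ge0_sph.
  by rewrite lecE /= => /andP[_]; rewrite leNgt rx.
split=> //; apply/eqP => u0; apply: (c2 x).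
  by rewrite (rsph_root dx) /lt0_sph ltcE /= rx (rfun_real rs dx) eqxx.
have := rho_has_value rQ; rewrite [ext Q _]real_of_Im0 ?u0//.
exact: ext_real nQ.1 rQ.
Qed.

(* The argument that [r] must take at a point [x] where [r x != 0, oo] for [arg (r Q)]
   to lie in [0, pi]. *)
Definition branch r Q x : R :=
  if 0 <= Re (rfun r x%:C) then 0 else if 0 < Re (ext Q x%:C) then pi else - pi.

Lemma branch0 r Q x : 0 <= Re (rfun r x%:C) -> branch r Q x = 0.
Proof. by rewrite /branch => ->. Qed.

Lemma branch_pi r Q x : Re (rfun r x%:C) < 0 -> 0 < Re (ext Q x%:C) -> branch r Q x = pi.
Proof. by rewrite /branch ltNge => /negbTE -> ->. Qed.

Lemma branch_npi r Q x : Re (rfun r x%:C) < 0 -> Re (ext Q x%:C) < 0 -> branch r Q x = - pi.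
Proof. by rewrite /branch ltNge => /negbTE -> h; rewrite ltNge ltW. Qed.

Definition left_near c (A : R -> Prop) :=
  exists2 s, 0 < s & forall x, c - s < x < c -> A x.

Definition right_near c (A : R -> Prop) :=
  exists2 s, 0 < s & forall x, c < x < c + s -> A x.

Lemma left_near2 c (A B C : R -> Prop) : (forall x, A x -> B x -> C x) ->
  left_near c A -> left_near c B -> left_near c C.
Proof.
move=> ABC [s s0 sP] [s' s'0 s'P]; exists (Num.min s s'); first by rewrite lt_min s0.
move=> x /andP[+ xc]; rewrite ltrBlDr -ltrBlDl lt_min => /andP[h1 h2].
by apply: ABC; [apply: sP|apply: s'P]; rewrite xc ltrBlDr -ltrBlDl ?h1 ?h2.
Qed.

Lemma right_near2 c (A B C : R -> Prop) : (forall x, A x -> B x -> C x) ->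
  right_near c A -> right_near c B -> right_near c C.
Proof.
move=> ABC [s s0 sP] [s' s'0 s'P]; exists (Num.min s s'); first by rewrite lt_min s0.
move=> x /andP[xc]; rewrite -ltrBlDl lt_min => /andP[h1 h2].
by apply: ABC; [apply: sP|apply: s'P]; rewrite xc -ltrBlDl.
Qed.

Lemma jump_of_sides (D : R -> R) (P : Prop) c t t' j : ~ P ->
  left_near c (fun x => D x = t') -> right_near c (fun x => D x = t) -> t' = t + j ->
  exists s t, 0 < s /\ forall x, `|x - c| < s -> x != c \/ P ->
    D x = t + (if x < c then j else 0).
Proof.
move=> nP [s s0 h1] [s' s'0 h2] tE; exists (Num.min s s'), t; split; first by rewrite lt_min s0.
move=> x; rewrite lt_min !ltr_norml => /andP[/andP[a1 a2] /andP[a3 a4]] [xc|/nP//].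
case: (ltgtP x c) xc => // xc _.
  by rewrite h1 ?tE// xc andbT; clear -a1; lra.
by rewrite h2 ?addr0// xc /=; clear -a4; lra.
Qed.

Lemma branch_jump_none r Q c : admissible r Q ->
  zero_order r c%:C = 0%N -> pole_order r c%:C = 0%N ->
  exists s t, 0 < s /\ forall x, `|x - c| < s -> branch r Q x = t.
Proof.
move=> aQ z0 p0; have [nQ rs n0 _ _] := aQ.
have [l [d [l0 d0 _ H]]] := rat_local_sign c rs n0; rewrite z0 p0 in H.
have {}H x : `|x - c| < d -> ~~ root (rden r) x%:C /\ 0 < l * Re (rfun r x%:C).
  by move=> xd; have [|dx [p -> lp]] := H x xd; [right|rewrite !expr0 divr1 mul1r].
have [lp|ln] := ltP 0 l.
  exists d, 0; split=> // x xd; have [_] := H x xd; rewrite pmulr_rgt0// => h.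
  by rewrite branch0// ltW.
have {l0} ln : l < 0 by rewrite lt_neqAle l0.
have neg x : `|x - c| < d -> Re (rfun r x%:C) < 0.
  by move=> xd; have [_] := H x xd; rewrite nmulr_rgt0.
have reg x : `|x - c| < d -> regular Q x.
  by move=> xd; have [dx _] := H x xd; exact: neg_regular aQ dx (neg x xd).
have [|rc uc] := reg c; first by rewrite subrr normr0.
have [D /cder_cont/ccontP cc] := ext_cder rc.
have u0 : 0 < `|Re (ext Q c%:C)| by rewrite normr_gt0.
have [e e0 eP] := cc _ u0.
exists (Num.min d e), (branch r Q c); split; first by rewrite lt_min d0.
move=> x; rewrite lt_min => /andP[xd xe].
have nc : Re (rfun r c%:C) < 0 by apply: neg; rewrite subrr normr0.
have := eP x%:C; rewrite -rmorphB normcR => /(_ xe) /(le_lt_trans (normc_Re _)).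
rewrite ReB ltr_norml => /andP[h1 h2].
have [_ ux] := reg x xd.
have [up|un] := ltP 0 (Re (ext Q c%:C)).
  rewrite (gtr0_norm up) in h1; have ux' : 0 < Re (ext Q x%:C) by clear -h1; lra.
  by rewrite (branch_pi (neg x xd) ux') (branch_pi nc up).
have {}un : Re (ext Q c%:C) < 0 by rewrite lt_neqAle uc.
rewrite (ltr0_norm un) in h2; have ux' : Re (ext Q x%:C) < 0 by clear -h2; lra.
by rewrite (branch_npi (neg x xd) ux') (branch_npi nc un).
Qed.

Lemma nt_lim_unsg l Q c q : l != 0 -> nt_lim (fun z => (Num.sg l)%:C * Q z) c q%:C ->
  nt_lim Q c (Num.sg l * q)%:C.
Proof.
move=> l0 h; apply: nt_lim_eq (nt_limZR (k := Num.sg l) h) => z.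
by rewrite mulrA -rmorphM -expr2 sqr_sg l0 mul1r.
Qed.

Lemma nt_lim_oo_unsg l Q c : l != 0 -> nt_lim_oo (fun z => (Num.sg l)%:C * Q z) c ->
  nt_lim_oo Q c.
Proof.
move=> l0 /nt_lim_ooP h; apply/nt_lim_ooP => M k M0; have [d d0 dP] := h M k M0.
exists d => // z zs zd; have := dP z zs zd.
by rewrite normcM normcR normr_sg l0 mul1r.
Qed.

(** Values of [branch] to the left and to the right of [c]: at a simple zero, [pi] and 0 if [l > 0],
    0 and [- pi] if [l < 0]; at a double zero, [pi] and [- pi]; at a simple pole, [- pi] and 0 if
    [l > 0], 0 and [pi] if [l < 0]; at a double pole, [- pi] and [pi]. The difference is [pi] times
    the order, counted negatively at poles. *)
Lemma branch_jump r Q c : admissible r Q ->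
  exists s t, 0 < s /\ forall x, `|x - c| < s ->
    x != c \/ zero_order r c%:C = 0%N /\ pole_order r c%:C = 0%N ->
    branch r Q x = t + (if x < c then
      pi * ((zero_order r c%:C)%:R - (pole_order r c%:C)%:R) else 0).
Proof.
move=> aQ; have [nQ rs n0 _ [ho ha hb]] := aQ.
have [l [d [l0 d0 hl H]]] := rat_local_sign c rs n0.
have [hz hp] := ho c%:C; have [az ap] := ha c; have [bz bp] := hb c.
have co := coprime_orders r c%:C.
have none := @branch_jump_none r Q c aQ.
have inl x : c - d < x < c -> `|x - c| < d /\ x != c.
  move=> /andP[h1 h2]; rewrite lt_eqF// ltr_norml; split=> //.
  by apply/andP; split; [clear -h1|clear -h2 d0]; lra.
have inr x : c < x < c + d -> `|x - c| < d /\ x != c.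
  move=> /andP[h1 h2]; rewrite gt_eqF// ltr_norml; split=> //.
  by apply/andP; split; [clear -h1 d0|clear -h2]; lra.
have pt x : `|x - c| < d -> x != c -> exists2 p,
    Re (rfun r x%:C) = (x - c) ^+ zero_order r c%:C / (x - c) ^+ pole_order r c%:C * p &
    0 < l * p.
  by move=> xd xc; have [|//] := H x xd; left.
have reg x : `|x - c| < d -> x != c -> Re (rfun r x%:C) < 0 -> regular Q x.
  move=> xd xc; have [|dx _] := H x xd; first by left.
  exact: neg_regular aQ dx.
have rl : (forall x, x < c -> forall p, 0 < l * p ->
      (x - c) ^+ zero_order r c%:C / (x - c) ^+ pole_order r c%:C * p < 0) ->
    left_near c (fun x => Re (rfun r x%:C) < 0) /\ forall x, c - d < x < c -> regular Q x.
  move=> h; have h' x : c - d < x < c -> Re (rfun r x%:C) < 0.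
    move=> /[dup] /andP[_ xc] /inl[xd xn]; have [p -> lp] := pt x xd xn; exact: h.
  by split=> [|x xc]; [exists d|have [xd xn] := inl x xc; apply: reg => //; exact: h'].
have rr : (forall x, c < x -> forall p, 0 < l * p ->
      (x - c) ^+ zero_order r c%:C / (x - c) ^+ pole_order r c%:C * p < 0) ->
    right_near c (fun x => Re (rfun r x%:C) < 0) /\ forall x, c < x < c + d -> regular Q x.
  move=> h; have h' x : c < x < c + d -> Re (rfun r x%:C) < 0.
    move=> /[dup] /andP[xc _] /inr[xd xn]; have [p -> lp] := pt x xd xn; exact: h.
  by split=> [|x xc]; [exists d|have [xd xn] := inr x xc; apply: reg => //; exact: h'].
have zl : (forall x, x < c -> forall p, 0 < l * p ->
      0 < (x - c) ^+ zero_order r c%:C / (x - c) ^+ pole_order r c%:C * p) ->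
    left_near c (fun x => branch r Q x = 0).
  move=> h; exists d => // x /[dup] /andP[_ xc] /inl[xd xn].
  by apply: branch0; have [p -> lp] := pt x xd xn; rewrite ltW// h.
have zr : (forall x, c < x -> forall p, 0 < l * p ->
      0 < (x - c) ^+ zero_order r c%:C / (x - c) ^+ pole_order r c%:C * p) ->
    right_near c (fun x => branch r Q x = 0).
  move=> h; exists d => // x /[dup] /andP[xc _] /inr[xd xn].
  by apply: branch0; have [p -> lp] := pt x xd xn; rewrite ltW// h.
have bpi x := @branch_pi r Q x; have bnpi x := @branch_npi r Q x.
have lsgn : 0 < l \/ l < 0 by case: (ltgtP l 0) l0 => // h _; [right|left].
move: hz hp az ap bz bp co hl none rl rr zl zr; clear H pt reg inl inr.
case: (zero_order r c%:C) => [|[|[|n]]]; last by move=> /(_ isT)[].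
- case: (pole_order r c%:C) => [|[|[|m]]]; last by move=> _ /(_ isT)[].
  + move=> _ _ _ _ _ _ _ _ /(_ erefl erefl)[s [t [s0 sP]]] _ _ _ _.
    by exists s, t; split=> // x xs _; rewrite sP// subrr mulr0 if_same addr0.
  + move=> _ _ _ _ _ /(_ erefl)[l' hl' [q hq q0]] _ hl _ rl rr zl zr.
    (* The limit given by (ii) is the local coefficient of [r], by uniqueness; this ties the sign in
       the condition to the sign of [r] beside [c]. *)
    have E : l' = l.
      have hl2 : nt_lim (fun z => (z - c%:C) * rfun r z) c l%:C.
        by apply: nt_lim_eq hl => z; rewrite expr0 divr1 expr1 mulrC.
      by have /(congr1 (@complex.Re R)) := nt_lim_uniq hl' hl2.
    rewrite E in hq; have {}hq := nt_lim_unsg l0 hq.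
    case: lsgn => ls; rewrite ?(gtr0_sg ls) ?(ltr0_sg ls) in hq.
      have [|neg regl] := rl.
        by move=> x xc p; rewrite pmulr_rgt0// => pp; rewrite mul1r pmulr_llt0// invr_lt0 subr_lt0.
      apply: (@jump_of_sides _ _ c 0 (- pi)); first by case.
      - apply: left_near2 bnpi neg (left_neg nQ d0 regl hq _).
        by rewrite mul1r.
      - apply: zr => x xc p; rewrite pmulr_rgt0// => pp.
        by rewrite mul1r mulr_gt0// invr_gt0 subr_gt0.
      - by rewrite sub0r mulrN mulr1 add0r.
    have [|neg regr] := rr.
      by move=> x xc p; rewrite nmulr_rgt0// => pn; rewrite mul1r nmulr_llt0// invr_gt0 subr_gt0.
    apply: (@jump_of_sides _ _ c pi 0); first by case.
    - apply: zl => x xc p; rewrite nmulr_rgt0// => pn.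
      by rewrite mul1r nmulr_lgt0// invr_lt0 subr_lt0.
    - apply: right_near2 bpi neg (right_pos nQ d0 regr hq _).
      by rewrite mulN1r oppr_ge0.
    - by rewrite sub0r mulrN mulr1 subrr.
  + move=> _ _ _ /(_ erefl)[hz0 [l' hl' l'0]] _ _ _ hl _ rl rr _ _.
    have E : l' = l.
      have hl2 : nt_lim (fun z => (z - c%:C) ^+ 2 * rfun r z) c l%:C.
        by apply: nt_lim_eq hl => z; rewrite expr0 divr1 mulrC.
      by have /(congr1 (@complex.Re R)) := nt_lim_uniq hl' hl2.
    have ls : l < 0 by rewrite -E.
    have sq x p : x != c -> 0 < l * p -> (x - c) ^+ 0 / (x - c) ^+ 2 * p < 0.
      rewrite nmulr_rgt0// => xc pn.
      by rewrite mul1r nmulr_llt0// invr_gt0 exprn_even_gt0//= subr_eq0.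
    have [|negl regl] := rl; first by move=> x xc p; apply: sq; rewrite lt_eqF.
    have [|negr regr] := rr; first by move=> x xc p; apply: sq; rewrite gt_eqF.
    have [||s s0 sP] := @zero_signs R Q c d nQ.1 hz0.
    - move=> x; rewrite ltr_norml => /andP[h1 h2] xc.
      case: (ltgtP x c) xc => // xc _; [apply: regl|apply: regr]; rewrite xc ?andbT /=.
        by clear -h1; lra.
      by clear -h2; lra.
    - exact: d0.
    apply: (@jump_of_sides _ _ c pi (- pi)); first by case.
    - apply: left_near2 bnpi negl _; exists s => // x /andP[h1 xc].
      apply: (sP x _).1 => //; rewrite ltr_norml; apply/andP; split.
        by clear -h1; lra.
      by clear -xc s0; lra.
    - apply: right_near2 bpi negr _; exists s => // x /andP[xc h1].
      apply: (sP x _).2 => //; rewrite ltr_norml; apply/andP; split.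
        by clear -xc s0; lra.
      by clear -h1; lra.
    - by ring.
- move=> _ _ _ _ /(_ erefl)[l' hl' hq] _ [//|po]; rewrite po => hl _ rl rr zl zr.
  have E : l' = l.
    have hl2 : nt_lim (fun z => rfun r z / (z - c%:C)) c l%:C.
      by apply: nt_lim_eq hl => z; rewrite expr0 mulr1 expr1.
    by have /(congr1 (@complex.Re R)) := nt_lim_uniq hl' hl2.
  rewrite E in hq.
  have {}hq : (exists2 q, nt_lim Q c (Num.sg l * q)%:C & 0 < q) \/ nt_lim_oo Q c.
    case: hq => [[q hq q0]|hq]; last by right; exact: nt_lim_oo_unsg hq.
    by left; exists q; [exact: nt_lim_unsg l0 hq|exact: q0].
  case: lsgn => ls; rewrite ?(gtr0_sg ls) ?(ltr0_sg ls) in hq.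
    have [|neg regl] := rl.
      by move=> x xc p; rewrite pmulr_rgt0// => pp; rewrite divr1 pmulr_llt0// subr_lt0.
    apply: (@jump_of_sides _ _ c 0 pi); first by case.
    - apply: left_near2 bpi neg (left_pos nQ d0 regl _).
      by case: hq => [[q hq q0]|hq]; [left; exists q; rewrite ?mul1r in hq *|right].
    - apply: zr => x xc p; rewrite pmulr_rgt0// => pp.
      by rewrite divr1 mulr_gt0// subr_gt0.
    - by rewrite subr0 mulr1 add0r.
  have [|neg regr] := rr.
    by move=> x xc p; rewrite nmulr_rgt0// => pn; rewrite divr1 nmulr_llt0// subr_gt0.
  apply: (@jump_of_sides _ _ c (- pi) 0); first by case.
  - apply: zl => x xc p; rewrite nmulr_rgt0// => pn.
    by rewrite divr1 nmulr_lgt0// subr_lt0.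
  - apply: right_near2 bnpi neg (right_neg nQ d0 regr _).
    case: hq => [[q hq q0]|hq]; [left; exists (- q)|right]; rewrite ?mulN1r in hq * => //.
    by rewrite oppr_lt0.
  - by rewrite subr0 mulr1 addNr.
move=> _ _ /(_ erefl)[hz0 [l' hl' l'0]] _ _ _ [//|po]; rewrite po => hl _ rl rr _ _.
have E : l' = l.
  have hl2 : nt_lim (fun z => rfun r z / (z - c%:C) ^+ 2) c l%:C.
    by apply: nt_lim_eq hl => z; rewrite expr0 mulr1.
  by have /(congr1 (@complex.Re R)) := nt_lim_uniq hl' hl2.
have ls : l < 0 by rewrite -E.
have sq x p : x != c -> 0 < l * p -> (x - c) ^+ 2 / (x - c) ^+ 0 * p < 0.
  rewrite nmulr_rgt0// => xc pn.
  by rewrite divr1 nmulr_llt0// exprn_even_gt0//= subr_eq0.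
have [|negl regl] := rl; first by move=> x xc p; apply: sq; rewrite lt_eqF.
have [|negr regr] := rr; first by move=> x xc p; apply: sq; rewrite gt_eqF.
have [|s s0 sP] := @isolated_pole_signs R Q c d nQ.1 d0 _ hz0.
  move=> x; rewrite ltr_norml => /andP[h1 h2] xc.
  case: (ltgtP x c) xc => // xc _; [have [] // := regl x|have [] // := regr x].
    by rewrite xc andbT; clear -h1; lra.
  by rewrite xc /=; clear -h2; lra.
apply: (@jump_of_sides _ _ c (- pi) pi); first by case.
- apply: left_near2 bpi negl _; exists s => // x /andP[h1 xc].
  apply: (sP x _).1 => //; rewrite ltr_norml; apply/andP; split.
    by clear -h1; lra.
  by clear -xc s0; lra.
- apply: right_near2 bnpi negr _; exists s => // x /andP[xc h1].
  apply: (sP x _).2 => //; rewrite ltr_norml; apply/andP; split.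
    by clear -xc s0; lra.
  by clear -h1; lra.
- by ring.
Qed.

End Branches.

(** * The argument of [r Q] in the upper half-plane *)

Section ArgumentOfProduct.
Variable R : realType.
Implicit Types (x y t s k e c q l v p : R) (Q : R[i] -> R[i]).
Implicit Types (a z w : R[i]) (r : ratfun R).

Lemma order_nonroot r z : cond_ii_order r -> rnum r != 0 -> Im z != 0 ->
  ~~ root (rnum r) z /\ ~~ root (rden r) z.
Proof.
move=> ho n0 z0; split; apply: contra_neqN z0 => rz.
  have [h _] := ho z; have [|//] := h.
  by rewrite /zero_order -XsubC_dvd// dvdp_XsubCl.
have [_ h] := ho z; have [|//] := h.
by rewrite /pole_order -XsubC_dvd ?rden_neq0// dvdp_XsubCl.
Qed.

Lemma cder_rfun r z : ~~ root (rden r) z -> exists d, cder (rfun r) z d.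
Proof.
move=> dz; have [n' nn] := cder_poly (rnum r) z; have [d' dd] := cder_poly (rden r) z.
by eexists; apply: cderM; [exact: nn|apply: cderV; [exact: dz|exact: dd]].
Qed.

Lemma rfun_branch r Q x : rsymmetric r -> ~~ root (rden r) x%:C ->
  rfun r x%:C = circ (normc (rfun r x%:C)) (branch r Q x).
Proof.
move=> rs dx; have im := rfun_real rs dx.
rewrite [X in normc X](real_of_Im0 im) normcR; apply: eq_ReIm; rewrite ?im /= /branch.
  case: (leP 0 (Re (rfun r x%:C))) => h; first by rewrite cos0 mulr1 ger0_norm.
  by rewrite ltr0_norm//; case: ifP => _; rewrite ?cosN cospi mulrN1 opprK.
by case: ifP => _; [|case: ifP => _]; rewrite ?sinN ?sin0 ?sinpi ?oppr0 mulr0.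
Qed.

Lemma sufficiency r Q : admissible r Q -> nevanlinna (fun z => rfun r z * Q z).
Proof.
move=> aQ; have [nQ rs n0 _ [ho _ _]] := aQ.
have [th [B [G [hG hB hE hC hJ]]]] := rat_arg ho n0.
(* The jumps of [th] and of [branch] agree at every point, so their difference is locally constant
   off the zeros and poles and extends across them. *)
have [v vP] : exists v, forall x, zero_order r x%:C = 0%N /\ pole_order r x%:C = 0%N ->
    th x%:C - branch r Q x = v.
  apply: punctured_const => c; have [s [t [s0 h]]] := hJ c.
  have [s' [t' [s'0 h']]] := branch_jump c aQ.
  exists (Num.min s s'), (t - t'); split; first by rewrite lt_min s0.
  by move=> x; rewrite lt_min => /andP[xs xs'] xc; rewrite h// h'//; ring.
have th_v x : ~~ root (rnum r) x%:C -> ~~ root (rden r) x%:C -> th x%:C = branch r Q x + v.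
  by move=> nx dx; rewrite -(vP x) ?subrKC//; split; exact: mupNroot.
(* At any real point off the zeros and poles both [th] and [branch] are arguments of [r], so [v] is
   a multiple of [2 * pi]. *)
have v1 : circ 1 v = 1.
  have nd : rnum r * rden r != 0 by rewrite mulf_neq0// rden_neq0.
  have [d d0 [_ dP]] := nonroot_near 0 nd (ltr01 : 0 < (1 : R)).
  have d2 : 0 < d / 2 by rewrite divr_gt0.
  have := dP (d / 2)%:C; rewrite subr0 normcR gtr0_norm// ltr_pdivrMr// ltr_pMr// ltr1n.
  have x0 : (d / 2)%:C != 0 :> R[i] by apply: contra_neq (lt0r_neq0 d2) => /(congr1 (@complex.Re R)).
  move=> /(_ isT x0); rewrite rootM negb_or => /andP[nx dx].
  have r0 : rfun r (d / 2)%:C != 0 by rewrite /rfun mulf_neq0 ?invr_eq0.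
  have im0 : 0 <= Im ((d / 2)%:C : R[i]) by [].
  have := hE _ im0 nx dx; rewrite th_v// -[normc _]mulr1 -circM -rfun_branch// => h.
  by apply: (mulfI r0); rewrite mulr1 -h.
have nr z : 0 < Im z -> ~~ root (rnum r) z /\ ~~ root (rden r) z.
  by move=> z0; apply: order_nonroot => //; exact: lt0r_neq0.
have Ar : argfun (rfun r) th.
  move=> z z0; have [nz dz] := nr z z0; split.
  - by rewrite /rfun mulf_neq0 ?invr_eq0.
  - exact: cder_rfun.
  - by apply: hE => //; exact: ltW.
  - by move=> e; exact: hC.
pose h z := arg (Q z) + th z - v.
have Ah : argfun (fun z => Q z * rfun r z * circ 1 (- v)) h.
  exact: argfunM (argfunM (argfun_nev nQ) Ar) (argfun_cst (- v)).
(* Where [r >= 0], [h] is close to [arg (Q z)]. Where [r < 0], it tends to [pi] if [Q > 0], namely 0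
   plus [pi], and to 0 if [Q < 0], namely [pi] minus [pi]. *)
have bd x : x \notin G -> forall e, 0 < e -> exists2 d : R, 0 < d &
    forall z, 0 < Im z -> normc (z - x%:C) < d -> - e <= h z <= pi + e.
  move=> xG e e0; have [nx dx] := hG x xG; have e2 : 0 < e / 2 by rewrite divr_gt0.
  have [d d0 dP] := hC _ _ nx dx e2.
  have [r0|r0] := leP 0 (Re (rfun r x%:C)).
    exists d => // z z0 /dP; rewrite th_v// branch0// add0r ltr_norml => /andP[h1 h2].
    have := arg_ge0 (Q z); have := arg_lepi (Q z); rewrite /h => a1 a2.
    by apply/andP; split; [clear -h1 a2 e0|clear -h2 a1 e0]; lra.
  have [rx ux] := neg_regular aQ dx r0.
  have im := ext_real nQ.1 rx.
  have ex0 : ext Q x%:C != 0 by apply: contra_neq ux => ->.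
  have [d1 d10 d1P] := arg_cont ex0 e2.
  have [D /cder_cont/ccontP/(_ _ d10)[d2 d20 d2P]] := ext_cder rx.
  exists (Num.min d d2) => [|z z0]; first by rewrite lt_min d0.
  rewrite lt_min => /andP[/dP + /d2P /d1P]; rewrite th_v// extE ?lt0r_neq0//.
  rewrite !ltr_norml => /andP[h1 h2] /andP[h3 h4]; rewrite /h.
  have [up|un] := ltP 0 (Re (ext Q x%:C)).
    rewrite branch_pi// in h1 h2; rewrite (real_of_Im0 im) arg_pos// in h3 h4.
    have := pi_gt0 R => p0.
    by apply/andP; split; [clear -h1 h3 p0 e0|clear -h2 h4]; lra.
  have {}un : Re (ext Q x%:C) < 0 by rewrite lt_neqAle ux.
  rewrite branch_npi// in h1 h2; rewrite (real_of_Im0 im) arg_neg// in h3 h4.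
  have := pi_gt0 R => p0.
  by apply/andP; split; [clear -h1 h3|clear -h2 h4 p0 e0]; lra.
have hb z : `|h z| <= pi + B + `|v|.
  have := hB z; have := arg_ge0 (Q z); have := arg_lepi (Q z); have := ler_norm v.
  have := ler_norm (- v); rewrite normrN /h !ler_norml => a1 a2 a3 a4 /andP[a5 a6].
  by apply/andP; split; [clear -a2 a4 a5 a3|clear -a1 a3 a6]; have := pi_gt0 R; lra.
(* The two bounds on [h] come from the same principle, applied to [h - pi] and to [- h], which are
   arguments as well. *)
have up z : 0 < Im z -> h z - pi <= 0.
  apply: (@argfun_le0 R _ (fun z => h z - pi) (pi + B + `|v|) G).
  - exact: argfunM Ah (argfun_cst (- pi)).
  - move=> w _; have := le_trans (ler_norm _) (hb w); have := pi_gt0 R; clear; lra.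
  - move=> x xG e e0; have [d d0 dP] := bd x xG e e0; exists d => // w w0 /(dP w w0)/andP[_ k].
    by clear -k; lra.
have low z : 0 < Im z -> - h z <= 0.
  apply: (@argfun_le0 R _ (fun z => - h z) (pi + B + `|v|) G).
  - exact: argfunV Ah.
  - by move=> w _; have := hb w; rewrite ler_norml => /andP[k _]; rewrite lerNl.
  - move=> x xG e e0; have [d d0 dP] := bd x xG e e0; exists d => // w w0 /(dP w w0)/andP[k _].
    by rewrite lerNl.
have pos z : 0 < Im z -> 0 <= Im (rfun r z * Q z).
  move=> z0; have [_ _ e1 _] := Ar z z0; have [_ _ e2 _] := argfun_nev nQ z0.
  have -> : rfun r z * Q z = circ (normc (rfun r z) * normc (Q z)) (h z).
    rewrite {1}e1 {1}e2 circM -[RHS]mulr1 -v1 circM mulr1; congr circ; rewrite /h; ring.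
  rewrite /= mulr_ge0 ?mulr_ge0 ?normc_ge0//; apply: sin_ge0_pi.
  by have := up z z0; have := low z z0; rewrite oppr_le0 subr_le0 => -> ->.
have sym z : Im z != 0 -> rfun r z^* * Q z^* = (rfun r z * Q z)^*.
  move=> z0; have [_ dz] := order_nonroot ho n0 z0; have [_ ->] := rsym_rfun rs dz.
  by rewrite (nev_sym nQ.1 z0) conjcM.
split.
- move=> z z0; apply/holo_atP; have [_ dz] := order_nonroot ho n0 z0.
  have [d rd] := cder_rfun dz; have [d' qd] := nev_cder nQ.1 z0.
  by eexists; apply: cderM; [exact: rd|exact: qd].
- by move=> z z0; exact: sym.
move=> z z0; case: (Im_conj_gt0 z0) => zp; first by rewrite divr_ge0 ?pos// ltW.
have := pos _ zp; rewrite sym// ImJ; move: zp; rewrite ImJ => zp.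
move=> h1; rewrite -[Im z]opprK invrN mulrN -mulNr divr_ge0// ltW//.
Qed.

End ArgumentOfProduct.

Theorem theorem4p12 (R : realType) (Q0 : R[i]%C -> R[i]%C) (r : ratfun R)
    (Q0_nev : nevanlinna Q0)
    (Q0_neq0 : exists2 z, nonreal z & (Q0 z <> 0)%R)
    (r_sym : rsymmetric r)
    (r_deg : (0 < rdeg r)%N) :
  N00 r Q0 <->
  [/\ cond_i r Q0, cond_ii_order r, cond_ii_a r Q0 & cond_ii_b r Q0].
Proof.
have nQ := nev_neq0 Q0_nev Q0_neq0; have n0 := rnum_neq0 r_deg.
split=> [[_ [F nF FE]]|[hi ho ha hb]].
  have mQ := multiplier_N00 nQ r_sym n0 nF FE.
  by split; [exact: necessity_i mQ|exact: necessity_order mQ|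
             exact: necessity_a mQ|exact: necessity_b mQ].
split=> //; exists (fun z => rfun r z * Q0 z) => //.
by apply: sufficiency; split.
Qed.
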